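(* For the manifold structure on $\mathcal{M}(\mathbb{B})$ for which the bijection $\mathrm{Sp}(1,1)/\mathrm{Sp}(1)I_2\to\mathcal{M}(\mathbb{B})$, $A\,\mathrm{Sp}(1)I_2\mapsto\mathcal{F}_{A^{-1}}$, is a diffeomorphism, the evaluation map $$\mathcal{M}(\mathbb{B})\times\mathbb{B}\to\mathbb{B},\qquad(\mathcal{F},q)\mapsto\mathcal{F}(q),$$ is smooth. Furthermore, the following properties hold. \begin{enumerate} \item Transitivity: for every $p,q\in\mathbb{B}$ there exists $\mathcal{F}\in\mathcal{M}(\mathbb{B})$ such that $\mathcal{F}(p)=q$. \item Isotropy at $0$: the family $\mathcal{M}(\mathbb{B})_0=\{\mathcal{F}\in\mathcal{M}(\mathbb{B}):\mathcal{F}(0)=0\}$ is given by $\mathcal{M}(\mathbb{B})_0=\{R_u:u\in\mathrm{Sp}(1)\}$, where $R_u(q)=qu$ for $q\in\mathbb{B}$. \item Structure of the isotropy at $0$: $\mathcal{M}(\mathbb{B})_0$ is a compact submanifold of $\mathcal{M}(\mathbb{B})$ and a Lie group for this manifold structure together with the composition of maps. Furthermore, the assignment $\rho:\mathrm{Sp}(1)\to\mathcal{M}(\mathbb{B})_0$, $u\mapsto R_{u^{-1}}$, is an isomorphism of Lie groups. \end{enumerate}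
   Context: $\mathbb{H}$ denotes the quaternions and $\mathbb{B}=\{q\in\mathbb{H}: |q|<1\}$. $\mathrm{Sp}(1,1)=\{A\in M_2(\mathbb{H}): A^*I_{1,1}A=I_{1,1}\}$ with $I_{1,1}=\operatorname{diag}(1,-1)$, a Lie group. $\mathrm{Sp}(1)=\{q\in\mathbb{H}:|q|=1\}$, and $\mathrm{Sp}(1)I_2=\{uI_2:u\in\mathrm{Sp}(1)\}$, a closed subgroup of $\mathrm{Sp}(1,1)$. The coset space $\mathrm{Sp}(1,1)/\mathrm{Sp}(1)I_2$ carries the unique manifold structure for which the quotient map from $\mathrm{Sp}(1,1)$ is a submersion. A function $f:\mathbb{B}\to\mathbb{H}$ is (left) slice regular if for every $I\in\mathbb{H}$ with $I^2=-1$ one has $\frac12\left(\frac{\partial}{\partial x}+I\frac{\partial}{\partial y}\right)f(x+Iy)=0$ whenever $x,y\in\mathbb{R}$, $x+yI\in\mathbb{B}$. Such functions have power series expansions $f(q)=\sum_n q^na_n$ on $\mathbb{B}$. For $f(q)=\sum q^na_n$ and $g(q)=\sum q^nb_n$, the $*$-product is $(f*g)(q)=\sum_n q^n\sum_{k=0}^n a_kb_{n-k}$; the regular conjugate is $f^c(q)=\sum q^n\overline{a_n}$; the symmetrization is $f^s=f*f^c$; the $*$-reciprocal is $f^{-*}(q)=f^s(q)^{-1}f^c(q)$ off the zero set of $f^s$. For $a,b\in\mathbb{H}$ let $l_{(a,b)}(q)=qa+b$. For $A=\begin{pmatrix}a&c\\ b&d\end{pmatrix}\in\mathrm{Sp}(1,1)$,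 the slice regular M\''obius transformation $\mathcal{F}_A:\mathbb{B}\to\mathbb{B}$ is $\mathcal{F}_A=l_{(c,d)}^{-*}*l_{(a,b)}$, written $\mathcal{F}_A(q)=(qc+d)^{-*}*(qa+b)$. Set $\mathcal{M}(\mathbb{B})=\{\mathcal{F}_A:A\in\mathrm{Sp}(1,1)\}$. (Each $\mathcal{F}_A$ is a well defined slice regular bijection of $\mathbb{B}$ onto itself.) *)

(* Defs.v *)
From HB Require Import structures.
From mathcomp Require Import all_boot all_order all_algebra.
From mathcomp Require Import ring lra.
From mathcomp Require Import all_classical all_reals all_analysis.
Set Implicit Arguments.
Unset Strict Implicit.
Unset Printing Implicit Defensive.
Import Order.TTheory GRing.Theory Num.Theory.
Import numFieldNormedType.Exports.
Local Open Scope classical_set_scope.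
Local Open Scope ring_scope.

(* x0 + x1 i + x2 j + x3 k is the row (x0, x1, x2, x3).  The topology and the
   real vector space structure are those of 'rV[R]_4; the inherited library
   norm `|q| is the sup norm of the coordinates, so the modulus of a quaternion
   is qnorm below (it induces the same topology). *)
Definition quat (R : realType) : Type := 'rV[R]_4.

HB.instance Definition _ (R : realType) :=
  NormedModule.copy (quat R) 'rV[R]_4.

Section QuaternionRing.
Variable R : realType.
Implicit Types p q r : quat R.

Definition qcoord q (i : nat) : R := (q : 'rV[R]_4) ord0 (inord i).

Definition mkquat (a b c d : R) : quat R := \row_(i < 4) [:: a; b; c; d]`_i.

Definition quat_one : quat R := mkquat 1 0 0 0.

Definition quat_mul p q : quat R :=
  let a := qcoord p in let b := qcoord q in
  mkquat (a 0%N * b 0%N - a 1%N * b 1%N - a 2%N * b 2%N - a 3%N * b 3%N)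
         (a 0%N * b 1%N + a 1%N * b 0%N + a 2%N * b 3%N - a 3%N * b 2%N)
         (a 0%N * b 2%N - a 1%N * b 3%N + a 2%N * b 0%N + a 3%N * b 1%N)
         (a 0%N * b 3%N + a 1%N * b 2%N - a 2%N * b 1%N + a 3%N * b 0%N).

Definition qconj q : quat R :=
  mkquat (qcoord q 0) (- qcoord q 1) (- qcoord q 2) (- qcoord q 3).

Definition qnorm q : R := Num.sqrt (\sum_(i < 4) qcoord q i ^+ 2).

Lemma qcoord_mk a b c d i : (i < 4)%N ->
  qcoord (mkquat a b c d) i = [:: a; b; c; d]`_i.
Proof. by move=> i4; rewrite /qcoord /mkquat mxE inordK. Qed.

Lemma quat_ext p q :
  qcoord p 0 = qcoord q 0 -> qcoord p 1 = qcoord q 1 ->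
  qcoord p 2 = qcoord q 2 -> qcoord p 3 = qcoord q 3 -> p = q.
Proof.
move=> h0 h1 h2 h3; apply/rowP => i.
have -> : i = inord (val i) by rewrite inord_val.
by case: i => -[|[|[|[|]]]].
Qed.

Lemma qcoordD p q i : qcoord (p + q) i = qcoord p i + qcoord q i.
Proof. by rewrite /qcoord mxE. Qed.

Lemma qcoord0 i : qcoord 0 i = 0.
Proof. by rewrite /qcoord mxE. Qed.

Lemma quat_mulA : associative quat_mul.
Proof.
by move=> p q r; apply: quat_ext; rewrite /quat_mul !qcoord_mk //=; ring.
Qed.

Lemma quat_mul1q : left_id quat_one quat_mul.
Proof.
by move=> p; apply: quat_ext; rewrite /quat_mul /quat_one !qcoord_mk //=; ring.
Qed.

Lemma quat_mulq1 : right_id quat_one quat_mul.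
Proof.
by move=> p; apply: quat_ext; rewrite /quat_mul /quat_one !qcoord_mk //=; ring.
Qed.

Lemma quat_mulDl : left_distributive quat_mul +%R.
Proof.
move=> p q r; apply: quat_ext;
  by rewrite qcoordD /quat_mul !qcoord_mk //= !qcoordD; ring.
Qed.

Lemma quat_mulDr : right_distributive quat_mul +%R.
Proof.
move=> p q r; apply: quat_ext;
  by rewrite qcoordD /quat_mul !qcoord_mk //= !qcoordD; ring.
Qed.

Lemma quat_one_neq0 : quat_one != 0 :> quat R.
Proof.
apply/eqP => /(congr1 (qcoord ^~ 0%N)) /eqP.
by rewrite /quat_one qcoord_mk // qcoord0 oner_eq0.
Qed.

End QuaternionRing.

HB.instance Definition _ (R : realType) :=
  GRing.Zmodule_isNzRing.Build (quat R) (@quat_mulA R) (@quat_mul1q R)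
    (@quat_mulq1 R) (@quat_mulDl R) (@quat_mulDr R) (@quat_one_neq0 R).

Section QuaternionInverse.
Variable R : realType.
Implicit Types p q : quat R.

Let nsq q : R :=
  qcoord q 0 ^+ 2 + qcoord q 1 ^+ 2 + qcoord q 2 ^+ 2 + qcoord q 3 ^+ 2.

Lemma qnorm_sqr q : qnorm q ^+ 2 = nsq q.
Proof.
rewrite sqr_sqrtr; last by apply: sumr_ge0 => i _; exact: sqr_ge0.
by rewrite !big_ord_recl big_ord0 addr0 !addrA.
Qed.

Lemma nsq_eq0 q : nsq q = 0 -> q = 0.
Proof.
rewrite /nsq => h; apply: quat_ext; rewrite qcoord0; nra.
Qed.

Definition quat_inv q : quat R := (qnorm q ^- 2) *: (qconj q : 'rV[R]_4).

Lemma qcoordZ (a : R) q i : qcoord (a *: (q : 'rV[R]_4)) i = a * qcoord q i.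
Proof. by rewrite /qcoord mxE. Qed.

Lemma quat_mulE p q : p * q = quat_mul p q. Proof. by []. Qed.

Lemma quat_mulVq : {in [pred q | q != 0], left_inverse 1 quat_inv *%R}.
Proof.
move=> q /= q0.
have n0 : nsq q != 0 by apply: contraNneq q0 => /nsq_eq0 ->.
rewrite quat_mulE /quat_inv qnorm_sqr.
by apply: quat_ext; rewrite /quat_mul /qconj qcoord_mk //= !qcoordZ
  !qcoord_mk //=; move: n0; rewrite /nsq => n0; field.
Qed.

Lemma quat_mulqV : {in [pred q | q != 0], right_inverse 1 quat_inv *%R}.
Proof.
move=> q /= q0.
have n0 : nsq q != 0 by apply: contraNneq q0 => /nsq_eq0 ->.
rewrite quat_mulE /quat_inv qnorm_sqr.
by apply: quat_ext; rewrite /quat_mul /qconj qcoord_mk //= !qcoordZ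
  !qcoord_mk //=; move: n0; rewrite /nsq => n0; field.
Qed.

Lemma quat_unitP p q : q * p = 1 /\ p * q = 1 -> p != 0.
Proof.
by case=> qp1 _; apply: contra_eqN qp1 => /eqP ->; rewrite mulr0 eq_sym oner_eq0.
Qed.

Lemma quat_inv0 : {in [predC [pred q : quat R | q != 0]], quat_inv =1 id}.
Proof.
move=> q; rewrite !inE /= negbK => /eqP ->.
by apply: quat_ext; rewrite qcoordZ /qconj qcoord_mk //= !qcoord0 ?oppr0 mulr0.
Qed.

End QuaternionInverse.

HB.instance Definition _ (R : realType) :=
  GRing.NzRing_hasMulInverse.Build (quat R) (@quat_mulVq R) (@quat_mulqV R)
    (@quat_unitP R) (@quat_inv0 R).

Section SmoothManifolds.
Variable R : realType.

(* C^k on an open set U: every iterated directional derivative of order < k is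
   (Frechet) differentiable, those of order k are continuous. *)
Fixpoint Ck_on {m n : nat} (k : nat) (U : set 'rV[R]_m)
    (f : 'rV[R]_m -> 'rV[R]_n) : Prop :=
  match k with
  | 0%N => forall x, U x -> {for x, continuous f}
  | k'.+1 => (forall x, U x -> differentiable f x) /\
             (forall v, Ck_on k' U (fun x => 'D_v f x))
  end.

Definition smooth_on {m n : nat} (U : set 'rV[R]_m)
    (f : 'rV[R]_m -> 'rV[R]_n) : Prop := forall k, Ck_on k U f.

(* A chart is a pair (domain, coordinate map); the values of the coordinate map
   off the domain are irrelevant. *)
Definition chart (T : Type) (n : nat) : Type := (set T * (T -> 'rV[R]_n))%type.
Definition cdom T n (c : chart T n) : set T := c.1.
Definition cmap T n (c : chart T n) : T -> 'rV[R]_n := c.2.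

Definition is_chart T n (c : chart T n) : Prop :=
  {in cdom c &, injective (cmap c)} /\ open (cmap c @` cdom c).

Definition smooth_transition T n (c d : chart T n) : Prop :=
  open (cmap c @` (cdom c `&` cdom d)) /\
  exists g : 'rV[R]_n -> 'rV[R]_n,
    smooth_on (cmap c @` (cdom c `&` cdom d)) g /\
    forall x, cdom c x -> cdom d x -> cmap d x = g (cmap c x).

Definition atlas (T : Type) (n : nat) : Type := set (chart T n).

(* The open sets of the topology determined by an atlas. *)
Definition mopen T n (A : atlas T n) (U : set T) : Prop :=
  (U `<=` \bigcup_(c in A) cdom c) /\
  forall c, A c -> open (cmap c @` (U `&` cdom c)).

(* (M, A) is a smooth n-manifold with underlying set M.  The atlas A need not
   be maximal; all the notions below depend only on the maximal atlas. *)
Definition is_manifold T n (M : set T) (A : atlas T n) : Prop :=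
  [/\ forall c, A c -> is_chart c,
      M = \bigcup_(c in A) cdom c,
      forall c d, A c -> A d -> smooth_transition c d,
      forall x y, M x -> M y -> x <> y -> exists U V,
        [/\ mopen A U, mopen A V, U x, V y & U `&` V = set0] &
      exists B : nat -> set T, (forall i, mopen A (B i)) /\
        forall U x, mopen A U -> U x -> exists i, B i x /\ B i `<=` U].

Definition compact_in T n (A : atlas T n) (K : set T) : Prop :=
  forall F : set (set T), (forall U, F U -> mopen A U) ->
    K `<=` \bigcup_(U in F) U ->
    exists F' : set (set T),
      [/\ finite_set F', F' `<=` F & K `<=` \bigcup_(U in F') U].

(* In the charts c and d, the map f is represented by g on the open set U. *)
Definition local_rep T T' m n (c : chart T m) (d : chart T' n) (f : T -> T')
    (U : set 'rV[R]_m) (g : 'rV[R]_m -> 'rV[R]_n) : Prop :=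
  [/\ open U, U `<=` cmap c @` cdom c, smooth_on U g &
      forall x, cdom c x -> U (cmap c x) ->
        cdom d (f x) /\ cmap d (f x) = g (cmap c x)].

Definition smooth_map T T' m n (M : set T) (A : atlas T m) (A' : atlas T' n)
    (f : T -> T') : Prop :=
  forall x, M x -> exists c d U g,
    [/\ A c, A' d, cdom c x, U (cmap c x) & local_rep c d f U g].

Definition submersion T T' m n (M : set T) (A : atlas T m) (A' : atlas T' n)
    (f : T -> T') : Prop :=
  forall x, M x -> exists c d U g,
    [/\ A c, A' d, cdom c x, U (cmap c x) & local_rep c d f U g /\
     forall w, exists v, 'D_v g (cmap c x) = w].

Definition diffeomorphism T T' m n (M : set T) (A : atlas T m)
    (M' : set T') (A' : atlas T' n) (f : T -> T') : Prop :=
  [/\ set_bij M M' f, smooth_map M A A' f &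
      exists g : T' -> T, (forall x, M x -> g (f x) = x) /\
                          smooth_map M' A' A g].

Definition prod_atlas T T' m n (A : atlas T m) (A' : atlas T' n) :
    atlas (T * T') (m + n) :=
  [set (cdom c `*` cdom d, fun z => row_mx (cmap c z.1) (cmap d z.2))
     | c in A & d in A'].

Definition max_atlas T n (A : atlas T n) : atlas T n :=
  [set c | [/\ is_chart c, cdom c `<=` \bigcup_(d in A) cdom d &
    forall d, A d -> smooth_transition c d /\ smooth_transition d c]].

(* In the chart c, the set S is { v | v_k = ... = v_(n-1) = 0 }. *)
Definition slice_chart T n (A : atlas T n) (S : set T) (k : nat)
    (c : chart T n) : Prop :=
  max_atlas A c /\
  forall x, cdom c x ->
    (S x <-> forall j : 'I_n, (k <= j)%N -> cmap c x ord0 j = 0).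

Definition submanifold T n (A : atlas T n) (S : set T) (k : nat) : Prop :=
  (k <= n)%N /\ forall x, S x -> exists2 c, slice_chart A S k c & cdom c x.

Definition first_coords n k (v : 'rV[R]_n) : 'rV[R]_k :=
  \row_(i < k) oapp (fun j : 'I_n => v ord0 j) 0 (insub (i : nat)).

(* The manifold structure carried by an embedded k-dimensional submanifold S. *)
Definition sub_atlas T n (A : atlas T n) (S : set T) (k : nat) : atlas T k :=
  [set (S `&` cdom c, fun x => first_coords k (cmap c x))
     | c in slice_chart A S k].

Definition lie_group T n (G : set T) (A : atlas T n) (op : T -> T -> T) : Prop :=
  is_manifold G A /\
  exists (e : T) (inv : T -> T),
    [/\ G e,
        forall x y, G x -> G y -> G (op x y),
        forall x y z, G x -> G y -> G z -> op x (op y z) = op (op x y) z,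
        forall x, G x -> op e x = x /\ op x e = x &
        forall x, G x -> [/\ G (inv x), op (inv x) x = e & op x (inv x) = e]] /\
    smooth_map (G `*` G) (prod_atlas A A) A (fun z => op z.1 z.2) /\
    smooth_map G A A inv.

Definition lie_group_iso T T' m n
    (G : set T) (A : atlas T m) (op : T -> T -> T)
    (G' : set T') (A' : atlas T' n) (op' : T' -> T' -> T') (f : T -> T') : Prop :=
  [/\ lie_group G A op, lie_group G' A' op', diffeomorphism G A G' A' f &
      forall x y, G x -> G y -> f (op x y) = op' (f x) (f y)].

End SmoothManifolds.
Arguments sub_atlas {R T n} A S k.

Section Groups.
Variable R : realType.
Local Notation H := (quat R).

Definition Sp1 : set H := [set u | qnorm u = 1].

Definition quat_atlas : atlas R H 4 := [set ([set: H], id)].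

Definition Sp1_atlas : atlas R H 3 := sub_atlas quat_atlas Sp1 3.

Definition ctrmx (A : 'M[H]_2) : 'M[H]_2 := \matrix_(i, j) qconj (A j i).

Definition I11 : 'M[H]_2 := diag_mx (\row_(j < 2) if j == 0 then 1 else -1).

Definition Sp11 : set 'M[H]_2 := [set A | ctrmx A *m I11 *m A = I11].

Definition mx_coords (A : 'M[H]_2) : 'rV[R]_(2 * 2 * 4) :=
  mxvec (\matrix_(i < 2 * 2, j < 4) qcoord (mxvec A ord0 i) j).

Definition mx_atlas : atlas R 'M[H]_2 (2 * 2 * 4) :=
  [set ([set: 'M[H]_2], mx_coords)].

(* Sp(1,1) is a closed subgroup of GL_2(H), of real dimension 10 = 16 - 6. *)
Definition Sp11_atlas : atlas R 'M[H]_2 10 := sub_atlas mx_atlas Sp11 10.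

Definition coset (A : 'M[H]_2) : set 'M[H]_2 := [set A *m u%:M | u in Sp1].

Definition coset_space : set (set 'M[H]_2) := [set coset A | A in Sp11].

End Groups.
Arguments Sp1 R _ : clear implicits.
Arguments Sp1_atlas R _ : clear implicits.
Arguments Sp11 R _ : clear implicits.
Arguments Sp11_atlas R _ : clear implicits.
Arguments coset_space R _ : clear implicits.

Section Moebius.
Variable R : realType.
Local Notation H := (quat R).

Definition qball : Type := {q : H | qnorm q < 1}.

Definition qball_atlas : atlas R qball 4 :=
  [set ([set: qball], fun q : qball => val q)].

Definition has_expansion (f : H -> H) (a : nat -> H) : Prop :=
  forall q : H, qnorm q < 1 ->
    series (fun n => q ^+ n * a n) @ \oo --> f q.

(* The (unique) coefficients of the expansion of f on the unit ball. *)
Definition coef (f : H -> H) : nat -> H := xget (fun=> 0) (has_expansion f).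

Definition pseries (a : nat -> H) (q : H) : H :=
  lim (series (fun n => q ^+ n * a n) @ \oo).

Definition star (f g : H -> H) : H -> H :=
  pseries (fun n => \sum_(k < n.+1) coef f k * coef g (n - k)%N).

Definition reg_conj (f : H -> H) : H -> H := pseries (fun n => qconj (coef f n)).

Definition symmetrization (f : H -> H) : H -> H := star f (reg_conj f).

Definition star_recip (f : H -> H) (q : H) : H :=
  (symmetrization f q)^-1 * reg_conj f q.

Definition affine (a b q : H) : H := q * a + b.

(* A = [[a, c], [b, d]], so a = A_00, c = A_01, b = A_10, d = A_11. *)
Definition moebius (A : 'M[H]_2) : H -> H :=
  star (star_recip (affine (A 0 1) (A 1 1))) (affine (A 0 0) (A 1 0)).

(* f : B -> B is the Moebius transformation F_A. *)
Definition is_moebius (A : 'M[H]_2) (f : qball -> qball) : Prop :=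
  forall q, val (f q) = moebius A (val q).

Definition moebius_set : set (qball -> qball) :=
  [set f | exists2 A, Sp11 R A & is_moebius A f].

Definition is_right_mul (u : H) (f : qball -> qball) : Prop :=
  forall q, val (f q) = val q * u.

Definition isotropy0 : set (qball -> qball) :=
  [set f | moebius_set f /\ forall q, val q = 0 -> val (f q) = 0].

End Moebius.
Arguments qball_atlas R _ : clear implicits.
Arguments moebius_set R _ : clear implicits.
Arguments isotropy0 R _ : clear implicits.

(* Main.v *)
Require Import Defs.
From HB Require Import structures.
From mathcomp Require Import all_boot all_order all_algebra.
From mathcomp Require Import ring lra.
From mathcomp Require Import all_classical all_reals all_analysis.
Import Order.TTheory GRing.Theory Num.Theory.
Import numFieldNormedType.Exports.
Local Open Scope classical_set_scope.
Local Open Scope ring_scope.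
Set Implicit Arguments.
Unset Strict Implicit.
Unset Printing Implicit Defensive.

                                                                               
                                                                                  
                                                                          
                                                                                  
                                                                              
                                                                                   
                                                         
                                                                                  
                                                                            
                                                                                     
                                                                            
                  

                                                                                   
                                                                                   
                                                                                 
                                                                                
                                                                               
                                                                              
                                                                              
                           

                                                                             
                                                                                   
                                                                                   
                                                                           
                                                                                
                                                                                    
                                                                                  
                                                                                   
                                                                                     
                                                                       
                                                                         
                                                                                   
                                                                                 

                                       

Section DiffEps.
Variables (R : realType) (V W : normedModType R).
Implicit Types f g : V -> W.

                                                                                     
                                                
Lemma diff_approx f (df : {linear V -> W}) x : continuous df ->
  (forall e, 0 < e -> \forall h \near 0, `|f (h + x) - f x - df h| <= e * `|h|) ->
  differentiable f x /\ 'd f x = df :> (V -> W).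
Proof.
move=> cdf H.
have E : f \o shift x = cst (f x) + df +o_ 0 id.
  by apply/eqaddoP => e e0; have := H e e0; apply: filterS => h /=; rewrite opprD addrA.
have dE := diff_unique cdf E; split => //.
by apply/diff_locallyP; rewrite dE.
Qed.

Lemma diff_approxP f x : differentiable f x ->
  forall e, 0 < e ->
  \forall h \near 0, `|f (h + x) - f x - 'd f x h| <= e * `|h|.
Proof.
move=> /diff_locally /eqaddoP H e e0.
by have := H e e0; apply: filterS => h /=; rewrite opprD addrA.
Qed.

Lemma near_eq_diff f g (x : V) :
  (\near x, f x = g x) -> differentiable f x -> differentiable g x.
Proof.
move=> fg df.
have fgx : f x = g x by exact: nbhs_singleton fg.
apply: (@diff_approx g ('d f x) x _ _).1; first exact: diff_continuous.
move=> e e0; have := diff_approxP df e0.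
have fg0 : \forall h \near 0, f (h + x) = g (h + x).
  by have := fg; rewrite (near_shift 0 x) subr0.
by apply: filterS2 fg0 => h ->; rewrite fgx.
Qed.

Lemma open_near_eq (U : set V) f g x : open U -> U x ->
  (forall y, U y -> f y = g y) -> \near x, f x = g x.
Proof.
move=> oU Ux fg; near=> y; apply: fg; near: y; exact: open_nbhs_nbhs.
Unshelve. all: by end_near. Qed.

End DiffEps.

                                     

Section ScalarCk.
Variable R : realType.

                                                                                     
                                                                                    
  
Fixpoint Cks {m : nat} (k : nat) (U : set 'rV[R]_m) (f : 'rV[R]_m -> R) : Prop :=
  match k with
  | 0%N => forall x, U x -> {for x, continuous f}
  | k'.+1 => (forall x, U x -> differentiable f x) /\
             (forall v, Cks k' U (fun x => 'D_v f x))
  end.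

Section Fix_m.
Variable m : nat.
Implicit Types (U V : set 'rV[R]_m) (f g : 'rV[R]_m -> R).

Lemma Cks_ext k U f g : open U -> (forall x, U x -> f x = g x) ->
  Cks k U f -> Cks k U g.
Proof.
move=> oU; elim: k f g => [|k IH] f g fg /=.
  move=> cf x Ux; have nfg := open_near_eq oU Ux fg.
  rewrite -[{for _, _}]/(g @ x --> g x) -(fg x Ux).
  by apply: cvg_trans (cf x Ux); exact: (near_eq_cvg nfg).
case=> df Df; split=> [x Ux|v].
  exact: near_eq_diff (open_near_eq oU Ux fg) (df x Ux).
apply: IH (Df v) => x Ux; apply: near_eq_derive; exact: (open_near_eq oU Ux fg).
Qed.

Lemma Cks_sub k U V f : V `<=` U -> Cks k U f -> Cks k V f.
Proof.
move=> VU; elim: k f => [|k IH] f /=; first by move=> cf x /VU; exact: cf.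
by case=> df Df; split=> [x /VU|v]; [exact: df | exact: IH].
Qed.

Lemma Cks_continuous k U f : Cks k U f -> forall x, U x -> {for x, continuous f}.
Proof.
by case: k => [//|k] [df _] x Ux; apply: differentiable_continuous; exact: df.
Qed.

Lemma CksW k U f : Cks k.+1 U f -> Cks k U f.
Proof.
elim: k f => [|k IH] f; first exact: Cks_continuous.
by case=> df Df; split => // v; exact: IH.
Qed.

Lemma Cks_local k U f :
  (forall x, U x -> exists V, [/\ open V, V x & Cks k V f]) -> Cks k U f.
Proof.
elim: k f => [|k IH] f H /=.
  by move=> x /H [V [oV Vx cf]]; exact: cf.
split=> [x /H [V [oV Vx [df _]]]|v]; first exact: df.
by apply: IH => x /H [V [oV Vx [_ Df]]]; exists V; split => //; exact: Df.
Qed.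

Lemma Cks_cst k U (a : R) : Cks k U (cst a).
Proof.
elim: k a => [|k IH] a /=; first by move=> x _; exact: cst_continuous.
split=> [x _|v]; first exact: differentiable_cst.
by rewrite (_ : (fun x => _) = cst 0) //; apply/funext => x; rewrite derive_cst.
Qed.

Lemma CksD k U f g : open U -> Cks k U f -> Cks k U g ->
  Cks k U (fun x => f x + g x).
Proof.
move=> oU; elim: k f g => [|k IH] f g /=.
  by move=> cf cg x Ux; exact: (cvgD (cf x Ux) (cg x Ux)).
move=> [df Df] [dg Dg]; split=> [x Ux|v].
  by apply: differentiableD; [exact: df|exact: dg].
apply: Cks_ext (IH _ _ (Df v) (Dg v)) => // x Ux.
by rewrite -deriveD //; apply: diff_derivable; [exact: df|exact: dg].
Qed.

                                                                                    
                                          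
Lemma CksM k U f g : open U -> Cks k U f -> Cks k U g ->
  Cks k U (fun x => f x * g x).
Proof.
move=> oU; elim: k f g => [|k IH] f g.
  by move=> cf cg x Ux; exact: (cvgM (cf x Ux) (cg x Ux)).
move=> Cf Cg; have := CksW Cg; have := CksW Cf.
case: Cf => df Df; case: Cg => dg Dg Cf Cg; split=> [x Ux|v].
  by apply: differentiableM; [exact: df|exact: dg].
apply: Cks_ext (CksD oU (IH _ _ Cf (Dg v)) (IH _ _ Cg (Df v))) => // x Ux.
rewrite -[RHS]/('D_v (f * g) x) deriveM //; apply: diff_derivable; [exact: df|exact: dg].
Qed.

Lemma CksN k U f : open U -> Cks k U f -> Cks k U (fun x => - f x).
Proof.
move=> oU Cf; apply: Cks_ext (CksM oU (Cks_cst k U (-1)) Cf) => // x _.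
by rewrite mulN1r.
Qed.

Lemma CksV k U f : open U -> (forall x, U x -> f x != 0) -> Cks k U f ->
  Cks k U (fun x => (f x)^-1).
Proof.
move=> oU f0; elim: k => [|k IH].
  by move=> cf x Ux; exact: (cvgV (f0 x Ux) (cf x Ux)).
move=> Cf; have CV := IH (CksW Cf); case: Cf => df Df; split=> [x Ux|v].
  by apply: differentiableV; [exact: df|exact: f0].
apply: Cks_ext (CksN oU (CksM oU (CksM oU CV CV) (Df v))) => // x Ux.
rewrite deriveV ?f0 //; last by apply: diff_derivable; exact: df.
by rewrite -[RHS]/(_ * _) mulNr expr2 invfM.
Qed.

Lemma Cks_sqrt k U f : open U -> (forall x, U x -> 0 < f x) -> Cks k U f ->
  Cks k U (fun x => Num.sqrt (f x)).
Proof.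
move=> oU f0; elim: k => [|k IH].
  move=> cf x Ux; apply: (continuous_comp (cf x Ux)); exact: sqrt_continuous.
move=> Cf; have CV := IH (CksW Cf); case: Cf => df Df.
have ds x : U x -> differentiable Num.sqrt (f x).
  move=> Ux; apply/derivable1_diffP.
  exact: (@ex_derive _ _ _ _ _ _ _ (is_derive1_sqrt (f0 x Ux))).
split=> [x Ux|v].
  by apply: differentiable_comp; [exact: df|exact: ds].
have C2 : Cks k U (fun x => (2 * Num.sqrt (f x))^-1).
  apply: CksV => // [x Ux|]; first by rewrite mulf_neq0 // gt_eqF // sqrtr_gt0 f0.
  exact: CksM (Cks_cst _ _ _) CV.
apply: Cks_ext (CksM oU C2 (Df v)) => // x Ux.
rewrite -[RHS]/('D_v (Num.sqrt \o f) x).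
rewrite (deriveE v (differentiable_comp (df x Ux) (ds x Ux))).
rewrite (diff_comp (df x Ux) (ds x Ux)) /=.
rewrite (deriveE v (df x Ux)).
rewrite -[in RHS](mulr1 ('d f x v)) -[_ * 1]/(_ *: (1 : R)) linearZ /=.
have := deriveE (1 : R^o) (ds x Ux); rewrite (derive_sqrt (f0 x Ux)) => <-.
by rewrite -[RHS]/(_ * _) mulrC.
Qed.

Lemma Cks_sum k U (I : Type) (r : seq I) (P : pred I) (F : I -> 'rV[R]_m -> R) :
  open U -> (forall i, P i -> Cks k U (F i)) ->
  Cks k U (fun x => \sum_(i <- r | P i) F i x).
Proof.
move=> oU H; elim: r => [|i r IH].
  by apply: Cks_ext (Cks_cst k U 0) => // x _; rewrite big_nil.
have [Pi|nPi] := boolP (P i).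
  by apply: Cks_ext (CksD oU (H i Pi) IH) => // x _; rewrite big_cons Pi.
by apply: Cks_ext IH => // x _; rewrite big_cons (negbTE nPi).
Qed.

Lemma Cks_prod k U (I : Type) (r : seq I) (P : pred I) (F : I -> 'rV[R]_m -> R) :
  open U -> (forall i, P i -> Cks k U (F i)) ->
  Cks k U (fun x => \prod_(i <- r | P i) F i x).
Proof.
move=> oU H; elim: r => [|i r IH].
  by apply: Cks_ext (Cks_cst k U 1) => // x _; rewrite big_nil.
have [Pi|nPi] := boolP (P i).
  by apply: Cks_ext (CksM oU (H i Pi) IH) => // x _; rewrite big_cons Pi.
by apply: Cks_ext IH => // x _; rewrite big_cons (negbTE nPi).
Qed.

Lemma differentiable_entry i x : differentiable (fun v : 'rV[R]_m => v 0 i) x.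
Proof. exact: differentiable_coord. Qed.

Lemma derive_entry i v x : 'D_v (fun v : 'rV[R]_m => v 0 i) x = v 0 i.
Proof.
rewrite -[v 0 i in RHS]/(id v 0 i) -{2}(derive_id x v) derive_mx ?mxE //.
Qed.

Lemma Cks_coord k U i : Cks k U (fun v => v 0 i).
Proof.
case: k => [|k] /=.
  by move=> x _; apply: differentiable_continuous; exact: differentiable_entry.
split=> [x _|v]; first exact: differentiable_entry.
have -> : (fun x => 'D_v (fun v : 'rV[R]_m => v 0 i) x) = cst (v 0 i).
  by apply/funext => x; rewrite derive_entry.
exact: Cks_cst.
Qed.

End Fix_m.

Lemma differentiable_rowP m n (f : 'rV[R]_m -> 'rV[R]_n) x :
  differentiable f x <-> forall j, differentiable (fun x => f x 0 j) x.
Proof.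
split=> [df j|H].
  exact: (differentiable_comp df (differentiable_entry _ _)).
have -> : f = \sum_(j < n) (fun x => f x 0 j *: delta_mx 0 j).
  by apply/funext => y; rewrite fct_sumE; exact: row_sum_delta.
by apply: differentiable_sum => j; apply: differentiableZl; exact: H.
Qed.

Lemma derive_coord m n (f : 'rV[R]_m -> 'rV[R]_n) x v j : differentiable f x ->
  ('D_v f x) 0 j = 'D_v (fun x => f x 0 j) x.
Proof. by move=> df; rewrite derive_mx ?mxE //; exact: diff_derivable. Qed.

Lemma continuous_rowP m n (f : 'rV[R]_m -> 'rV[R]_n) (x : 'rV[R]_m) :
  {for x, continuous f} <-> forall j, {for x, continuous (fun x => f x 0 j)}.
Proof.
split=> [cf j|H].
  apply: (@continuous_comp _ _ _ f (fun M : 'rV_n => M 0 j) x cf).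
  exact: coord_continuous.
apply/(@cvgrPdist_lt _ _ _ (nbhs x) (nbhs_filter x) f (f x)) => e e0.
have : \forall y \near x, forall j, `|f x 0 j - f y 0 j| < e.
  apply: (@filter_forall _ _ (fun j y => `|f x 0 j - f y 0 j| < e) (nbhs x) (nbhs_filter x)) => j.
  have := H j.
  by rewrite -[{for _, _}]/(f y 0 j @[y --> x] --> f x 0 j) => /cvgrPdist_lt/(_ e e0).
apply: filterS => y h.
rewrite [ltLHS]/Num.Def.normr/= mx_normrE.
by apply: bigmax_lt => // -[i j] _ /=; rewrite !mxE (ord1 i).
Qed.

Lemma Ck_onE m n k (U : set 'rV[R]_m) (f : 'rV[R]_m -> 'rV[R]_n) : open U ->
  Ck_on k U f <-> forall j, Cks k U (fun x => f x 0 j).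
Proof.
move=> oU; elim: k f => [|k IH] f /=.
  split=> [cf j x Ux|cf x Ux]; first by have /continuous_rowP := cf x Ux.
  by apply/continuous_rowP => j; exact: cf.
split=> [[df Df] j|H].
  split=> [x Ux|v]; first by have /differentiable_rowP := df x Ux.
  have /IH/(_ j) := Df v; apply: Cks_ext => // x Ux.
  by rewrite derive_coord //; exact: df.
have df x : U x -> differentiable f x.
  by move=> Ux; apply/differentiable_rowP => j; exact: (H j).1.
split=> // v; apply/IH => j; apply: Cks_ext ((H j).2 v) => // x Ux.
by rewrite derive_coord //; exact: df.
Qed.

                                                                               
                                                                            
Lemma Cks_comp m n k (U : set 'rV[R]_m) (V : set 'rV[R]_n)
    (f : 'rV[R]_m -> 'rV[R]_n) (g : 'rV[R]_n -> R) :
  open U -> (forall x, U x -> V (f x)) ->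
  Ck_on k U f -> Cks k V g -> Cks k U (fun x => g (f x)).
Proof.
move=> oU UV; elim: k g => [|k IH] g.
  move=> cf cg x Ux; apply: (continuous_comp (cf x Ux)); exact: cg (UV _ Ux).
move=> Cf [dg Dg]; have /(Ck_onE k.+1) Cfj := Cf; have {Cfj} Cfj := Cfj oU.
case: Cf => df Df.
have Cf : Ck_on k U f by apply/Ck_onE => // j; exact: CksW.
split=> [x Ux|v].
  by apply: differentiable_comp; [exact: df|exact: dg (UV _ Ux)].
have C : Cks k U (fun x => \sum_(j < n)
    'D_v (fun x => f x 0 j) x * 'D_(delta_mx 0 j) g (f x)).
  apply: Cks_sum => // j _; apply: CksM => //; first exact: (Cfj j).2.
  exact: (IH _ Cf (Dg _)).
apply: Cks_ext C => // x Ux.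
have dgx := dg _ (UV _ Ux); have dfx := df _ Ux.
rewrite -[RHS]/('D_v (g \o f) x) (deriveE v (differentiable_comp dfx dgx)).
rewrite diff_comp //= -(deriveE v dfx) [in RHS](row_sum_delta ('D_v f x)).
rewrite linear_sum /=; apply: eq_bigr => j _.
by rewrite linearZ /= -(deriveE (delta_mx 0 j) dgx) derive_coord.
Qed.

Definition smooths {m} (U : set 'rV[R]_m) (f : 'rV[R]_m -> R) : Prop :=
  forall k, Cks k U f.

Section Smooth.
Variables (m : nat) (U : set 'rV[R]_m).
Hypothesis oU : open U.
Implicit Types f g : 'rV[R]_m -> R.

Lemma smooths_ext f g : (forall x, U x -> f x = g x) -> smooths U f -> smooths U g.
Proof. by move=> fg Sf k; exact: Cks_ext fg (Sf k). Qed.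

Lemma smooths_cst a : smooths U (fun=> a).
Proof. by move=> k; exact: Cks_cst. Qed.

Lemma smoothsD f g : smooths U f -> smooths U g -> smooths U (fun x => f x + g x).
Proof. by move=> Sf Sg k; exact: CksD. Qed.

Lemma smoothsN f : smooths U f -> smooths U (fun x => - f x).
Proof. by move=> Sf k; exact: CksN. Qed.

Lemma smoothsB f g : smooths U f -> smooths U g -> smooths U (fun x => f x - g x).
Proof. by move=> Sf Sg; apply: smoothsD => //; exact: smoothsN. Qed.

Lemma smoothsM f g : smooths U f -> smooths U g -> smooths U (fun x => f x * g x).
Proof. by move=> Sf Sg k; exact: CksM. Qed.

Lemma smoothsV f : (forall x, U x -> f x != 0) -> smooths U f ->
  smooths U (fun x => (f x)^-1).
Proof. by move=> f0 Sf k; exact: CksV. Qed.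

Lemma smooths_sqrt f : (forall x, U x -> 0 < f x) -> smooths U f ->
  smooths U (fun x => Num.sqrt (f x)).
Proof. by move=> f0 Sf k; exact: Cks_sqrt. Qed.

Lemma smooths_sum (I : Type) (r : seq I) (P : pred I) (F : I -> 'rV[R]_m -> R) :
  (forall i, P i -> smooths U (F i)) ->
  smooths U (fun x => \sum_(i <- r | P i) F i x).
Proof. by move=> H k; apply: Cks_sum => // i Pi; exact: H. Qed.

Lemma smooth_onE n (f : 'rV[R]_m -> 'rV[R]_n) :
  smooth_on U f <-> forall j, smooths U (fun x => f x 0 j).
Proof.
split=> [Sf j k|H k]; first by have /Ck_onE := Sf k; apply.
by apply/Ck_onE => // j; exact: H.
Qed.

Lemma smooth_on_ext n (f g : 'rV[R]_m -> 'rV[R]_n) :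
  (forall x, U x -> f x = g x) -> smooth_on U f -> smooth_on U g.
Proof.
move=> fg /smooth_onE H; apply/smooth_onE => j; apply: smooths_ext (H j) => x Ux.
by rewrite fg.
Qed.

Lemma smooth_on_sub n (V : set 'rV[R]_m) (f : 'rV[R]_m -> 'rV[R]_n) :
  open V -> U `<=` V -> smooth_on V f -> smooth_on U f.
Proof.
move=> oV UV Sf; apply/smooth_onE => j k.
by apply: (Cks_sub UV); have /Ck_onE := Sf k; apply.
Qed.

Lemma smooth_on_local n (f : 'rV[R]_m -> 'rV[R]_n) :
  (forall x, U x -> exists V, [/\ open V, V x & smooth_on V f]) -> smooth_on U f.
Proof.
move=> H; apply/smooth_onE => j k; apply: Cks_local => x /H [V [oV Vx Sf]].
by exists V; split => //; have /Ck_onE := Sf k; apply.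
Qed.

Lemma smooth_on_continuous n (f : 'rV[R]_m -> 'rV[R]_n) x :
  smooth_on U f -> U x -> {for x, continuous f}.
Proof. by move=> /(_ 0%N) /=; apply. Qed.

Lemma smooth_on_diff n (f : 'rV[R]_m -> 'rV[R]_n) x :
  smooth_on U f -> U x -> differentiable f x.
Proof. by move=> /(_ 1%N) [H _] Ux; exact: H. Qed.

Lemma smooth_on_comp n p (V : set 'rV[R]_n) (f : 'rV[R]_m -> 'rV[R]_n)
    (g : 'rV[R]_n -> 'rV[R]_p) :
  open V -> (forall x, U x -> V (f x)) -> smooth_on U f -> smooth_on V g ->
  smooth_on U (fun x => g (f x)).
Proof.
move=> oV UV Sf Sg; apply/smooth_onE => j k.
exact: (Cks_comp (g := fun y => g y 0 j) oU UV (Sf k) ((Ck_onE k g oV).1 (Sg k) j)).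
Qed.

Lemma smooth_on_lin n (f : {linear 'rV[R]_m -> 'rV[R]_n}) : smooth_on U f.
Proof.
apply/smooth_onE => j.
suff -> : (fun x => f x 0 j) = (fun x => \sum_i x 0 i * f (delta_mx 0 i) 0 j).
  apply: smooths_sum => i _; apply: smoothsM; last exact: smooths_cst.
  by move=> k; exact: Cks_coord.
apply/funext => x; rewrite {1}(row_sum_delta x) linear_sum summxE.
by apply: eq_bigr => i _; rewrite linearZ mxE.
Qed.

Lemma open_preimage n (V : set 'rV[R]_n) (f : 'rV[R]_m -> 'rV[R]_n) :
  smooth_on U f -> open V -> open [set x | U x /\ V (f x)].
Proof.
move=> Sf oV; rewrite openE => x [Ux Vfx].
have nU : nbhs x U by exact: open_nbhs_nbhs.
have nV : nbhs x (f @^-1` V).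
  by apply: (smooth_on_continuous Sf Ux); exact: open_nbhs_nbhs.
by apply: filterS2 nU nV => y.
Qed.

End Smooth.

End ScalarCk.
Lemma near_norm_lt (R : realType) (V : normedModType R) (x : V) (P : V -> Prop) :
  (\forall y \near x, P y) -> exists2 r : R, 0 < r & forall y, `|y - x| < r -> P y.
Proof.
move=> /nbhs_normP [r /= r0 H]; exists r => // y yr.
by apply: H; rewrite /= distrC.
Qed.

Lemma norm_lt_near (R : realType) (V : normedModType R) (x : V) (r : R) :
  0 < r -> \forall y \near x, `|y - x| < r.
Proof. by move=> r0; apply/nbhs_normP; exists r => //= y; rewrite distrC. Qed.

Section MeanValue.
Variables (R : realType) (m n : nat).
Implicit Types (f : 'rV[R]_m -> 'rV[R]_n).

Lemma entryB p q (A B : 'M[R]_(p, q)) i j : (A - B) i j = A i j - B i j.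
Proof. by rewrite !mxE. Qed.

Lemma row_norm_le (v : 'rV[R]_n) (c : R) : 0 <= c ->
  (forall j, `|v 0 j| <= c) -> `|v| <= c.
Proof.
move=> c0 H; rewrite [leLHS]/Num.Def.normr/= mx_normrE.
by apply: bigmax_le => // -[i j] _ /=; rewrite (ord1 i).
Qed.

Lemma row_norm_ge (v : 'rV[R]_n) j : `|v 0 j| <= `|v|.
Proof.
rewrite [leRHS]/Num.Def.normr/= mx_normrE.
exact: (le_bigmax _ (fun ij => `|v ij.1 ij.2|) (0, j)).
Qed.

                                                                                    
                                               
Lemma mean_value_le f (x0 : 'rV[R]_m) (r c : R) : 0 <= c ->
  (forall x, `|x - x0| <= r -> differentiable f x) ->
  (forall x v, `|x - x0| <= r -> `|'D_v f x| <= c * `|v|) ->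
  forall x y, `|x - x0| <= r -> `|y - x0| <= r -> `|f x - f y| <= c * `|x - y|.
Proof.
move=> c0 df Df x y xr yr; apply: row_norm_le => [|j]; first by rewrite mulr_ge0.
pose p (t : R) := y + t *: (x - y).
have pr (t : R) : t \in `[0, 1] -> `|p t - x0| <= r.
  rewrite in_itv /= => /andP [t0 t1].
  have -> : p t - x0 = t *: (x - x0) + (1 - t) *: (y - x0).
    rewrite /p scalerBl scale1r !scalerBr !addrA.
    by apply/rowP => i; rewrite !mxE; ring.
  apply: (le_trans (ler_normD _ _)); rewrite !normrZ (ger0_norm t0).
  have t1' : 0 <= 1 - t by rewrite subr_ge0.
  by rewrite (ger0_norm t1'); nra.
pose g (t : R) : R := f (p t) 0 j.
have dp (t : R) : differentiable p t.
  apply: differentiableD; first exact: differentiable_cst.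
  exact: differentiableZl.
have Dp (t : R) : 'd p t 1 = x - y.
  rewrite -(deriveE (1 : R^o)) // /p.
  rewrite deriveD ?derive_cst ?add0r; [|exact: derivable_cst|]; last first.
    by apply: diff_derivable; exact: differentiableZl.
  rewrite deriveE; last exact: differentiableZl.
  by rewrite diffZl // diff_val scale1r.
have dg (t : R) : t \in `[0, 1] -> is_derive t 1 g ('D_(x - y) f (p t) 0 j).
  move=> t01; have dfp := df _ (pr t t01).
  have dfpt : differentiable (f \o p) t by exact: differentiable_comp.
  have dgt : differentiable g t.
    exact: (differentiable_comp dfpt (differentiable_entry _ _)).
  apply: DeriveDef; first exact: diff_derivable.
  rewrite -[LHS]/('D_1 (fun t => (f \o p) t 0 j) t).
  have E : 'D_(1 : R^o) (f \o p) t = 'D_(x - y) f (p t).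
    by rewrite (deriveE _ dfpt) (diff_comp (dp t) dfp) /= Dp -(deriveE _ dfp).
  by rewrite -E derive_mx ?mxE //; exact: diff_derivable.
have [t t01 ->] : exists2 t, t \in `[0, 1] & (f x - f y) 0 j = 'D_(x - y) f (p t) 0 j.
  have h1 (t : R) : t \in `]0, 1[ -> is_derive t 1 g (('D_(x - y) f (p t)) 0 j).
    by move=> t01; apply: dg; exact: subset_itv_oo_cc t01.
  have h2 : {within `[0, 1], continuous g}.
    apply: continuous_in_subspaceT => t; rewrite inE /= => /dg dgt.
    apply: differentiable_continuous; apply/derivable1_diffP.
    exact: (@ex_derive _ _ _ _ _ _ _ dgt).
  have [t t01] := MVT_segment ler01 h1 h2.
  have g1 : g 1 = f x 0 j by rewrite /g /p scale1r addrC subrK.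
  have g0 : g 0 = f y 0 j by rewrite /g /p scale0r addr0.
  by rewrite g1 g0 subr0 mulr1 => E; exists t => //; rewrite entryB.
exact: le_trans (row_norm_ge _ _) (Df _ _ (pr t t01)).
Qed.

End MeanValue.

                              

Section InverseFunction.
Variable R : realType.

Lemma Cks_det m n k (U : set 'rV[R]_m) (A : 'rV[R]_m -> 'M[R]_n) : open U ->
  (forall i j, Cks k U (fun x => A x i j)) -> Cks k U (fun x => \det (A x)).
Proof.
move=> oU H; apply: Cks_sum => // s _; apply: CksM => //; first exact: Cks_cst.
by apply: Cks_prod => // i _; exact: H.
Qed.

                                                                                     
Lemma Cks_invmx m n k (U : set 'rV[R]_m) (A : 'rV[R]_m -> 'M[R]_n) : open U ->
  (forall x, U x -> A x \in unitmx) ->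
  (forall i j, Cks k U (fun x => A x i j)) ->
  forall i j, Cks k U (fun x => invmx (A x) i j).
Proof.
move=> oU uA CA i j.
apply: (@Cks_ext _ _ _ _ (fun x => (\det (A x))^-1 * \adj (A x) i j)) => // [x Ux|].
  by rewrite /invmx (uA x Ux) [RHS]mxE.
apply: CksM => //.
  apply: CksV => //; last exact: Cks_det.
  by move=> x /uA; rewrite unitmxE unitfE.
apply: (@Cks_ext _ _ _ _ (fun x => (-1) ^+ (j + i) * \det (row' j (col' i (A x))))) => //.
  by move=> x _; rewrite mxE.
apply: CksM => //; first exact: Cks_cst.
apply: Cks_det => // a b.
apply: (@Cks_ext _ _ _ _ (fun x => A x (lift j a) (lift i b))) => // x _.
by rewrite !mxE.
Qed.

Lemma linear_continuous_row m n (f : {linear 'rV[R]_m -> 'rV[R]_n}) : continuous f.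
Proof.
move=> x; apply: (@smooth_on_continuous _ _ setT) => //.
by apply: smooth_on_lin; exact: openT.
Qed.

Lemma open_norm_ball n (a : 'rV[R]_n) r : open [set z | `|z - a| < r].
Proof.
rewrite (_ : [set _ | _] = ball a r); first exact: ball_open.
by rewrite -ball_normE; apply/seteqP; split=> y /=; rewrite distrC.
Qed.

Section LocalInverse.
Variables (n : nat) (U : set 'rV[R]_n) (G : 'rV[R]_n -> 'rV[R]_n) (x0 : 'rV[R]_n).
Hypotheses (oU : open U) (Ux0 : U x0) (SG : smooth_on U G).
Hypothesis DG0 : forall v, 'D_v G x0 = v.

                                                                                   
                                                                         
Let near_id : exists r, 0 < r /\ forall x, `|x - x0| <= r ->
  U x /\ forall v, `|v - 'D_v G x| <= 2^-1 * `|v|.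
Proof.
                                                                  
pose e : R := (2 * n.+1%:R)^-1.
have e0 : 0 < e by rewrite invr_gt0 mulr_gt0.
have cD i j : \forall x \near x0, `|(delta_mx 0 i - 'D_(delta_mx 0 i) G x) 0 j| < e.
  have : {for x0, continuous (fun x => 'D_(delta_mx 0 i) G x)}.
    by have [_ /(_ (delta_mx 0 i)) H] := SG 1%N; exact: H.
  move=> /continuous_rowP/(_ j).
  rewrite -[{for _, _}]/(('D_(delta_mx 0 i) G y) 0 j @[y --> x0] --> ('D_(delta_mx 0 i) G x0) 0 j).
  rewrite DG0 => /cvgrPdist_lt/(_ e e0); apply: filterS => x.
  by rewrite entryB.
have cD' : \forall x \near x0, forall ij : 'I_n * 'I_n,
    `|(delta_mx 0 ij.1 - 'D_(delta_mx 0 ij.1) G x) 0 ij.2| < e.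
  apply: (@filter_forall _ _ (fun ij x => `|(delta_mx 0 ij.1 -
    'D_(delta_mx 0 ij.1) G x) 0 ij.2| < e) (nbhs x0) (nbhs_filter x0)) => ij.
  exact: cD.
have nU : \forall x \near x0, U x by exact: open_nbhs_nbhs.
have [r r0 rH] := near_norm_lt (filterI nU cD').
exists (r / 2); split=> [|x xr]; first by rewrite divr_gt0.
have {rH} [Ux Dx] : U x /\ forall ij : 'I_n * 'I_n,
    `|(delta_mx 0 ij.1 - 'D_(delta_mx 0 ij.1) G x) 0 ij.2| < e.
  apply: rH; rewrite (le_lt_trans xr) // ltr_pdivrMr //.
  by rewrite ltr_pMr // ltr1n.
split=> // v; apply: row_norm_le => [|j]; first by rewrite mulr_ge0.
have dG : differentiable G x by exact: smooth_on_diff Ux.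
rewrite (deriveE _ dG) {1 2}(row_sum_delta v) linear_sum -sumrB summxE.
apply: le_trans (ler_norm_sum _ _ _) _.
apply: (@le_trans _ _ (\sum_(i < n) `|v| * e)).
  apply: ler_sum => i _; rewrite linearZ -scalerBr mxE normrM.
  apply: ler_pM => //; first exact: row_norm_ge.
  by have := Dx (i, j); rewrite /= (deriveE _ dG) => /ltW.
rewrite sumr_const card_ord -[_ *+ n]mulr_natr -mulrA [leRHS]mulrC ler_wpM2l //.
rewrite /e invfM -mulrA ler_piMr // ler_pdivrMl // mulr1 ler_nat; exact: leqnSn.
Qed.

                                                                                     
                                                                                   
                                                                                   
             
Lemma local_inverse_at_id : exists V s, [/\ open V, V (G x0), smooth_on V s,
  s (G x0) = x0 & forall y, V y -> U (s y) /\ G (s y) = y].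
Proof.
have [r [r0 rH]] := near_id.
have rU x : `|x - x0| <= r -> U x by move=> /rH [].
have rD x v : `|x - x0| <= r -> `|v - 'D_v G x| <= 2^-1 * `|v| by move=> /rH [_]; apply.
have dG x : `|x - x0| <= r -> differentiable G x.
  by move=> /rU Ux; exact: smooth_on_diff Ux.
                                                                        
pose phi x := x - G x.
have Lphi x y : `|x - x0| <= r -> `|y - x0| <= r -> `|phi x - phi y| <= 2^-1 * `|x - y|.
  apply: (@mean_value_le _ _ _ phi) => // [z zr|z v zr].
    by apply: differentiableB => //; exact: dG.
  rewrite deriveB ?derive_id; [exact: rD| |]; first exact: derivable_id.
  by apply: diff_derivable; exact: dG.
have expand x y : `|x - x0| <= r -> `|y - x0| <= r -> `|x - y| <= 2 * `|G x - G y|.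
  move=> xr yr; have := Lphi x y xr yr.
  have -> : phi x - phi y = (x - y) - (G x - G y).
    by rewrite /phi !opprB addrACA [RHS]addrACA [- G x + _]addrC.
  move=> h; have := ler_normD ((x - y) - (G x - G y)) (G x - G y).
  rewrite subrK; lra.
have ex z : `|z - G x0| < r / 2 -> exists x, `|x - x0| < r /\ G x = z.
  move=> zr; pose B := [set x | `|x - x0| <= r].
  pose T x := phi x + z.
  have TB x : B x -> B (T x).
    move=> Bx; rewrite /B /=.
    have -> : T x - x0 = (phi x - phi x0) + (z - G x0).
      by rewrite /T /phi opprB; apply/rowP => i; rewrite !mxE; ring.
    apply: le_trans (ler_normD _ _) _; have := Lphi x x0 Bx.
    rewrite subrr normr0 => /(_ (ltW r0)); move: (Bx); rewrite /B /= => Bx'; lra.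
  pose TF : {fun B >-> B} := HB.pack T (@isFun.Build _ _ B B T TB).
  have cT : is_contraction TF.
    exists (2^-1)%:nng; split; first by rewrite /=; lra.
    case=> x y [/= Bx By]; rewrite /T opprD addrACA subrr addr0.
    exact: Lphi.
  have cB : closed B.
    have -> : B = closed_ball x0 r.
      rewrite closed_ballE //; apply/seteqP; split=> y;
      by rewrite /B /closed_ball_ /= distrC.
    exact: closed_ball_closed.
  pose X := HB.pack_for (completeNormedModType R) 'rV[R]_n.
  have [|x Bx xT] := @banach_fixed_point R X B TF cT cB.
    by exists x0; rewrite /B /= subrr normr0 ltW.
  have Gx : G x = z.
    have : G x = x - phi x by rewrite /phi opprB addrC subrK.
    have xT' : x = phi x + z := xT.
    by move=> ->; rewrite {1}xT' addrAC subrr add0r.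
  exists x; split => //.
  have := expand x x0 Bx; rewrite subrr normr0 Gx => /(_ (ltW r0)); lra.
pose V := [set z | `|z - G x0| < r / 2].
pose s z := xget x0 [set x | `|x - x0| < r /\ G x = z].
have sP z : V z -> `|s z - x0| < r /\ G (s z) = z.
  by move=> /ex [x Px]; rewrite /s; case: xgetP => [y _ //|/(_ x) []].
have oV : open V by exact: open_norm_ball.
have VG : V (G x0) by rewrite /V /= subrr normr0 divr_gt0.
have sG : s (G x0) = x0.
  have [sr Gs] := sP _ VG; apply/eqP; rewrite -subr_eq0 -normr_eq0.
  have := expand _ x0 (ltW sr); rewrite Gs !subrr !normr0 mulr0 => /(_ (ltW r0)) h.
  by rewrite eq_le h normr_ge0.
                                                                             
pose J x := \matrix_(i < n, j < n) ('D_(delta_mx 0 i) G x) 0 j.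
have JE x (v : 'rV[R]_n) : `|x - x0| <= r -> v *m J x = 'D_v G x.
  move=> /dG dGx; rewrite (deriveE _ dGx) {2}(row_sum_delta v) linear_sum.
  apply/rowP => j; rewrite mxE summxE; apply: eq_bigr => i _.
  by rewrite linearZ mxE -(deriveE _ dGx) mxE.
have Jlow x (v : 'rV[R]_n) : `|x - x0| <= r -> `|v| <= 2 * `|v *m J x|.
  move=> xr; rewrite JE //; have := rD x v xr; have := ler_normD (v - 'D_v G x) ('D_v G x).
  rewrite subrK; lra.
have uJ x : `|x - x0| <= r -> J x \in unitmx.
  move=> xr; rewrite -row_free_unit; apply: inj_row_free => v vJ.
  apply/eqP; rewrite -normr_eq0 eq_le normr_ge0 andbT.
  by have := Jlow x v xr; rewrite vJ normr0 mulr0.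
have sL y z : V y -> V z -> `|s y - s z| <= 2 * `|y - z|.
  move=> /sP [yr {2}<-] /sP [zr {2}<-]; exact: expand (ltW yr) (ltW zr).
have ds z : V z -> differentiable s z /\ forall v, 'D_v s z = v *m invmx (J (s z)).
  move=> Vz; have [zr Gz] := sP z Vz; set x := s z in zr Gz *.
  have [dsz Es] : differentiable s z /\ 'd s z = mulmxr (invmx (J x)) :> (_ -> _).
    apply: diff_approx; first exact: linear_continuous_row.
    move=> e e0.
    have e4 : 0 < e / 4 by rewrite divr_gt0.
    have [d d0 dH] := near_norm_lt (diff_approxP (dG _ (ltW zr)) e4).
    have nV : \forall h \near (0 : 'rV[R]_n), V (h + z).
      have : \forall y \near z, V y by exact: open_nbhs_nbhs.
      by rewrite (near_shift 0 z) subr0.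
    have nd : \forall h \near (0 : 'rV[R]_n), `|h| < d / 2.
      have := norm_lt_near (0 : 'rV[R]_n) (divr_gt0 d0 (ltr0Sn _ 1)).
      by apply: filterS => h; rewrite subr0.
    apply: filterS2 nV nd => h Vh hd /=.
    set k := s (h + z) - s z.
    have kh : `|k| <= 2 * `|h| by have := sL _ _ Vh Vz; rewrite addrK.
    have Gk : G (k + x) - G x = h by rewrite /k subrK (sP _ Vh).2 Gz addrK.
    have kd : `|k| < d by lra.
    have := dH k; rewrite subr0 => /(_ kd); rewrite Gk -(deriveE _ (dG _ (ltW zr))) -(JE _ _ (ltW zr)) => hk.
    have := Jlow x (k - h *m invmx (J x)) (ltW zr).
    rewrite mulmxBl (mulmxKV (uJ _ (ltW zr))) [in X in _ <= 2 * X]distrC.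
    have := ler_wpM2l (ltW e4) kh; lra.
  by split=> // v; rewrite (deriveE _ dsz) Es.
exists V, s; split => //; last by move=> y /sP [/ltW/rU].
have sJ i j : smooths [set x | `|x - x0| < r] (fun x => invmx (J x) i j).
  have oB : open [set x | `|x - x0| < r] by exact: open_norm_ball.
  move=> k; apply: Cks_invmx => // [x /= xr|a b]; first exact: uJ (ltW xr).
  have [_ /(_ (delta_mx 0 a)) /Ck_onE DG] := SG k.+1.
  apply: (@Cks_ext _ _ _ _ (fun x => 'D_(delta_mx 0 a) G x 0 b)) => // [x _|].
    by rewrite mxE.
  by apply: Cks_sub (DG oU b) => x /= xr; apply: rU; exact: ltW.
                                                                       
elim=> [|k IH].
  by move=> z Vz; apply: differentiable_continuous; exact: (ds z Vz).1.
split=> [z Vz|v]; first exact: (ds z Vz).1.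
apply/Ck_onE => // j.
apply: (@Cks_ext _ _ _ _ (fun z => \sum_i v 0 i * invmx (J (s z)) i j)) => //.
  by move=> z Vz; rewrite (ds z Vz).2 mxE.
apply: Cks_sum => // i _; apply: CksM => //; first exact: Cks_cst.
apply: (@Cks_comp _ _ _ _ _ [set x | `|x - x0| < r] s (fun x => invmx (J x) i j)) => //.
  by move=> z /sP [].
exact: sJ.
Qed.

End LocalInverse.

                                                                           
                                                                                    
  
Lemma smooth_local_section m n (U : set 'rV[R]_m) (g : 'rV[R]_m -> 'rV[R]_n) x0 :
  open U -> U x0 -> smooth_on U g -> (forall w, exists v, 'D_v g x0 = w) ->
  exists V s, [/\ open V, V (g x0), smooth_on V s,
    s (g x0) = x0 & forall y, V y -> U (s y) /\ g (s y) = y].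
Proof.
move=> oU Ux0 Sg surj.
have dg : differentiable g x0 by exact: smooth_on_diff Sg Ux0.
have [L LE] := choice (fun j : 'I_n => surj (delta_mx 0 j)).
                                                                            
pose A (y : 'rV[R]_n) : 'rV[R]_m := y *m (\matrix_j L j) + x0.
have A0 : A 0 = x0 by rewrite /A mul0mx add0r.
have SA : smooth_on setT A.
  apply/smooth_onE; first exact: openT.
  move=> j; apply: (@smooths_ext _ _ _ openT
      (fun y => (y *m \matrix_j L j) 0 j + x0 0 j)) => [y _|].
    by rewrite /A [RHS]mxE.
  apply: smoothsD; [exact: openT| |exact: smooths_cst].
  by move: j; apply/smooth_onE; [exact: openT|apply: (@smooth_on_lin _ _ _ openT _ (mulmxr _))].
pose U' := [set y | setT y /\ U (A y)].
have oU' : open U' by exact: (open_preimage openT SA oU).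
have U'0 : U' 0 by split => //; rewrite A0.
have SAU : smooth_on U' A by apply: (@smooth_on_sub _ _ _ oU' _ setT) => //; exact: openT.
have SG : smooth_on U' (g \o A).
  by apply: (smooth_on_comp oU' oU _ SAU Sg) => y [].
have dA : differentiable A 0 by exact: smooth_on_diff SAU U'0.
have DA v : 'D_v A 0 = v *m (\matrix_j L j).
  pose Lf : {linear 'rV[R]_n -> 'rV[R]_m} := mulmxr (\matrix_j L j).
  have cL : continuous Lf by exact: linear_continuous_row.
  have dL : differentiable Lf 0 by exact: linear_differentiable.
  rewrite -[LHS]/('D_v ((Lf : 'rV[R]_n -> 'rV[R]_m) + cst x0) 0) deriveD.
  - by rewrite derive_cst addr0 (deriveE _ dL) (diff_lin _ cL).
  - exact: diff_derivable.
  - exact: derivable_cst.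
have DG v : 'D_v (g \o A) 0 = v.
  have dgA : differentiable g (A 0) by rewrite A0.
  rewrite (deriveE _ (differentiable_comp dA dgA)) (diff_comp dA dgA) /=.
  rewrite -(deriveE _ dA) DA A0 {2}(row_sum_delta v) mulmx_sum_row linear_sum.
  by apply: eq_bigr => j _; rewrite linearZ rowK -(deriveE _ dg) LE.
have [V [s [oV V0 Ss s0 sP]]] := local_inverse_at_id oU' U'0 SG DG.
exists V, (A \o s); rewrite -A0; split => //; last by move=> y /sP [[]].
  by apply: (smooth_on_comp oV openT _ Ss SA).
by rewrite /= s0.
Qed.

End InverseFunction.

                                                

Section SmoothRep.
Variable R : realType.

                                                                                
                                             
Definition smooth_rep T T' m n (c : chart R T m) (d : chart R T' n)
    (f : T -> T') (x : T) : Prop :=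
  exists U g, [/\ cdom c x, U (cmap c x) & local_rep c d f U g].

Lemma smooth_rep_dom T T' m n (c : chart R T m) (d : chart R T' n) f x :
  smooth_rep c d f x -> cdom c x /\ cdom d (f x).
Proof. by move=> [U [g [cx Ux [_ _ _ H]]]]; split => //; case: (H x cx Ux). Qed.

Lemma smooth_rep_comp T T' T'' m n p (c : chart R T m) (d : chart R T' n)
    (e : chart R T'' p) f h x :
  smooth_rep c d f x -> smooth_rep d e h (f x) -> smooth_rep c e (h \o f) x.
Proof.
move=> [U [g [cx Ux [oU Uc Sg gP]]]] [V [k [dx Vx [oV Vd Sk kP]]]].
exists [set u | U u /\ V (g u)], (k \o g); split => //.
  by split => //; have [_ <-] := gP x cx Ux.
have oW := open_preimage oU Sg oV.
split => // [u [/Uc //]| |y cy [Uy Vy]].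
  apply: (smooth_on_comp oW oV _ _ Sk) => [u []//|].
  by apply: smooth_on_sub oU _ Sg => // u [].
have [dy E] := gP y cy Uy.
by have [|ey ->] := kP (f y) dy; rewrite E.
Qed.

Lemma smooth_rep_ext T T' m n (c : chart R T m) (d : chart R T' n) f h x :
  (forall y, cdom c y -> f y = h y) -> smooth_rep c d f x -> smooth_rep c d h x.
Proof.
move=> fh [U [g [cx Ux [oU Uc Sg gP]]]]; exists U, g; split => //; split => // y cy Uy.
by rewrite -fh //; exact: gP.
Qed.

Lemma is_chart_inj T n (c : chart R T n) x y : is_chart c ->
  cdom c x -> cdom c y -> cmap c x = cmap c y -> x = y.
Proof. by move=> [ci _] cx cy; apply: ci; rewrite inE. Qed.

Lemma smooth_transition_rep T n (c d : chart R T n) x :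
  is_chart c -> smooth_transition c d -> cdom c x -> cdom d x ->
  smooth_rep c d id x.
Proof.
move=> cc [ocd [g [Sg gP]]] cx dx.
exists (cmap c @` (cdom c `&` cdom d)), g; split => //; first by exists x.
split => // [_ [y [cy _] <-]|y cy [z [cz dz] zy]]; first by exists y.
have yz : y = z by apply: (is_chart_inj cc).
by subst z; split => //; exact: gP.
Qed.

                                                                                     
                                        
Lemma rep_transition T n (c d : chart R T n) : is_chart c ->
  (forall x, cdom c x -> cdom d x -> smooth_rep c d id x) -> smooth_transition c d.
Proof.
move=> cc H.
have oW : open (cmap c @` (cdom c `&` cdom d)).
  rewrite openE => _ [x [cx dx] <-].
  have [U [g [_ Ux [oU Uc _ gP]]]] := H x cx dx.
  have : nbhs (cmap c x) U by exact: open_nbhs_nbhs.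
  apply: filterS => u Uu; have [y cy yu] := Uc u Uu.
  by exists y => //; split => //; case: (gP y cy); rewrite ?yu.
split => //; pose g u := xget 0 [set v | exists y, [/\ cdom c y, cmap c y = u & cmap d y = v]].
have gE y : cdom c y -> g (cmap c y) = cmap d y.
  move=> cy; rewrite /g; case: xgetP => [v _ [w [cw wy <-]]|/(_ (cmap d y)) []].
    by rewrite (is_chart_inj cc cw cy wy).
  by exists y.
exists g; split; last by move=> x cx _; rewrite gE.
apply: (smooth_on_local oW) => _ [x [cx dx] <-].
have [U [k [_ Ux [oU Uc Sk kP]]]] := H x cx dx.
exists U; split => //; apply: (smooth_on_ext oU _ Sk) => u Uu.
have [y cy yu] := Uc u Uu; subst u; rewrite gE //.
by case: (kP y cy Uu).
Qed.

                                                                                  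
                                                
Lemma smooth_rep_dim T m n (c : chart R T m) (d : chart R T n) x :
  smooth_rep c d id x -> smooth_rep d c id x -> (m <= n)%N.
Proof.
move=> [U [g [cx Ux [oU Uc Sg gP]]]] [V [k [dx Vx [oV Vd Sk kP]]]].
have [_ gx] := gP x cx Ux.
pose W := [set u | U u /\ V (g u)].
have oW : open W := open_preimage oU Sg oV.
have Wx : W (cmap c x) by split => //; rewrite -gx.
                                                  
have kg u : W u -> k (g u) = u.
  move=> [Uu Vu]; have [y cy yu] := Uc u Uu; subst u.
  have [dy gy] := gP y cy Uu; rewrite -gy in Vu *.
  by case: (kP y dy Vu).
have dg : differentiable g (cmap c x) by exact: smooth_on_diff Sg Ux.
have dk : differentiable k (g (cmap c x)) by rewrite -gx; exact: smooth_on_diff Sk Vx.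
apply: (@mulmx1_min _ _ _ (jacobian g (cmap c x)) (jacobian k (g (cmap c x)))).
apply/row_matrixP => i; rewrite row_mul row1 rowE.
rewrite -(deriveEjacobian _ dg) -(deriveEjacobian _ dk) (deriveE _ dk) (deriveE _ dg).
have -> : 'd k (g (cmap c x)) ('d g (cmap c x) (delta_mx 0 i)) =
    'D_(delta_mx 0 i) (k \o g) (cmap c x).
  by rewrite (deriveE _ (differentiable_comp dg dk)) (diff_comp dg dk).
rewrite (near_eq_derive (g := id)) ?derive_id //.
by apply: (open_near_eq oW Wx) => u Wu; exact: kg.
Qed.

                                                                                   
                                                
Definition compat T n (A : atlas R T n) : Prop :=
  (forall c, A c -> is_chart c) /\ (forall c d, A c -> A d -> smooth_transition c d).

Lemma manifold_compat T n (M : set T) (A : atlas R T n) : is_manifold M A -> compat A.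
Proof. by case. Qed.

Section Compat.
Variables (T : Type) (n : nat) (A : atlas R T n).
Hypothesis cA : compat A.

Lemma max_atlas_sub c : A c -> max_atlas A c.
Proof.
move=> Ac; split; first exact: cA.1; first by move=> x cx; exists c.
by move=> d Ad; split; exact: cA.2.
Qed.

Lemma max_atlas_cover c x : max_atlas A c -> cdom c x -> exists2 d, A d & cdom d x.
Proof. by case=> _ H _ /H [d Ad dx]; exists d. Qed.

                                                                                    
  
Lemma max_atlas_rep c d x : max_atlas A c -> max_atlas A d ->
  cdom c x -> cdom d x -> smooth_rep c d id x.
Proof.
move=> Mc Md cx dx; have [e Ae ex] := max_atlas_cover Mc cx.
have [cc _ cH] := Mc; have [_ _ dH] := Md.
have r1 : smooth_rep c e id x by apply: smooth_transition_rep => //; exact: (cH e Ae).1.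
have r2 : smooth_rep e d id x.
  by apply: smooth_transition_rep => //; [exact: cA.1|exact: (dH e Ae).2].
exact: smooth_rep_comp r1 r2.
Qed.

Lemma max_atlasP (c : chart R T n) : is_chart c -> cdom c `<=` \bigcup_(d in A) cdom d ->
  (forall d x, A d -> cdom c x -> cdom d x -> smooth_rep c d id x /\ smooth_rep d c id x) ->
  max_atlas A c.
Proof.
move=> cc cov H; split => // d Ad.
split; apply: rep_transition => //; [|exact: cA.1|] => x cx dx.
  exact: (H d x Ad cx dx).1.
exact: (H d x Ad dx cx).2.
Qed.

Lemma mopen_max_chart c (O : set 'rV[R]_n) : max_atlas A c -> open O ->
  mopen A [set x | cdom c x /\ O (cmap c x)].
Proof.
move=> Mc oO; split=> [x [cx _]|d Ad]; first by have [_ cov _] := Mc; exact: cov.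
rewrite openE => _ [y [[cy Oy] dy] <-].
have [U [g [_ Ux [oU Ud Sg gP]]]] := max_atlas_rep (max_atlas_sub Ad) Mc dy cy.
have oW := open_preimage oU Sg oO.
have : nbhs (cmap d y) [set u | U u /\ O (g u)].
  by apply: open_nbhs_nbhs; split => //; split => //; have [_ <-] := gP y dy Ux.
apply: filterS => u [Uu Ou]; have [z dz zu] := Ud u Uu; subst u.
by have [cz E] := gP z dz Uu; exists z => //; split => //; split => //; rewrite E.
Qed.

Lemma open_max_chart c (W : set T) : max_atlas A c -> mopen A W ->
  open (cmap c @` (W `&` cdom c)).
Proof.
move=> Mc [Wcov oW]; rewrite openE => _ [y [Wy cy] <-].
have [d Ad dy] := Wcov y Wy.
have [U [g [_ Ux [oU Ud Sg gP]]]] := max_atlas_rep Mc (max_atlas_sub Ad) cy dy.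
have oV := open_preimage oU Sg (oW d Ad).
have : nbhs (cmap c y) [set u | U u /\ (cmap d @` (W `&` cdom d)) (g u)].
  apply: open_nbhs_nbhs; split => //; split => //; exists y => //.
  by have [_ <-] := gP y cy Ux.
apply: filterS => u [Uu [z [Wz dz] zu]]; have [w cw wu] := Ud u Uu; subst u.
have [dw E] := gP w cw Uu; exists w => //; split => //.
by rewrite (is_chart_inj (cA.1 _ Ad) dw dz) // E.
Qed.

End Compat.

Section SmoothMaps.
Variables (T T' : Type) (m n : nat) (A : atlas R T m) (A' : atlas R T' n).
Hypotheses (cA : compat A) (cA' : compat A').
Variables (M : set T) (f : T -> T').

                                                                     
Lemma smooth_map_rep c d x : smooth_map M A A' f -> M x ->
  max_atlas A c -> max_atlas A' d -> cdom c x -> cdom d (f x) -> smooth_rep c d f x.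
Proof.
move=> Sf Mx Mc Md cx dx; have [c' [d' [U [g [Ac' Ad' c'x Ux r]]]]] := Sf x Mx.
have r' : smooth_rep c' d' f x by exists U, g.
have [_ d'x] := smooth_rep_dom r'.
have r1 := max_atlas_rep cA Mc (max_atlas_sub cA Ac') cx c'x.
have r2 := max_atlas_rep cA' (max_atlas_sub cA' Ad') Md d'x dx.
exact: smooth_rep_comp (smooth_rep_comp r1 r') r2.
Qed.

Lemma smooth_map_intro : (forall x, M x ->
    exists c d, [/\ max_atlas A c, max_atlas A' d & smooth_rep c d f x]) ->
  smooth_map M A A' f.
Proof.
move=> H x Mx; have [c [d [Mc Md r]]] := H x Mx.
have [cx dx] := smooth_rep_dom r.
have [c' Ac' c'x] := max_atlas_cover Mc cx.
have [d' Ad' d'x] := max_atlas_cover Md dx.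
have r1 := max_atlas_rep cA (max_atlas_sub cA Ac') Mc c'x cx.
have r2 := max_atlas_rep cA' Md (max_atlas_sub cA' Ad') dx d'x.
have [U [g [_ Ux rr]]] := smooth_rep_comp (smooth_rep_comp r1 r) r2.
by exists c', d', U, g.
Qed.

End SmoothMaps.

Lemma smooth_map_comp T T' T'' m n p (A : atlas R T m) (A' : atlas R T' n)
    (A'' : atlas R T'' p) (M : set T) (M' : set T') f h :
  compat A' -> (forall x, M x -> M' (f x)) ->
  smooth_map M A A' f -> smooth_map M' A' A'' h -> smooth_map M A A'' (h \o f).
Proof.
move=> cA' MM' Sf Sh x Mx.
have [c [d [U [g [Ac Ad cx Ux r]]]]] := Sf x Mx.
have [d' [e [U' [g' [Ad' Ae dx' Ux' r']]]]] := Sh (f x) (MM' x Mx).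
have r1 : smooth_rep c d f x by exists U, g.
have r2 : smooth_rep d' e h (f x) by exists U', g'.
have [_ dx] := smooth_rep_dom r1.
have r3 := max_atlas_rep cA' (max_atlas_sub cA' Ad) (max_atlas_sub cA' Ad') dx dx'.
have [V [k [_ Vx rr]]] := smooth_rep_comp (smooth_rep_comp r1 r3) r2.
by exists c, e, V, k.
Qed.

                                                                       
Lemma submersion_descend T T' T'' m n p (A : atlas R T m) (A' : atlas R T' n)
    (A'' : atlas R T'' p) (M : set T) (M' : set T') f h :
  compat A -> compat A' -> compat A'' -> (forall y, M' y -> exists2 x, M x & f x = y) ->
  submersion M A A' f -> smooth_map M A A'' (h \o f) -> smooth_map M' A' A'' h.
Proof.
move=> cA cA' cA'' surj Sf Shf y M'y; have [x Mx xy] := surj y M'y; subst y.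
have [c [d [U [g [Ac Ad cx Ux [[oU Uc Sg gP] Dg]]]]]] := Sf x Mx.
have [V [s [oV Vx Ss sx sP]]] := smooth_local_section oU Ux Sg Dg.
have [c2 [e2 [U2' [g2' [Ac2 Ae2 cx2 Ux2' r2]]]]] := Shf x Mx.
have ex2 : cdom e2 (h (f x)) by have [_ _ _ /(_ x cx2 Ux2') []] := r2.
have [U2 [g2 [_ Ux2 [oU2 U2c Sg2 g2P]]]] := smooth_map_rep cA cA'' Shf Mx
  (max_atlas_sub cA Ac) (max_atlas_sub cA'' Ae2) cx ex2.
have [dx gx] := gP x cx Ux.
have oW := open_preimage oV Ss oU2.
exists d, e2, [set v | V v /\ U2 (s v)], (g2 \o s); split => //.
  by split; rewrite gx // sx.
split => // [v [Vv _]| |y dy [Vy Uy]].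
- have [Usv gsv] := sP v Vv; have [z cz zs] := Uc _ Usv.
  by rewrite -zs in Usv gsv; have [dz E] := gP z cz Usv; exists (f z); rewrite // E.
- apply: (smooth_on_comp oW oU2 _ _ Sg2) => [u []//|].
  by apply: smooth_on_sub oV _ Ss => // u [].
have [Usv gsv] := sP _ Vy; have [z cz zs] := Uc _ Usv.
rewrite -zs in Usv gsv Uy; have [dz E] := gP z cz Usv.
have -> : y = f z by apply: (is_chart_inj (cA'.1 _ Ad)) => //; rewrite E.
by have [ez ->] := g2P z cz Uy; rewrite /= E gsv -zs.
Qed.

End SmoothRep.

                                             

Section Submanifolds.
Variable R : realType.

                                                                                      
           
Definition pad_coords k n (v : 'rV[R]_k) : 'rV[R]_n :=
  \row_(j < n) oapp (fun i : 'I_k => v 0 i) 0 (insub (j : nat)).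

Lemma smooths_coord m (U : set 'rV[R]_m) i : smooths U (fun v => v 0 i).
Proof. by move=> k; exact: Cks_coord. Qed.

Lemma smooth_on_first_coords n k (U : set 'rV[R]_n) : open U ->
  smooth_on U (@first_coords R n k).
Proof.
move=> oU; apply/smooth_onE => // j.
apply: (@smooths_ext _ _ _ oU (fun v : 'rV_n =>
  oapp (fun i : 'I_n => v 0 i) 0 (insub (j : nat)))) => [v _|]; first by rewrite mxE.
by case: insubP => [i _ _|_] /=; [exact: smooths_coord|exact: smooths_cst].
Qed.

Lemma smooth_on_pad_coords n k (U : set 'rV[R]_k) : open U ->
  smooth_on U (@pad_coords k n).
Proof.
move=> oU; apply/smooth_onE => // j.
apply: (@smooths_ext _ _ _ oU (fun v : 'rV_k =>
  oapp (fun i : 'I_k => v 0 i) 0 (insub (j : nat)))) => [v _|]; first by rewrite mxE.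
by case: insubP => [i _ _|_] /=; [exact: smooths_coord|exact: smooths_cst].
Qed.

Lemma pad_coordsK n k (v : 'rV[R]_k) : (k <= n)%N -> first_coords k (pad_coords n v) = v.
Proof.
move=> kn; apply/rowP => i; rewrite mxE insubT ?(leq_trans (ltn_ord i)) //= => lt.
rewrite mxE /= insubT //= => lt'; congr (v 0 _); exact: val_inj.
Qed.

Lemma first_coordsK n k (w : 'rV[R]_n) :
  (forall j : 'I_n, (k <= j)%N -> w 0 j = 0) -> pad_coords n (first_coords k w) = w.
Proof.
move=> H; apply/rowP => j; rewrite mxE; case: insubP => [i _ ij|] /=.
  by rewrite mxE ij insubT //= => lt; congr (w 0 _); exact: val_inj.
by rewrite -leqNgt => /H ->.
Qed.

Lemma pad_coords_ge n k (v : 'rV[R]_k) (j : 'I_n) : (k <= j)%N -> pad_coords n v 0 j = 0.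
Proof. by move=> kj; rewrite mxE insubF // ltnNge kj. Qed.

Section Slice.
Variables (T : Type) (n : nat) (A : atlas R T n) (S : set T) (k : nat).
Hypotheses (cA : compat A) (kn : (k <= n)%N).

Definition slice_restr (c : chart R T n) : chart R T k :=
  (S `&` cdom c, fun x => first_coords k (cmap c x)).

Lemma sub_atlasP c : sub_atlas A S k c <-> exists2 d, slice_chart A S k d & c = slice_restr d.
Proof. by split=> [[d Sd <-]|[d Sd ->]]; exists d. Qed.

Lemma slice_pad c x : slice_chart A S k c -> S x -> cdom c x ->
  pad_coords n (first_coords k (cmap c x)) = cmap c x.
Proof. by move=> [_ H] Sx cx; apply: first_coordsK; apply/(H x cx). Qed.

                                                                                     
                                                                        
Lemma slice_image c (W : set T) : slice_chart A S k c ->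
  cmap (slice_restr c) @` (W `&` cdom (slice_restr c)) =
  [set v | (cmap c @` (W `&` cdom c)) (pad_coords n v)].
Proof.
move=> Sc; apply/seteqP; split=> [_ [x [Wx [Sx cx]] <-]|v [x [Wx cx] xv]] /=.
  by exists x => //; rewrite (slice_pad Sc).
exists x; last by rewrite /cmap /= -/(cmap c x) xv pad_coordsK.
by split => //; split => //; apply/(Sc.2 x cx) => j; rewrite xv; exact: pad_coords_ge.
Qed.

Lemma open_pad (O : set 'rV[R]_n) : open O -> open [set v : 'rV_k | O (pad_coords n v)].
Proof.
move=> oO; have := open_preimage openT (@smooth_on_pad_coords n k setT openT) oO.
by rewrite (_ : [set _ | _ /\ _] = [set v : 'rV_k | O (pad_coords n v)]) //; apply/seteqP; split=> v // [].
Qed.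

Lemma slice_restr_chart c : slice_chart A S k c -> is_chart (slice_restr c).
Proof.
move=> Sc; have [[cc _ _] _] := Sc; split.
  move=> x y; rewrite !inE => -[Sx cx] [Sy cy] E; apply: (is_chart_inj cc) => //.
  by rewrite -(slice_pad Sc Sx cx) -(slice_pad Sc Sy cy); congr pad_coords.
have := slice_image setT Sc; rewrite !setTI => ->; apply: open_pad.
by case: cc.
Qed.

Lemma slice_incl_rep c x : slice_chart A S k c -> S x -> cdom c x ->
  smooth_rep (slice_restr c) c id x.
Proof.
move=> Sc Sx cx; have [[cc _ _] _] := Sc.
have oU : open (cmap (slice_restr c) @` cdom (slice_restr c)) by case: (slice_restr_chart Sc).
exists (cmap (slice_restr c) @` cdom (slice_restr c)), (@pad_coords k n).
split => //; first by exists x.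
split => //; first exact: smooth_on_pad_coords.
by move=> y [Sy cy] _; split => //; rewrite (slice_pad Sc Sy cy).
Qed.

Lemma slice_restr_rep T' m (c : chart R T' m) d (f : T' -> T) x : slice_chart A S k d ->
  (forall y, cdom c y -> S (f y)) -> smooth_rep c d f x -> smooth_rep c (slice_restr d) f x.
Proof.
move=> Sd fS [U [g [cx Ux [oU Uc Sg gP]]]].
exists U, (@first_coords R n k \o g); split => //; split => //.
  apply: (smooth_on_comp oU openT _ Sg) => //; exact: smooth_on_first_coords openT.
move=> y cy Uy; have [dy E] := gP y cy Uy; split; first by split => //; exact: fS.
by rewrite /= -E.
Qed.

Lemma sub_atlas_compat : compat (sub_atlas A S k).
Proof.
split=> [c /sub_atlasP [d Sd ->]|c d /sub_atlasP [c' Sc ->] /sub_atlasP [d' Sd ->]].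
  exact: slice_restr_chart.
apply: rep_transition; first exact: slice_restr_chart.
move=> x [Sx cx] [_ dx]; apply: slice_restr_rep => //; first by move=> y [].
have r1 := slice_incl_rep Sc Sx cx.
have r2 := max_atlas_rep cA Sc.1 Sd.1 cx dx.
exact: smooth_rep_comp r1 r2.
Qed.

Hypothesis SA : forall x, S x -> exists2 c, slice_chart A S k c & cdom c x.

Lemma sub_atlas_cover : S = \bigcup_(c in sub_atlas A S k) cdom c.
Proof.
apply/seteqP; split=> [x Sx|x [_ /sub_atlasP [c Sc ->] []] //].
have [c Sc cx] := SA Sx; exists (slice_restr c) => //.
by apply/sub_atlasP; exists c.
Qed.

Lemma sub_atlas_mopen (W : set T) : mopen A W -> mopen (sub_atlas A S k) (W `&` S).
Proof.
move=> oW; split=> [x [Wx Sx]|_ /sub_atlasP [c Sc ->]].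
  by rewrite -sub_atlas_cover.
have -> : W `&` S `&` cdom (slice_restr c) = W `&` cdom (slice_restr c).
  by apply/seteqP; split=> x [] => [[Wx _] []//|Wx [Sx cx]].
rewrite slice_image //; apply: open_pad.
exact: (open_max_chart cA Sc.1 oW).
Qed.

                                                                                   
                                                    
Lemma sub_atlas_mopen_ext (W : set T) x : mopen (sub_atlas A S k) W -> W x ->
  exists W', [/\ mopen A W', W' x & W' `&` S `<=` W].
Proof.
move=> [Wc Wo] Wx; have [_ /sub_atlasP [c Sc ->] [Sx cx]] := Wc x Wx.
have Ac : sub_atlas A S k (slice_restr c) by apply/sub_atlasP; exists c.
have [cc _ _] := Sc.1.
pose O := cmap (slice_restr c) @` (W `&` cdom (slice_restr c)).
have oO : open O by exact: Wo.
have := open_preimage openT (@smooth_on_first_coords n k setT openT) oO.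
set O' := [set _ | _] => oO'.
exists [set y | cdom c y /\ O' (cmap c y)]; split.
- exact: mopen_max_chart Sc.1 oO'.
- by split => //; split => //; exists x.
move=> y [[cy [_ [z [Wz [Sz cz]] zy]]] Sy].
suff -> : y = z by [].
by apply: (is_chart_inj (slice_restr_chart Sc)).
Qed.

                                                                                 
                                   
Lemma sub_atlas_manifold (M : set T) : is_manifold M A -> S `<=` M ->
  is_manifold S (sub_atlas A S k).
Proof.
move=> [_ _ _ haus [B [oB bB]]] SM; have [c1 c2] := sub_atlas_compat.
split => //; first exact: sub_atlas_cover.
  move=> x y Sx Sy xy; have [U [V [oU oV Ux Vy UV]]] := haus x y (SM _ Sx) (SM _ Sy) xy.
  exists (U `&` S), (V `&` S); split => //; try exact: sub_atlas_mopen.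
  by rewrite setIACA UV set0I.
exists (fun i => B i `&` S); split=> [i|W x oW Wx]; first exact: sub_atlas_mopen.
have [W' [oW' W'x W'W]] := sub_atlas_mopen_ext oW Wx.
have Sx : S x by rewrite sub_atlas_cover; case: oW => + _; apply.
have [i [Bx BW]] := bB _ x oW' W'x; exists i; split => // y [By Sy].
by apply: W'W; split => //; exact: BW.
Qed.

Lemma slice_chart_max c : slice_chart A S k c -> max_atlas (sub_atlas A S k) (slice_restr c).
Proof. by move=> Sc; apply: (max_atlas_sub sub_atlas_compat); apply/sub_atlasP; exists c. Qed.

Lemma smooth_incl : smooth_map S (sub_atlas A S k) A id.
Proof.
apply: (smooth_map_intro sub_atlas_compat cA) => x Sx.
have [c Sc cx] := SA Sx; exists (slice_restr c), c.
by split; [exact: slice_chart_max|exact: Sc.1|exact: slice_incl_rep].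
Qed.

Lemma smooth_corestr T' m (A' : atlas R T' m) (M : set T') f : compat A' ->
  (forall c x, A' c -> cdom c x -> S (f x)) -> smooth_map M A' A f ->
  smooth_map M A' (sub_atlas A S k) f.
Proof.
move=> cA' fS Sf; apply: (smooth_map_intro cA' sub_atlas_compat) => x Mx.
have [c [d [U [g [Ac Ad cx Ux r]]]]] := Sf x Mx.
have [d' Sd d'x] := SA (fS c x Ac cx).
have Mc := max_atlas_sub cA' Ac.
exists c, (slice_restr d'); split => //; first exact: slice_chart_max.
apply: slice_restr_rep => //; first by move=> y; exact: fS Ac.
by apply: (smooth_map_rep cA' cA Sf Mx Mc Sd.1 cx d'x).
Qed.

End Slice.

Definition open_chart m (U : set 'rV[R]_m) : chart R 'rV[R]_m m := (U, id).
Definition open_atlas m (U : set 'rV[R]_m) : atlas R 'rV[R]_m m := [set open_chart U].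

Lemma open_atlas_compat m (U : set 'rV[R]_m) : open U -> compat (open_atlas U).
Proof.
move=> oU; have cU : is_chart (open_chart U) by split; rewrite ?image_id.
split=> [_ -> //|_ _ -> ->].
apply: rep_transition => // x Ux _; exists U, id; split => //; split => //.
  by rewrite image_id.
by apply: (@smooth_on_lin _ _ _ oU _ idfun).
Qed.

                                                                                    
         
Lemma smooth_map_open T m n (A : atlas R T n) (U : set 'rV[R]_m) f (W : set T) :
  compat A -> open U -> smooth_map U (open_atlas U) A f -> mopen A W ->
  open [set u | U u /\ W (f u)].
Proof.
move=> cA oU Sf oW; rewrite openE => x [Ux Wfx].
have [c [d [V [g [-> Ad _ Vx [oV VU Sg gP]]]]]] := Sf x Ux.
have [dx E] := gP x Ux Vx.
have oY := open_preimage oV Sg (oW.2 d Ad).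
have : nbhs x [set u | V u /\ (cmap d @` (W `&` cdom d)) (g u)].
  apply: open_nbhs_nbhs; split => //; split => //; exists (f x) => //.
apply: filterS => u [Vu [y [Wy dy] yu]].
have [u' Uu' uu] := VU u Vu; have {}uu : u' = u by []; subst u'.
have [du Eu] := gP u Uu' Vu; split => //.
suff -> : f u = y by [].
by apply: (is_chart_inj (cA.1 _ Ad)) => //; rewrite Eu.
Qed.

Lemma smooth_on_row_mx m n p (U : set 'rV[R]_m) (f : 'rV[R]_m -> 'rV[R]_n)
    (g : 'rV[R]_m -> 'rV[R]_p) : open U ->
  smooth_on U f -> smooth_on U g -> smooth_on U (fun u => row_mx (f u) (g u)).
Proof.
move=> oU /(smooth_onE oU) Sf /(smooth_onE oU) Sg; apply/smooth_onE => // j.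
case: (fintype.splitP j) => i ji.
  have -> : j = lshift p i by exact: val_inj.
  by apply: (@smooths_ext _ _ _ oU (fun u => f u 0 i)) => // u _; rewrite row_mxEl.
have -> : j = rshift n i by exact: val_inj.
by apply: (@smooths_ext _ _ _ oU (fun u => g u 0 i)) => // u _; rewrite row_mxEr.
Qed.

Lemma smooth_rep_row T m n p (c : chart R T m) (f : T -> 'rV[R]_n) (h : T -> 'rV[R]_p) x :
  smooth_rep c (open_chart setT) f x -> smooth_rep c (open_chart setT) h x ->
  smooth_rep c (open_chart setT) (fun y => row_mx (f y) (h y)) x.
Proof.
move=> [U [g [cx Ux [oU Uc Sg gP]]]] [V [k [_ Vx [oV Vc Sk kP]]]].
have oW : open (U `&` V) by exact: openI.
exists (U `&` V), (fun u => row_mx (g u) (k u)); split => //; split => //.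
- by move=> u [/Uc].
- apply: smooth_on_row_mx => //.
    by apply: (smooth_on_sub oW oU _ Sg) => u [].
  by apply: (smooth_on_sub oW oV _ Sk) => u [].
move=> y cy [Uy Vy]; split => //.
have [_ E1] := gP y cy Uy; have [_ E2] := kP y cy Vy.
by rewrite -E1 -E2.
Qed.

Definition prod_chart T T' m n (c : chart R T m) (d : chart R T' n) :
  chart R (T * T') (m + n) :=
  (cdom c `*` cdom d, fun z => row_mx (cmap c z.1) (cmap d z.2)).

Lemma prod_atlas_chart T T' m n (A : atlas R T m) (A' : atlas R T' n) c d :
  A c -> A' d -> prod_atlas A A' (prod_chart c d).
Proof. by move=> Ac Ad; exists c => //; exists d. Qed.

Lemma prod_chart_proj T T' m n (c : chart R T m) (d : chart R T' n) z :
  is_chart c -> is_chart d -> cdom c z.1 -> cdom d z.2 ->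
  smooth_rep (prod_chart c d) c fst z /\ smooth_rep (prod_chart c d) d snd z.
Proof.
move=> [_ oc] [_ od] cz dz.
have Sl := @smooth_on_lin R (m + n) setT openT m lsubmx.
have Sr := @smooth_on_lin R (m + n) setT openT n rsubmx.
have oU := open_preimage openT Sl oc.
have oV := open_preimage oU (smooth_on_sub oU openT (@subsetT _ _) Sr) od.
set W := [set _ | _] in oV.
have Wz : W (cmap (prod_chart c d) z).
  split; first by split => //; exists z.1 => //; rewrite -[RHS]/(lsubmx (row_mx _ _)) row_mxKl.
  by exists z.2 => //; rewrite -[RHS]/(rsubmx (row_mx _ _)) row_mxKr.
have Wim : W `<=` cmap (prod_chart c d) @` cdom (prod_chart c d).
  move=> w [[_ [x cx xw]] [y dy yw]]; exists (x, y); first by split.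
  by rewrite /cmap /= -/(cmap c x) -/(cmap d y) xw yw hsubmxK.
split.
  exists W, lsubmx; split => //; split => //; first exact: (smooth_on_sub oV openT).
  by move=> x [cx _] _; split => //; rewrite -[RHS]/(lsubmx (row_mx _ _)) row_mxKl.
exists W, rsubmx; split => //; split => //; first exact: (smooth_on_sub oV openT).
by move=> x [_ dx] _; split => //; rewrite -[RHS]/(rsubmx (row_mx _ _)) row_mxKr.
Qed.

End Submanifolds.

                                            

Section QuatAlgebra.
Variable R : realType.
Local Notation H := (quat R).
Implicit Types p q w : H.

Lemma qcoordN q i : qcoord (- q) i = - qcoord q i.
Proof. by rewrite /qcoord mxE. Qed.

Lemma qcoord_scale (a : R) q i : qcoord (a *: q) i = a * qcoord q i.
Proof. by rewrite /qcoord mxE. Qed.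

Lemma qcoord_mul p q i : qcoord (p * q) i = qcoord (quat_mul p q) i.
Proof. by []. Qed.

Lemma qcoord_one i : (i < 4)%N -> qcoord (1 : H) i = (i == 0%N)%:R.
Proof. by case: i => [|[|[|[|]]]] // _; rewrite -[1]/(@quat_one R) /quat_one qcoord_mk. Qed.

Lemma qcoord_one0 : qcoord (1 : H) 0 = 1. Proof. exact: qcoord_one. Qed.
Lemma qcoord_one1 : qcoord (1 : H) 1 = 0. Proof. exact: qcoord_one. Qed.
Lemma qcoord_one2 : qcoord (1 : H) 2 = 0. Proof. exact: qcoord_one. Qed.
Lemma qcoord_one3 : qcoord (1 : H) 3 = 0. Proof. exact: qcoord_one. Qed.

Lemma qcoord_mul0 p q : qcoord (p * q) 0 = qcoord p 0 * qcoord q 0 -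
  qcoord p 1 * qcoord q 1 - qcoord p 2 * qcoord q 2 - qcoord p 3 * qcoord q 3.
Proof. by rewrite qcoord_mul /quat_mul qcoord_mk. Qed.
Lemma qcoord_mul1 p q : qcoord (p * q) 1 = qcoord p 0 * qcoord q 1 +
  qcoord p 1 * qcoord q 0 + qcoord p 2 * qcoord q 3 - qcoord p 3 * qcoord q 2.
Proof. by rewrite qcoord_mul /quat_mul qcoord_mk. Qed.
Lemma qcoord_mul2 p q : qcoord (p * q) 2 = qcoord p 0 * qcoord q 2 -
  qcoord p 1 * qcoord q 3 + qcoord p 2 * qcoord q 0 + qcoord p 3 * qcoord q 1.
Proof. by rewrite qcoord_mul /quat_mul qcoord_mk. Qed.
Lemma qcoord_mul3 p q : qcoord (p * q) 3 = qcoord p 0 * qcoord q 3 +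
  qcoord p 1 * qcoord q 2 - qcoord p 2 * qcoord q 1 + qcoord p 3 * qcoord q 0.
Proof. by rewrite qcoord_mul /quat_mul qcoord_mk. Qed.

Lemma qcoord_conj0 q : qcoord (qconj q) 0 = qcoord q 0.
Proof. by rewrite /qconj qcoord_mk. Qed.
Lemma qcoord_conj1 q : qcoord (qconj q) 1 = - qcoord q 1.
Proof. by rewrite /qconj qcoord_mk. Qed.
Lemma qcoord_conj2 q : qcoord (qconj q) 2 = - qcoord q 2.
Proof. by rewrite /qconj qcoord_mk. Qed.
Lemma qcoord_conj3 q : qcoord (qconj q) 3 = - qcoord q 3.
Proof. by rewrite /qconj qcoord_mk. Qed.

                                                                            
                                       
Definition qcoordE := (qcoordD, qcoordN, qcoord_scale, qcoord0, qcoord_one0,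
  qcoord_one1, qcoord_one2, qcoord_one3, qcoord_mul0, qcoord_mul1, qcoord_mul2,
  qcoord_mul3, qcoord_conj0, qcoord_conj1, qcoord_conj2, qcoord_conj3).

Ltac qring := apply: quat_ext; rewrite !qcoordE; ring.

Lemma quat_scaleAl (a : R) p q : (a *: p) * q = a *: (p * q).
Proof. by qring. Qed.
Lemma quat_scaleAr (a : R) p q : p * (a *: q) = a *: (p * q).
Proof. by qring. Qed.
Lemma qconjM p q : qconj (p * q) = qconj q * qconj p.
Proof. by qring. Qed.
Lemma qconjD p q : qconj (p + q) = qconj p + qconj q.
Proof. by qring. Qed.
Lemma qconjN q : qconj (- q) = - qconj q.
Proof. by qring. Qed.
Lemma qconjB p q : qconj (p - q) = qconj p - qconj q.
Proof. by qring. Qed.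
Lemma qconjK q : qconj (qconj q) = q.
Proof. by qring. Qed.
Lemma qconjZ (a : R) q : qconj (a *: q) = a *: qconj q.
Proof. by qring. Qed.
Lemma qconj1 : qconj 1 = 1 :> H.
Proof. by qring. Qed.
Lemma qconj0 : qconj 0 = 0 :> H.
Proof. by qring. Qed.

                                                                            
               
Definition nsq q : R := qnorm q ^+ 2.

Lemma nsqE q : nsq q =
  qcoord q 0 ^+ 2 + qcoord q 1 ^+ 2 + qcoord q 2 ^+ 2 + qcoord q 3 ^+ 2.
Proof. exact: qnorm_sqr. Qed.

Lemma mul_qconj q : q * qconj q = nsq q *: (1 : H).
Proof. by rewrite nsqE; qring. Qed.
Lemma mul_conjq q : qconj q * q = nsq q *: (1 : H).
Proof. by rewrite nsqE; qring. Qed.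
Lemma add_qconj q : q + qconj q = (2 * qcoord q 0) *: (1 : H).
Proof. by qring. Qed.

Lemma nsqM p q : nsq (p * q) = nsq p * nsq q.
Proof. by rewrite !nsqE !qcoordE; ring. Qed.
Lemma nsq_conj q : nsq (qconj q) = nsq q.
Proof. by rewrite !nsqE !qcoordE; ring. Qed.
Lemma nsqN q : nsq (- q) = nsq q.
Proof. by rewrite !nsqE !qcoordE; ring. Qed.
Lemma nsqZ (a : R) q : nsq (a *: q) = a ^+ 2 * nsq q.
Proof. by rewrite !nsqE !qcoordE; ring. Qed.
Lemma nsq1 : nsq 1 = 1.
Proof. by rewrite !nsqE !qcoordE; ring. Qed.
Lemma nsq0 : nsq 0 = 0.
Proof. by rewrite !nsqE !qcoordE; ring. Qed.
Lemma nsq_ge0 q : 0 <= nsq q. Proof. exact: sqr_ge0. Qed.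
Lemma nsq_coord q i : (i < 4)%N -> qcoord q i ^+ 2 <= nsq q.
Proof.
rewrite nsqE; have := sqr_ge0 (qcoord q 0); have := sqr_ge0 (qcoord q 1).
have := sqr_ge0 (qcoord q 2); have := sqr_ge0 (qcoord q 3).
by case: i => [|[|[|[|]]]] // *; lra.
Qed.

Lemma nsq_eq0P q : (nsq q == 0) = (q == 0).
Proof.
apply/eqP/eqP => [|->]; last exact: nsq0.
rewrite nsqE; exact: nsq_eq0.
Qed.

Lemma nsq_gt0 q : (0 < nsq q) = (q != 0).
Proof. by rewrite lt_def nsq_ge0 andbT nsq_eq0P. Qed.

Lemma qnorm_ge0 q : 0 <= qnorm q. Proof. exact: sqrtr_ge0. Qed.

Lemma qnorm_lt1 q : (qnorm q < 1) = (nsq q < 1).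
Proof. by rewrite /nsq -{2}(expr1n _ 2) ltr_pXn2r // nnegrE ?qnorm_ge0. Qed.

Lemma qnorm_eq1 q : (qnorm q == 1) = (nsq q == 1).
Proof. by rewrite /nsq -{2}(expr1n _ 2) eqrXn2 // qnorm_ge0. Qed.

Lemma Sp1P q : Sp1 R q <-> nsq q = 1.
Proof. by split=> /eqP; [rewrite qnorm_eq1|rewrite -qnorm_eq1] => /eqP. Qed.

Lemma quat_unitE q : (q \is a GRing.unit) = (q != 0).
Proof. by []. Qed.

Lemma quat_invE q : q^-1 = (nsq q)^-1 *: qconj q.
Proof. by []. Qed.

Lemma nsqV q : nsq q^-1 = (nsq q)^-1.
Proof.
have [->|q0] := eqVneq q 0; first by rewrite invr0 nsq0 invr0.
by rewrite quat_invE nsqZ nsq_conj expr2 -mulrA mulVf ?mulr1 // nsq_eq0P.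
Qed.

Lemma invr_Sp1 u : nsq u = 1 -> u^-1 = qconj u.
Proof. by move=> u1; rewrite quat_invE u1 invr1 scale1r. Qed.

Lemma invr_conj q : q != 0 -> qconj q^-1 = (qconj q)^-1.
Proof. by move=> q0; rewrite !quat_invE qconjZ nsq_conj. Qed.

Section MobiusFormula.

                                                                                      
Definition symw w q : H := 1 - (2 * qcoord w 0) *: q + nsq w *: (q * q).

                                                                                    
                          
Definition mobw (P U : H) : H := - (U * qconj P).

                                                                                  
                                                                                      
                                 
Definition mob (P U q : H) : H :=
  let v := 1 - q * qconj (mobw P U) in
  (symw (mobw P U) q)^-1 * (v * P + q * v * U).

Lemma nsq_mobw P U : nsq U = 1 -> nsq (mobw P U) = nsq P.
Proof. by move=> U1; rewrite /mobw nsqN nsqM nsq_conj U1 mul1r. Qed.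

                                                                                     
        
Lemma symwE w q : symw w q = (1 - q * qconj w) - q * (1 - q * qconj w) * w.
Proof. by rewrite /symw nsqE; qring. Qed.

Lemma one_sub_neq0 p q : nsq p * nsq q < 1 -> 1 - p * q != 0.
Proof.
move=> h; apply/eqP => /subr0_eq E; move: h.
by rewrite -nsqM -E nsq1 ltxx.
Qed.

                                                                                 
                            
Lemma symw_neq0 w q : nsq q * nsq w < 1 -> symw w q != 0.
Proof.
move=> h; have v0 : 1 - q * qconj w != 0 by apply: one_sub_neq0; rewrite nsq_conj.
rewrite symwE; move: v0; set v := 1 - _ => v0.
apply/eqP => /subr0_eq /(congr1 nsq); rewrite !nsqM => E.
have := nsq_gt0 v; rewrite v0 => nv.
have : nsq v * (1 - nsq q * nsq w) = 0 by rewrite mulrBr mulr1 {1}E; ring.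
move/eqP; rewrite mulf_eq0 gt_eqF //= subr_eq0 => /eqP E1.
by rewrite -E1 ltxx in h.
Qed.

                                                                          
                   
Lemma nsq_mobius_diff x P :
  nsq (1 + x * qconj P) - nsq (P + x) = (1 - nsq x) * (1 - nsq P).
Proof. by rewrite !nsqE !qcoordE; ring. Qed.

                                                                                     
                                                             
Lemma mob_lt1 P U q : nsq P < 1 -> nsq U = 1 -> nsq q < 1 -> nsq (mob P U q) < 1.
Proof.
move=> P1 U1 q1; have w1 := nsq_mobw P U1.
have qw : nsq q * nsq (mobw P U) < 1.
  by rewrite w1; have := nsq_ge0 q; have := nsq_ge0 P; nra.
have s0 := symw_neq0 qw.
have v0 : 1 - q * qconj (mobw P U) != 0 by apply: one_sub_neq0; rewrite nsq_conj.
move: s0; rewrite /mob symwE; move: v0; set v := 1 - _; move=> v0 s0.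
rewrite nsqM nsqV mulrC ltr_pdivrMr ?nsq_gt0 // mul1r.
pose r := v^-1 * q * v.
have qv : q * v = v * r by rewrite /r !mulrA divrr ?mul1r.
have nr : nsq r = nsq q.
  by rewrite /r !nsqM nsqV mulrAC mulVf ?mul1r // nsq_eq0P.
clearbody r; rewrite qv -!mulrA -[X in nsq (X - _)](mulr1 v) -mulrBr -mulrDr !nsqM.
rewrite ltr_pM2l ?nsq_gt0 // /mobw mulrN opprK mulrA -subr_gt0 nsq_mobius_diff.
by rewrite nsqM U1 mulr1 nr mulr_gt0 // subr_gt0.
Qed.

Lemma mob_0 P U : mob P U 0 = P.
Proof. by rewrite /mob /symw mulr0 !scaler0 !mul0r !subr0 addr0 invr1 addr0 !mul1r. Qed.

Lemma mob_rot U q : mob 0 U q = q * U.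
Proof.
have -> : mob 0 U q = (symw 0 q)^-1 * (q * (1 - q * qconj 0) * U).
  by rewrite /mob /mobw !(qconj0, mulr0, oppr0) add0r.
by rewrite /symw qcoord0 mulr0 scale0r nsq0 scale0r subr0 addr0 invr1 mul1r qconj0 mulr0 subr0 mulr1.
Qed.

Section Homogeneous.
Variables a b c d q : H.
Hypotheses (d0 : d != 0) (cd : c * qconj d = a * qconj b).
Let P := d^-1 * b.
Let U := d^-1 * a.

                                                                                
                                                                               
Lemma mobwE : mobw P U = - (d^-1 * c).
Proof.
have ud : qconj d != 0 by rewrite -nsq_eq0P nsq_conj nsq_eq0P.
rewrite /mobw /P /U qconjM invr_conj //; congr (- _).
by rewrite !mulrA -(mulrA _ a) -cd mulrA mulrK.
Qed.

Let v : H := 1 - q * qconj (mobw P U).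

Lemma vconj : v * qconj d = qconj d + q * qconj c.
Proof.
rewrite /v mobwE qconjN mulrN opprK mulrDl mul1r; congr (_ + _).
have ud : qconj d != 0 by rewrite -nsq_eq0P nsq_conj nsq_eq0P.
by rewrite qconjM invr_conj // !mulrA mulrVK.
Qed.

Lemma nsq_scale_mul x : nsq d *: (x * (d^-1 * b)) = x * qconj d * b.
Proof.
by rewrite quat_invE quat_scaleAl quat_scaleAr scalerA mulfV ?nsq_eq0P // scale1r mulrA.
Qed.

End Homogeneous.

                                                                                     
                                                                                      
Lemma mob_hom a b c d q t : d != 0 -> c * qconj d = a * qconj b ->
  nsq c < nsq d -> nsq q < 1 ->
  let v := qconj d + q * qconj c in
  v * b + q * v * a = (v * d + q * v * c) * t -> mob (d^-1 * b) (d^-1 * a) q = t.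
Proof.
move=> d0 cd ncd q1 v E.
have s0 : symw (mobw (d^-1 * b) (d^-1 * a)) q != 0.
  apply: symw_neq0; rewrite (mobwE d0 cd) nsqN nsqM nsqV mulrA.
  have := nsq_gt0 d; rewrite d0 => nd.
  rewrite mulrAC ltr_pdivrMr // mul1r.
  by have := nsq_ge0 q; have := nsq_ge0 c; nra.
have nd : nsq d != 0 by rewrite nsq_eq0P.
rewrite -quat_unitE in s0.
rewrite /mob -[RHS](mulKr s0); congr (_ * _).
apply: (scalerI nd); rewrite scalerDr !nsq_scale_mul // -(mulrA q) (vconj q d0 cd).
rewrite -/v E -quat_scaleAl symwE; congr (_ * _).
rewrite scalerBr {3}(mobwE d0 cd) mulrN scalerN opprK nsq_scale_mul //.
rewrite -[q * _ * qconj d]mulrA (vconj q d0 cd) -/v; congr (_ + _).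
by rewrite -[RHS]mulr1 quat_scaleAl -quat_scaleAr -mul_conjq mulrA (vconj q d0 cd).
Qed.

                                                                                     
                                                                                    
                                                                                     
                              
Lemma mob_transitive p t : nsq p < 1 -> nsq t < 1 ->
  exists P U, [/\ nsq P < 1, nsq U = 1 & mob P U p = t].
Proof.
move=> p1 t1.
pose d := 1 - p * qconj t; pose b := t - p.
pose a := 1 - qconj p * t; pose c := qconj t - qconj p.
have d0 : d != 0.
  by apply: one_sub_neq0; rewrite nsq_conj; have := nsq_ge0 p; have := nsq_ge0 t; nra.
have nd : 0 < nsq d by rewrite nsq_gt0.
have nad : nsq a = nsq d by rewrite !nsqE /a /d !qcoordE; ring.
have nbd : nsq d - nsq b = (1 - nsq p) * (1 - nsq t) by rewrite !nsqE /b /d !qcoordE; ring.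
have ncb : nsq c = nsq b by rewrite !nsqE /b /c !qcoordE; ring.
have pos : 0 < (1 - nsq p) * (1 - nsq t) by rewrite mulr_gt0 // subr_gt0.
exists (d^-1 * b), (d^-1 * a); split.
- rewrite nsqM nsqV mulrC ltr_pdivrMr // mul1r; lra.
- by rewrite nsqM nsqV nad mulVf // gt_eqF.
apply: (mob_hom (c := c)) => //.
- by rewrite /c /d /a /b; qring.
- by rewrite ncb; lra.
set v := qconj d + p * qconj c.
have pv : p * v = v * p by rewrite /v /d /c; qring.
rewrite pv -!(mulrA v) -!mulrDr -mulrA; congr (v * _).
by rewrite /a /b /c /d; qring.
Qed.

End MobiusFormula.

End QuatAlgebra.

                                         

Section Sp11Matrices.
Variable R : realType.
Local Notation H := (quat R).
Implicit Types (X Y A : 'M[H]_2) (P U : H).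

Definition mx2 (a c b d : H) : 'M[H]_2 :=
  \matrix_(i, j) if i == 0 then (if j == 0 then a else c)
                 else (if j == 0 then b else d).

Lemma mx2E a c b d : [/\ mx2 a c b d 0 0 = a, mx2 a c b d 0 1 = c,
  mx2 a c b d 1 0 = b & mx2 a c b d 1 1 = d].
Proof. by split; rewrite mxE. Qed.

Lemma ord2P (i : 'I_2) : i = 0 \/ i = 1.
Proof. by case: i => [[|[|//]] lt]; [left|right]; apply: val_inj. Qed.

Lemma mx2_ext X Y : X 0 0 = Y 0 0 -> X 0 1 = Y 0 1 -> X 1 0 = Y 1 0 ->
  X 1 1 = Y 1 1 -> X = Y.
Proof.
move=> h00 h01 h10 h11; apply/matrixP => i j.
by case: (ord2P i) => ->; case: (ord2P j) => ->.
Qed.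

Lemma mulmx2E X Y i j : (X *m Y) i j = X i 0 * Y 0 j + X i 1 * Y 1 j.
Proof. by rewrite mxE big_ord_recl big_ord1; congr (_ + X i _ * Y _ j); apply: val_inj. Qed.

Lemma ctrmx_I11E X i j : (ctrmx X *m I11 R *m X) i j =
  qconj (X 0 i) * X 0 j - qconj (X 1 i) * X 1 j.
Proof.
rewrite mulmx2E /I11 mul_mx_diag !mxE /= mulr1 mulrN1 mulNr.
by [].
Qed.

Lemma scale1_inj (r s : R) : r *: (1 : H) = s *: (1 : H) -> r = s.
Proof. by move=> /(congr1 (fun q : H => qcoord q 0)); rewrite !qcoordE !mulr1. Qed.

                                                                          
Lemma Sp11P X : Sp11 R X <->
  [/\ nsq (X 0 0) - nsq (X 1 0) = 1, nsq (X 1 1) - nsq (X 0 1) = 1 &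
      qconj (X 0 0) * X 0 1 = qconj (X 1 0) * X 1 1].
Proof.
rewrite /Sp11 /=; split=> [E|[h0 h1 h2]].
  have e i j : qconj (X 0 i) * X 0 j - qconj (X 1 i) * X 1 j = I11 R i j.
    by rewrite -ctrmx_I11E E.
  split.
  - have := e 0 0; rewrite !mul_conjq -scalerBl /I11 !mxE /= => h.
    by apply: scale1_inj; rewrite h scale1r.
  - have := e 1 1; rewrite !mul_conjq -scalerBl /I11 !mxE /= => h.
    by rewrite -opprB; apply: oppr_inj; rewrite opprK; apply: scale1_inj; rewrite h scaleN1r.
  - by have := e 0 1; rewrite /I11 !mxE /= => /subr0_eq.
apply: mx2_ext; rewrite ctrmx_I11E /I11 !mxE /=.
- by rewrite !mul_conjq -scalerBl h0 scale1r.
- by rewrite h2 subrr.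
- apply: (can_inj (@qconjK R)); rewrite qconjB !qconjM !qconjK qconj0 h2 subrr //.
- by rewrite !mul_conjq -scalerBl -opprB h1 scaleN1r.
Qed.

                                                                                
                                                                                     
Lemma Sp11_rel X : Sp11 R X ->
  [/\ X 1 1 != 0, nsq (X 0 1) = nsq (X 1 0), nsq (X 0 0) = nsq (X 1 1) &
      X 0 1 * qconj (X 1 1) = X 0 0 * qconj (X 1 0)].
Proof.
move=> /Sp11P [h0 h1 h2].
have n00 := nsq_ge0 (X 0 0); have n01 := nsq_ge0 (X 0 1).
have n10 := nsq_ge0 (X 1 0); have n11 := nsq_ge0 (X 1 1).
have E := congr1 (@nsq R) h2; rewrite !nsqM !nsq_conj in E.
                                                                                                 
have e1 : nsq (X 0 1) = nsq (X 1 0) by nra.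
have e2 : nsq (X 0 0) = nsq (X 1 1) by lra.
have d0 : X 1 1 != 0 by rewrite -nsq_gt0; lra.
have a0 : qconj (X 0 0) != 0 by rewrite -nsq_gt0 nsq_conj; lra.
split => //; rewrite -quat_unitE in a0; apply: (mulrI a0).
by rewrite !mulrA h2 mul_conjq -mulrA mul_qconj -e2 quat_scaleAr quat_scaleAl mulr1 mul1r.
Qed.

                                                                       
Definition Sp11_inv X : 'M[H]_2 :=
  mx2 (qconj (X 0 0)) (- qconj (X 1 0)) (- qconj (X 0 1)) (qconj (X 1 1)).

Lemma Sp11_invE X : [/\ Sp11_inv X 0 0 = qconj (X 0 0), Sp11_inv X 0 1 = - qconj (X 1 0),
  Sp11_inv X 1 0 = - qconj (X 0 1) & Sp11_inv X 1 1 = qconj (X 1 1)].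
Proof. exact: mx2E. Qed.

Lemma Sp11_mulV X : Sp11 R X -> Sp11_inv X *m X = 1%:M /\ X *m Sp11_inv X = 1%:M.
Proof.
move=> SX; have [d0 e1 e2 e3] := Sp11_rel SX; have /Sp11P [h0 h1 h2] := SX.
have [i00 i01 i10 i11] := Sp11_invE X.
split; apply: mx2_ext; rewrite mulmx2E ?i00 ?i01 ?i10 ?i11 [RHS]mxE /=.
- by rewrite mulNr !mul_conjq -scalerBl h0 scale1r.
- by rewrite mulNr h2 subrr.
- by rewrite mulNr; apply: (can_inj (@qconjK R)); rewrite qconjD qconjN !qconjM !qconjK qconj0 h2 addNr.
- by rewrite mulNr !mul_conjq addrC -scalerBl h1 scale1r.
- by rewrite mulrN !mul_qconj -scalerBl e1 h0 scale1r.
- by rewrite mulrN e3 addNr.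
- by rewrite mulrN; apply: (can_inj (@qconjK R)); rewrite qconjD qconjN !qconjM !qconjK qconj0 e3 subrr.
- by rewrite mulrN !mul_qconj addrC -scalerBl -e1 h1 scale1r.
Qed.

Lemma Sp11_inv_Sp11 X : Sp11 R X -> Sp11 R (Sp11_inv X).
Proof.
move=> SX; have [d0 e1 e2 e3] := Sp11_rel SX; have /Sp11P [h0 h1 h2] := SX.
have [i00 i01 i10 i11] := Sp11_invE X.
apply/Sp11P; rewrite i00 i01 i10 i11 !nsqN !nsq_conj; split.
- by rewrite e1.
- by rewrite -e1.
- rewrite mulrN qconjN mulNr !qconjK; congr (- _).
  exact: esym e3.
Qed.

Lemma Sp11_inv_unique X Y : Sp11 R X -> X *m Y = 1%:M -> Y = Sp11_inv X.
Proof. by move=> /Sp11_mulV [VX _] XY; rewrite -[LHS]mul1mx -VX -mulmxA XY mulmx1. Qed.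

Lemma Sp11_invK X : Sp11 R X -> Sp11_inv (Sp11_inv X) = X.
Proof.
move=> SX; apply/esym/(Sp11_inv_unique (Sp11_inv_Sp11 SX)).
exact: (Sp11_mulV SX).1.
Qed.

                                                                                 
Definition inv_centre X : H := - (qconj (X 1 1))^-1 * qconj (X 0 1).
                                                                 
Definition inv_rotor X : H := (qconj (X 1 1))^-1 * qconj (X 0 0).

Lemma inv_params X : Sp11 R X -> nsq (inv_centre X) < 1 /\ nsq (inv_rotor X) = 1.
Proof.
move=> SX; have [d0 e1 e2 e3] := Sp11_rel SX; have /Sp11P [h0 h1 h2] := SX.
have nd : 0 < nsq (X 1 1) by rewrite nsq_gt0.
rewrite /inv_centre /inv_rotor !nsqM nsqN !nsqV !nsq_conj e2 mulVf ?gt_eqF //; split => //.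
by rewrite mulrC ltr_pdivrMr // mul1r; lra.
Qed.

                                                                                  
                                                                              
Definition Sp11_of P U : 'M[H]_2 :=
  let l := (Num.sqrt (1 - nsq P))^-1 in
  mx2 (l *: qconj U) (- (l *: qconj P)) (- (l *: (P * qconj U))) (l *: (1 : H)).

Lemma Sp11_of_Sp11 P U : nsq P < 1 -> nsq U = 1 ->
  [/\ Sp11 R (Sp11_of P U), inv_centre (Sp11_of P U) = P & inv_rotor (Sp11_of P U) = U].
Proof.
move=> P1 U1; have s0 : 0 < Num.sqrt (1 - nsq P) by rewrite sqrtr_gt0 subr_gt0.
have [x00 x01 x10 x11] := mx2E ((Num.sqrt (1 - nsq P))^-1 *: qconj U)
  (- ((Num.sqrt (1 - nsq P))^-1 *: qconj P))
  (- ((Num.sqrt (1 - nsq P))^-1 *: (P * qconj U))) ((Num.sqrt (1 - nsq P))^-1 *: (1 : H)).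
have l2 : (Num.sqrt (1 - nsq P))^-1 ^+ 2 * (1 - nsq P) = 1.
  by rewrite exprVn sqr_sqrtr ?mulVf ?subr_ge0 ?ltW // gt_eqF // subr_gt0.
have l0 : (Num.sqrt (1 - nsq P))^-1 != 0 by rewrite invr_neq0 // gt_eqF.
split.
- apply/Sp11P; rewrite /Sp11_of x00 x01 x10 x11 !nsqN !nsqZ !nsqM !nsq_conj U1 nsq1.
  split; [by rewrite -[RHS]l2; ring|by rewrite -[RHS]l2; ring|].
  rewrite qconjN !qconjZ qconjM !qconjK mulrN mulNr quat_scaleAl !quat_scaleAr.
  by rewrite quat_scaleAl !mulr1.
- rewrite /inv_centre /Sp11_of x01 x11 qconjZ qconj1 qconjN mulrNN qconjZ qconjK.
  rewrite quat_invE nsqZ nsq1 mulr1 qconjZ qconj1 scalerA quat_scaleAl mul1r scalerA.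
  have s1 : Num.sqrt (1 - nsq P) != 0 by rewrite gt_eqF.
  by rewrite expr2 invfM !invrK mulfK // mulfV // scale1r.
- rewrite /inv_rotor /Sp11_of x00 x11 qconjZ qconj1 qconjZ qconjK.
  rewrite quat_invE nsqZ nsq1 mulr1 qconjZ qconj1 scalerA quat_scaleAl mul1r scalerA.
  have s1 : Num.sqrt (1 - nsq P) != 0 by rewrite gt_eqF.
  by rewrite expr2 invfM !invrK mulfK // mulfV // scale1r.
Qed.

                                                                                     
                                               
Lemma coset_inv_params X Y : coset X Y -> inv_centre Y = inv_centre X /\ inv_rotor Y = inv_rotor X.
Proof.
move=> [u u1 <-]; have /Sp1P nu := u1.
have u0 : qconj u != 0 by rewrite -nsq_gt0 nsq_conj nu.
have E i j : (X *m u%:M) i j = X i j * u.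
  rewrite mulmx2E !mxE; case: (ord2P j) => -> /=; by rewrite !mulr1n !mulr0n !mulr0 ?addr0 ?add0r.
have inv_ (x y : H) : (qconj u * x)^-1 * (qconj u * y) = x^-1 * y.
  have [->|x0] := eqVneq x 0; first by rewrite mulr0 !invr0 !mul0r.
  by rewrite invrM // -mulrA mulKr.
by rewrite /inv_centre /inv_rotor !E !qconjM !mulNr !inv_.
Qed.

Lemma coset_refl X : coset X X.
Proof. by exists 1; [apply/Sp1P; exact: nsq1|rewrite mulmx1]. Qed.

                                                                                
Lemma Sp11_entries X : Sp11 R X ->
  [/\ X 0 0 = qconj (inv_rotor X) * X 1 1, X 0 1 = - qconj (inv_centre X) * X 1 1 &
      X 1 0 = - (inv_centre X * qconj (inv_rotor X)) * X 1 1].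
Proof.
move=> SX; have [d0 e1 e2 e3] := Sp11_rel SX; have /Sp11P [h0 h1 h2] := SX.
have ud : X 1 1 \is a GRing.unit by [].
have ucd : qconj (X 1 1) \is a GRing.unit by rewrite quat_unitE -nsq_gt0 nsq_conj nsq_gt0.
have E1 : X 0 0 = qconj (inv_rotor X) * X 1 1.
  by rewrite /inv_rotor qconjM invr_conj ?qconjK // -?quat_unitE // mulrVK.
have E2 : X 0 1 = - qconj (inv_centre X) * X 1 1.
  by rewrite /inv_centre [- _^-1 * _]mulNr qconjN opprK qconjM invr_conj ?qconjK // -?quat_unitE // mulrVK.
split => //; apply: (can_inj (@qconjK R)).
apply: (mulIr ud); rewrite -h2 {1}E2 {1}E1 !mulNr qconjN !qconjM !qconjK !mulrN !mulNr.
by rewrite !mulrA.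
Qed.

                                                                                   
                                    
Lemma coset_ext X Y : Sp11 R X -> Sp11 R Y -> inv_centre X = inv_centre Y -> inv_rotor X = inv_rotor Y -> coset X = coset Y.
Proof.
suff sub X' Y' : Sp11 R X' -> Sp11 R Y' -> inv_centre X' = inv_centre Y' -> inv_rotor X' = inv_rotor Y' ->
    coset X' `<=` coset Y'.
  by move=> SX SY eqP eqU; apply/seteqP; split; exact: sub.
move=> SX SY eqP eqU _ [u u1 <-].
have [x00 x01 x10] := Sp11_entries SX; have [y00 y01 y10] := Sp11_entries SY.
have [dX _ _ _] := Sp11_rel SX; have [dY _ _ _] := Sp11_rel SY.
have /Sp11P [_ hX _] := SX; have /Sp11P [_ hY _] := SY.
have nX : nsq (X' 0 1) = nsq (inv_centre X') * nsq (X' 1 1) by rewrite x01 nsqM nsqN nsq_conj.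
have nY : nsq (Y' 0 1) = nsq (inv_centre Y') * nsq (Y' 1 1) by rewrite y01 nsqM nsqN nsq_conj.
have nXY : nsq (X' 1 1) = nsq (Y' 1 1).
  rewrite nX eqP in hX; rewrite nY in hY; have := nsq_ge0 (inv_centre Y').
  have : nsq (inv_centre Y') < 1 by exact: (inv_params SY).1.
  nra.
have ud : Y' 1 1 \is a GRing.unit by [].
pose w := (Y' 1 1)^-1 * X' 1 1.
have nw : nsq w = 1 by rewrite nsqM nsqV nXY mulVf // gt_eqF // nsq_gt0.
have XY : X' = Y' *m w%:M.
  apply: mx2_ext; rewrite mulmx2E [w%:M 0 _]mxE [w%:M 1 _]mxE /= ?mulr1n ?mulr0n ?mulr0 ?addr0 ?add0r.
  - by rewrite x00 y00 eqU -[RHS]mulrA mulVKr.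
  - by rewrite x01 y01 eqP -[RHS]mulrA mulVKr.
  - by rewrite x10 y10 eqU eqP -[RHS]mulrA mulVKr.
  - by rewrite mulVKr.
have /Sp1P nu := u1.
exists (w * u); first by apply/Sp1P; rewrite nsqM nw nu mulr1.
by rewrite XY -mulmxA; congr (_ *m _); apply: mx2_ext; rewrite mulmx2E !mxE /=
  ?mulr1n ?mulr0n ?mulr0 ?mul0r ?addr0 ?add0r.
Qed.

End Sp11Matrices.

                                                               

Section PowerSeries.
Variable R : realType.
Local Notation H := (quat R).
Implicit Types (p q w : H) (a b : nat -> H) (f g : H -> H).

Lemma linear_quat_continuous (f : H -> H) :
  (forall (k : R) (u v : H), f (k *: u + v) = k *: f u + f v) -> continuous f.
Proof.
move=> lf; pose F : {linear 'rV[R]_4 -> 'rV[R]_4} :=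
  HB.pack (f : 'rV[R]_4 -> 'rV[R]_4) (GRing.isLinear.Build R 'rV[R]_4 'rV[R]_4 *:%R f lf).
have C : continuous (F : 'rV[R]_4 -> 'rV[R]_4).
  exact: linear_continuous_row.
exact C.
Qed.

Lemma cvg_quat_mull (u : nat -> H) (l p : H) :
  u @ \oo --> l -> (fun n => p * u n) @ \oo --> p * l.
Proof.
have C : continuous (fun x : H => p * x).
  by apply: linear_quat_continuous => k x y; rewrite mulrDr quat_scaleAr.
by move=> ul; exact: (cvg_comp _ _ ul (C l)).
Qed.

Lemma cvg_quat_mulr (u : nat -> H) (l p : H) :
  u @ \oo --> l -> (fun n => u n * p) @ \oo --> l * p.
Proof.
have C : continuous (fun x : H => x * p).
  by apply: linear_quat_continuous => k x y; rewrite mulrDl quat_scaleAl.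
by move=> ul; exact: (cvg_comp _ _ ul (C l)).
Qed.

Lemma cvg_qcoord (u : nat -> H) (l : H) i :
  u @ \oo --> l -> (fun n => qcoord (u n) i) @ \oo --> qcoord l i.
Proof.
have C : continuous (fun x : H => qcoord x i) := @coord_continuous R 1 4 ord0 (inord i).
by move=> ul; exact: (cvg_comp _ _ ul (C l)).
Qed.

Lemma cvg_quatP (u : nat -> H) (l : H) :
  (forall i, (i < 4)%N -> (fun n => qcoord (u n) i) @ \oo --> qcoord l i) ->
  u @ \oo --> l.
Proof.
move=> ul; apply/(@cvgrPdist_lt R H) => e e0.
have : \forall n \near \oo, forall j : 'I_4, `|qcoord l j - qcoord (u n) j| < e.
  apply: filter_forall => j.
  by have /cvgrPdist_lt/(_ e e0) := ul j (ltn_ord j).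
apply: filterS => n h; rewrite [ltLHS]/Num.Def.normr/= mx_normrE.
apply: bigmax_lt => // -[i j] _ /=; rewrite !mxE (ord1 i).
by have := h j; rewrite /qcoord inord_val.
Qed.

                                                                              
                                                                         
Lemma real_pseries_coef0 (c : nat -> R) :
  (forall t : R, 0 < t < 1 -> series (fun n => t ^+ n * c n) @ \oo --> 0) -> c 0%N = 0.
Proof.
move=> hc.
have [M [M0 hM]] : exists M : R, 0 < M /\ forall n, `|(2^-1) ^+ n * c n| <= M.
  have h2 : 0 < (2^-1 : R) < 1 by rewrite invr_gt0 ltr0n /= invf_lt1 ?ltr1n.
  have cv : cvgn (series (fun n => (2^-1 : R) ^+ n * c n)) by apply/cvg_ex; exists 0; exact: hc.
  have /cvg_seq_bounded : cvgn (fun n => (2^-1 : R) ^+ n * c n).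
    by apply/cvg_ex; exists 0; exact: cvg_series_cvg_0.
  move=> /ex_strict_bound_gt0 [M M0 hM]; exists M; split=> // n; apply: ltW; exact: hM.
                                                                                        
have key (t : R) : 0 < t < 4^-1 -> `|c 0%N| <= 4 * M * t.
  move=> /andP [t0 t4].
  pose x := 2 * t; have x0 : 0 < x by rewrite mulr_gt0.
  have x2 : x <= 2^-1 by rewrite /x; lra.
  have xn n : 0 <= x ^+ n by rewrite exprn_ge0 // ltW.
  have bd n : `|t ^+ n * c n| <= x ^+ n * M.
    have -> : t ^+ n * c n = x ^+ n * ((2^-1) ^+ n * c n).
      by rewrite mulrA -exprMn /x mulrAC mulfV ?mul1r.
    by rewrite normrM (ger0_norm (xn n)); apply: ler_wpM2l; [exact: xn|exact: hM].
  have bs N : `|series (fun n => t ^+ n * c n) N.+1 - c 0%N| <= 2 * x * (1 - x ^+ N) * M.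
    elim: N => [|N IH].
      by rewrite seriesSr /series /= big_geq // add0r expr0 mul1r !subrr normr0 mulr0 mul0r.
    rewrite seriesSr addrAC; apply: le_trans (ler_normD _ _) _.
    have := bd N.+1; have xN := xn N.
    rewrite [x ^+ N.+1]exprS => h; have h2 : 0 <= M * x * x ^+ N * (1 - 2 * x).
      by apply: mulr_ge0; [rewrite !mulr_ge0 // ltW|lra].
    apply: le_trans (lerD IH h) _; lra.
  have lim : (fun N => `|series (fun n => t ^+ n * c n) N.+1 - c 0%N|) @ \oo --> `|0 - c 0%N|.
    apply: cvg_norm; apply: cvgB; last exact: cvg_cst.
    have ht : 0 < t < 1 by rewrite t0 /=; lra.
    by have := hc t ht; rewrite -(cvg_shiftS (series _)).
  have nb : \forall N \near \oo,
      `|series (fun n => t ^+ n * c n) N.+1 - c 0%N| <= 4 * M * t.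
    apply: nearW => N; apply: le_trans (bs N) _.
    have : 0 <= x * x ^+ N * M by rewrite !mulr_ge0 // ltW.
    rewrite /x; lra.
  have := limr_le (cvgP _ lim) nb; rewrite (cvg_lim _ lim) // sub0r normrN.
  by apply; exact: eventually_filter.
apply/eqP; rewrite -normr_eq0 eq_le normr_ge0 andbT leNgt; apply/negP => c0.
have [t t0 t1] : exists2 t, 0 < t < 4^-1 & 4 * M * t < `|c 0%N|.
  exists (Num.min 8^-1 (`|c 0%N| / (8 * M))).
    apply/andP; split; first by rewrite lt_min invr_gt0 ltr0n /= divr_gt0 // mulr_gt0.
    by rewrite gt_min; apply/orP; left; lra.
  apply: (@le_lt_trans _ _ (4 * M * (`|c 0%N| / (8 * M)))).
    by rewrite ler_wpM2l ?mulr_ge0 // ?(ltW M0) // ge_min lexx orbT.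
  have -> : 4 * M * (`|c 0%N| / (8 * M)) = `|c 0%N| / 2 by field; rewrite gt_eqF.
  lra.
by have := key t t0; rewrite leNgt t1.
Qed.

Lemma real_pseries_unique (c : nat -> R) :
  (forall t : R, 0 < t < 1 -> series (fun n => t ^+ n * c n) @ \oo --> 0) ->
  forall n, c n = 0.
Proof.
move=> hc n; elim: n c hc => [|n IH] c hc; first exact: real_pseries_coef0.
have c0 := real_pseries_coef0 hc.
apply: (IH (fun n => c n.+1)) => t t01; have /andP [t0 _] := t01.
have E : series (fun n => t ^+ n * c n.+1) =
    (fun N => t^-1 * series (fun n => t ^+ n * c n) N.+1).
  apply/funext; elim=> [|N IHN].
    by rewrite seriesSr /series /= !big_geq // c0 mulr0 addr0 mulr0.
  rewrite seriesSr IHN [in RHS]seriesSr mulrDr; congr (_ + _).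
  by rewrite exprS !mulrA mulVf ?mul1r // gt_eqF.
rewrite E -[X in _ --> X](mulr0 t^-1).
apply: cvgM; first exact: cvg_cst.
by have := hc t t01; rewrite -(cvg_shiftS (series _)).
Qed.

Lemma scale1X (t : R) n : (t *: (1 : H)) ^+ n = t ^+ n *: (1 : H).
Proof.
elim: n => [|n IH]; first by rewrite !expr0 scale1r.
by rewrite exprS IH quat_scaleAl mul1r scalerA -exprS.
Qed.

                                                                                   
          
Lemma expansion_unique f a b : has_expansion f a -> has_expansion f b -> a = b.
Proof.
move=> fa fb; apply/funext => n; apply/subr0_eq.
suff H i : (i < 4)%N -> qcoord (a n - b n) i = 0 by apply: quat_ext; rewrite qcoord0 H.
move=> i4; apply: (@real_pseries_unique (fun n => qcoord (a n - b n) i)) => t /andP [t0 t1].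
have qt : qnorm (t *: (1 : H)) < 1.
  by rewrite qnorm_lt1 nsqZ nsq1 mulr1 expr_lt1 // ltW.
have ha := @cvg_qcoord _ _ i (fa _ qt); have hb := @cvg_qcoord _ _ i (fb _ qt).
have -> : series (fun n => t ^+ n * qcoord (a n - b n) i) =
    (fun N => qcoord (series (fun n => (t *: (1 : H)) ^+ n * a n) N) i -
              qcoord (series (fun n => (t *: (1 : H)) ^+ n * b n) N) i).
  apply/funext; elim=> [|N IH].
    by rewrite /series /= !big_geq // !qcoord0 subrr.
  rewrite !seriesSr IH !qcoordD opprD addrACA; congr (_ + _).
  by rewrite !scale1X !quat_scaleAl !mul1r !qcoord_scale qcoordN mulrDr mulrN.
rewrite -[X in _ --> X](subrr (qcoord (f (t *: (1 : H))) i)).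
exact: cvgB.
Qed.

Lemma coefE f a : has_expansion f a -> coef f = a.
Proof.
move=> fa; rewrite /coef; case: xgetP => [b _ fb|/(_ a)//].
exact: expansion_unique fb fa.
Qed.

Lemma pseriesE a q (l : H) : series (fun n => q ^+ n * a n) @ \oo --> l -> Defs.pseries a q = l.
Proof. by move=> h; apply/cvg_lim => //; exact: norm_hausdorff. Qed.

Lemma expansion_ext f g a : (forall q, nsq q < 1 -> f q = g q) ->
  has_expansion f a -> has_expansion g a.
Proof. by move=> fg fa q q1; rewrite -fg -?qnorm_lt1 //; exact: fa. Qed.

Lemma series_finite (u : nat -> H) N : (forall n, (N <= n)%N -> u n = 0) ->
  series u @ \oo --> series u N.
Proof.
move=> uN; apply: cvg_near_cst; near=> n.
have Nn : (N <= n)%N by near: n; exact: nbhs_infty_ge.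
rewrite -(subnKC Nn); elim: (n - N)%N => [|k IH]; first by rewrite addn0.
by rewrite addnS seriesSr IH uN ?addr0 // leq_addr.
Unshelve. all: by end_near. Qed.

Definition affine_coef p q (n : nat) : H :=
  match n with 0%N => q | 1%N => p | _ => 0 end.

Lemma affine_coef_gt1 p q n : (1 < n)%N -> affine_coef p q n = 0.
Proof. by case: n => [|[|n]]. Qed.

Lemma affine_expansion p q : has_expansion (affine p q) (affine_coef p q).
Proof.
move=> x _; have := @series_finite (fun n => x ^+ n * affine_coef p q n) 2%N.
rewrite /series /= big_nat_recr //= big_nat1 expr0 expr1 mul1r addrC; apply.
by case=> [|[|n]] // _; rewrite mulr0.
Qed.

Lemma reg_conj_affine p q x : nsq x < 1 ->
  reg_conj (affine p q) x = affine (qconj p) (qconj q) x.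
Proof.
move=> x1; apply: pseriesE; rewrite (coefE (@affine_expansion p q)).
have -> : (fun n => x ^+ n * qconj (affine_coef p q n)) =
    (fun n => x ^+ n * affine_coef (qconj p) (qconj q) n).
  by apply/funext => -[|[|n]] //=; rewrite qconj0.
by apply: affine_expansion; rewrite qnorm_lt1.
Qed.

                                                                                 
Lemma symmetrization_affine p q x : nsq x < 1 ->
  symmetrization (affine p q) x =
  nsq q *: (1 : H) + x * (q * qconj p + p * qconj q) + x ^+ 2 * (nsq p *: (1 : H)).
Proof.
move=> x1; apply: pseriesE.
have E : has_expansion (reg_conj (affine p q)) (affine_coef (qconj p) (qconj q)).
  apply: expansion_ext (@affine_expansion (qconj p) (qconj q)) => y y1.
  by rewrite reg_conj_affine.
rewrite (coefE (@affine_expansion p q)) (coefE E).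
set u := (fun n => _).
have u3 n : (3 <= n)%N -> u n = 0.
  move=> n3; rewrite /u big1 ?mulr0 // => k _.
  case: (k : nat) n3 => [|[|m]] n3 /=; rewrite ?mul0r //.
    by rewrite affine_coef_gt1 ?mulr0 // subn0 ltnW.
  by rewrite affine_coef_gt1 ?mulr0 // ltn_subRL.
have e0 : u 0%N = nsq q *: (1 : H).
  rewrite /u big_ord_recr big_ord0; change (1 * (0 + q * qconj q) = nsq q *: (1 : H)).
  by rewrite mul1r add0r mul_qconj.
have e1 : u 1%N = x * (q * qconj p + p * qconj q).
  rewrite /u !big_ord_recr big_ord0.
  change (x * (0 + q * qconj p + p * qconj q) = x * (q * qconj p + p * qconj q)).
  by rewrite add0r.
have e2 : u 2%N = x ^+ 2 * (nsq p *: (1 : H)).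
  rewrite /u !big_ord_recr big_ord0.
  change (x ^+ 2 * (0 + q * 0 + p * qconj p + 0 * qconj q) = x ^+ 2 * (nsq p *: (1 : H))).
  by rewrite mulr0 mul0r !add0r addr0 mul_qconj.
have := series_finite u3; rewrite -e0 -e1 -e2.
by rewrite {2}/series /= !big_nat_recr //= big_geq // add0r.
Qed.

Lemma commr_symw w q : q * symw w q = symw w q * q.
Proof.
rewrite /symw; move: (2 * _) (nsq w) => r s.
by rewrite !mulrDr !mulrDl mulrN mulNr mulr1 mul1r !quat_scaleAl !quat_scaleAr mulrA.
Qed.

Lemma symw_mul w q x :
  symw w q * x = x - (2 * qcoord w 0) *: (q * x) + nsq w *: (q * q * x).
Proof.
rewrite /symw; move: (2 * _) (nsq w) => r s.
by rewrite mulrDl mulrBl mul1r !quat_scaleAl.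
Qed.

                                                                                
                                                                                      
                                       
Lemma geometric_quat w q : nsq q * nsq w < 1 ->
  series (fun n => q ^+ n * w ^+ n) @ \oo --> (symw w q)^-1 * (1 - q * qconj w).
Proof.
move=> qw; have s0 : symw w q \is a GRing.unit by rewrite quat_unitE symw_neq0.
have q0 : (fun n => q ^+ n * w ^+ n) @ \oo --> (0 : H).
  apply: cvg_quatP => i i4; rewrite qcoord0.
  have bnd n : `|qcoord (q ^+ n * w ^+ n) i| ^+ 2 <= (nsq q * nsq w) ^+ n.
    rewrite real_normK ?num_real //; apply: le_trans (nsq_coord _ i4) _.
    have -> : nsq (q ^+ n * w ^+ n) = (nsq q * nsq w) ^+ n => //.
    elim: n => [|n IH]; first by rewrite !expr0 mulr1 nsq1.
    by rewrite !exprS [q * _ * _]mulrA; move: IH; rewrite !nsqM => <-; ring.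
  pose z := Num.sqrt (nsq q * nsq w).
  have qw0 : 0 <= nsq q * nsq w by rewrite mulr_ge0 // nsq_ge0.
  have z1 : `|z| < 1.
    by rewrite ger0_norm ?sqrtr_ge0 // -sqrtr1 ltr_sqrt.
  have bnd' n : `|qcoord (q ^+ n * w ^+ n) i| <= z ^+ n.
    rewrite -(ler_pXn2r (ltn0Sn 1)) ?nnegrE ?exprn_ge0 ?sqrtr_ge0 //.
    by rewrite -exprM mulnC exprM sqr_sqrtr.
  have zn : (fun n => z ^+ n) @ \oo --> (0 : R) by exact: cvg_expr.
  have zn' : (fun n => - z ^+ n) @ \oo --> (0 : R) by rewrite -oppr0; exact: cvgN.
  apply: (squeeze_cvgr _ zn' zn); apply: nearW => n.
  by rewrite -ler_norml.
pose S := series (fun n => q ^+ n * w ^+ n).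
have S1 n : S n - q * S n * w = 1 - q ^+ n * w ^+ n.
  elim: n => [|n IH]; first by rewrite /S /series /= big_geq // mulr0 mul0r !expr0 mulr1 !subrr.
  rewrite /S seriesSr -/(S n) mulrDr mulrDl opprD addrACA IH !exprS.
  have -> : q * (q ^+ n * w ^+ n) * w = q * q ^+ n * (w * w ^+ n).
    by rewrite -(exprS w) exprSr !mulrA.
  by rewrite addrA subrK.
have S2 n : symw w q * S n = (1 - q ^+ n * w ^+ n) - q * (1 - q ^+ n * w ^+ n) * qconj w.
  have e1 : (2 * qcoord w 0) *: (q * S n) = q * S n * (w + qconj w).
    by rewrite add_qconj quat_scaleAr mulr1.
  have e2 : nsq w *: (q * q * S n) = q * q * S n * (w * qconj w).
    by rewrite mul_qconj quat_scaleAr mulr1.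
  rewrite -S1 symw_mul e1 e2.
  rewrite mulrBr mulrBl opprB mulrDr opprD !mulrA -!addrA.
  by congr (_ + (_ + _)); rewrite addrC.
rewrite -/S; have -> : S = (fun n => (symw w q)^-1 * ((1 - q ^+ n * w ^+ n) - q * (1 - q ^+ n * w ^+ n) * qconj w)).
  by apply/funext => n; rewrite -S2 mulKr.
apply: cvg_quat_mull.
have h1 : (fun n => 1 - q ^+ n * w ^+ n) @ \oo --> (1 : H).
  by rewrite -[X in _ --> X]subr0; apply: cvgB => //; exact: cvg_cst.
have h2 := @cvg_quat_mulr _ _ (qconj w) (@cvg_quat_mull _ _ q h1).
by rewrite mulr1 in h2; exact: (cvgB h1 h2).
Qed.

                                                                            
Definition mob_coef (P U : H) (n : nat) : H :=
  mobw P U ^+ n * P + (if n is m.+1 then mobw P U ^+ m * U else 0).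

                                                                                   
                                         
Lemma mob_expansion_gen w P U q : nsq q * nsq w < 1 ->
  series (fun n => q ^+ n * (w ^+ n * P + (if n is m.+1 then w ^+ m * U else 0)))
    @ \oo --> (symw w q)^-1 * ((1 - q * qconj w) * P + q * (1 - q * qconj w) * U).
Proof.
move=> qw; have G := geometric_quat qw.
set T := (symw w q)^-1 * (1 - q * qconj w) in G.
have cs : (symw w q)^-1 * q = q * (symw w q)^-1.
  by apply/esym; apply: commrV; exact: commr_symw.
have -> : (symw w q)^-1 * ((1 - q * qconj w) * P + q * (1 - q * qconj w) * U) = T * P + q * T * U.
  by rewrite mulrDr /T !mulrA cs.
rewrite -(cvg_shiftS (series _)).
have -> : (fun n => series (fun n => q ^+ n * (w ^+ n * P + (if n is m.+1 then w ^+ m * U else 0))) n.+1) =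
    (fun n => series (fun n => q ^+ n * w ^+ n) n.+1 * P + q * series (fun n => q ^+ n * w ^+ n) n * U).
  apply/funext; elim=> [|n IH].
    by rewrite !seriesSr /series /= !big_geq // !add0r mulr0 mul0r !addr0 !expr0 !mul1r.
  rewrite seriesSr IH [in RHS]seriesSr mulrDl -!addrA; congr (_ + _).
  rewrite [series _ n.+1]seriesSr [q * (_ + _)]mulrDr [(_ + _) * U]mulrDl.
  rewrite [q ^+ n.+1 * (_ + _)]mulrDr addrCA.
  by congr (_ + (_ + _)); rewrite ?(exprS q) !mulrA.
apply: cvgD; last by apply: cvg_quat_mulr; exact: cvg_quat_mull.
by apply: cvg_quat_mulr; rewrite (cvg_shiftS (series _)).
Qed.

Lemma mob_expansion P U : nsq P < 1 -> nsq U = 1 -> has_expansion (mob P U) (mob_coef P U).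
Proof.
move=> P1 U1 q; rewrite qnorm_lt1 => q1; apply: mob_expansion_gen.
by rewrite nsq_mobw //; have := nsq_ge0 q; have := nsq_ge0 P; nra.
Qed.

                                                                      
Lemma mob_inj P U P' U' : nsq P < 1 -> nsq U = 1 -> nsq P' < 1 -> nsq U' = 1 ->
  (forall q, nsq q < 1 -> mob P U q = mob P' U' q) -> P = P' /\ U = U'.
Proof.
move=> P1 U1 P1' U1' E.
have EP : P = P' by have := E 0; rewrite nsq0 !mob_0; apply.
split => //; subst P'.
have e : mob_coef P U = mob_coef P U'.
  apply: expansion_unique (mob_expansion P1 U1'); apply: expansion_ext (mob_expansion P1 U1).
  by [].
have := congr1 (fun c => c 1%N) e; rewrite /mob_coef !expr1 !expr0 !mul1r /mobw !mulNr.
rewrite -!mulrA mul_conjq !quat_scaleAr !mulr1 => E1.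
have c0 : 1 - nsq P != 0 by rewrite gt_eqF // subr_gt0.
apply: (scalerI c0); rewrite !scalerBl !scale1r.
by rewrite addrC E1 addrC.
Qed.

Lemma quat_invZ (k : R) (x : H) : k != 0 -> (k *: x)^-1 = k^-1 *: x^-1.
Proof.
move=> k0; rewrite !quat_invE nsqZ qconjZ !scalerA expr2 !invfM; congr (_ *: _).
by rewrite mulrAC mulfVK.
Qed.

                                                                                     
                                                                                
               
Lemma moebiusE (A : 'M[H]_2) q : Sp11 R A -> nsq q < 1 ->
  moebius A q = mob ((A 1 1)^-1 * A 1 0) ((A 1 1)^-1 * A 0 0) q.
Proof.
move=> SA q1; have [d0 e1 e2 e3] := Sp11_rel SA; have /Sp11P [h0 h1 h2] := SA.
move: d0 e1 e2 e3 h0 h1 h2; set d := A 1 1; set c := A 0 1; set a := A 0 0; set b := A 1 0.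
move=> d0 e1 e2 e3 h0 h1 h2.
pose P := d^-1 * b; pose U := d^-1 * a; pose w := mobw P U.
have wE : w = - (d^-1 * c) by apply: mobwE.
have nd : 0 < nsq d by rewrite nsq_gt0.
have nd0 : nsq d != 0 by rewrite gt_eqF.
have nw : nsq w < 1.
  by rewrite wE nsqN nsqM nsqV mulrC ltr_pdivrMr // mul1r; lra.
have qw x : nsq x < 1 -> nsq x * nsq w < 1.
  by move=> x1; have := nsq_ge0 x; have := nsq_ge0 w; nra.
have ud : d \is a GRing.unit by rewrite quat_unitE.
have X : has_expansion (star_recip (affine c d)) (fun n => w ^+ n * d^-1).
  apply: (@expansion_ext (fun x => (symw w x)^-1 * (1 - x * qconj w) * d^-1)).
    move=> x x1; rewrite /star_recip symmetrization_affine // reg_conj_affine //.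
    have us : symw w x \is a GRing.unit by rewrite quat_unitE symw_neq0 // qw.
                                                                                            
    have re : nsq d * qcoord w 0 = - qcoord (d * qconj c) 0.
      rewrite wE quat_invE quat_scaleAl qcoordN qcoord_scale mulrN mulVKf //.
      by rewrite !qcoordE; ring.
    have nwc : nsq d * nsq w = nsq c by rewrite wE nsqN nsqM nsqV mulVKf.
    have sE : nsq d *: (1 : H) + x * (d * qconj c + c * qconj d) + x ^+ 2 * (nsq c *: (1 : H)) =
        nsq d *: symw w x.
      rewrite -[c * qconj d](qconjK (c * qconj d)) qconjM qconjK add_qconj.
      rewrite /symw scalerDr scalerBr !scalerA nwc mulrCA re.
      by rewrite !quat_scaleAr !mulr1 mulrN scaleNr opprK expr2.
    rewrite sE quat_invZ // [RHS]quat_scaleAl -[LHS]mulrA [d^-1]quat_invE quat_scaleAr.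
    by rewrite (vconj x d0 e3) quat_scaleAr /affine addrC.
  move=> x; rewrite qnorm_lt1 => x1.
  have -> : series (fun n => x ^+ n * (w ^+ n / d)) =
      (fun n => series (fun n => x ^+ n * w ^+ n) n * d^-1).
    by apply/funext => n; rewrite /series /= mulr_suml; apply: eq_bigr => k _; rewrite mulrA.
  exact: (cvg_quat_mulr (geometric_quat (qw x x1))).
have nP : nsq P < 1.
  by rewrite nsqM nsqV mulrC ltr_pdivrMr // mul1r; lra.
have nU : nsq U = 1 by rewrite nsqM nsqV e2 mulVf.
apply: pseriesE; rewrite (coefE X) (coefE (@affine_expansion a b)).
have q1' : qnorm q < 1 by rewrite qnorm_lt1.
suff E n : \sum_(k < n.+1) w ^+ k / d * affine_coef a b (n - k) = mob_coef P U n.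
  rewrite (_ : (fun n => _) = (fun n => q ^+ n * mob_coef P U n)).
    exact (mob_expansion nP nU q1').
  by apply/funext => n; rewrite E.
rewrite /mob_coef -/w; case: n => [|n].
  rewrite big_ord_recr big_ord0.
  change (0 + w ^+ 0 * d^-1 * b = w ^+ 0 * P + 0).
  by rewrite addr0 add0r mulrA.
rewrite !big_ord_recr /= big1 ?add0r.
  by rewrite subnn subSnn /= addrC !mulrA.
move=> k _; rewrite affine_coef_gt1 ?mulr0 //.
by rewrite subSn ?ltnS ?subn_gt0 // ltnW.
Qed.

End PowerSeries.

                                      

Section QuatSmooth.
Variables (R : realType) (m : nat) (U : set 'rV[R]_m).
Hypothesis oU : open U.
Local Notation H := (quat R).
Implicit Types f g : 'rV[R]_m -> H.

Definition qsmooth f : Prop := forall i, (i < 4)%N -> smooths U (fun x => qcoord (f x) i).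

Lemma qsmoothP f : smooth_on U (f : 'rV[R]_m -> 'rV[R]_4) <-> qsmooth f.
Proof.
split=> [/(smooth_onE oU) Sf i i4|Sf]; first exact: Sf.
apply/smooth_onE => // j; have := Sf j (ltn_ord j).
by rewrite /qcoord inord_val.
Qed.

Lemma qsmooth_ext f g : (forall x, U x -> f x = g x) -> qsmooth f -> qsmooth g.
Proof.
move=> fg Sf i i4; apply: smooths_ext (Sf i i4) => // x Ux; by rewrite fg.
Qed.

Lemma qsmooth_cst (a : H) : qsmooth (fun=> a).
Proof. by move=> i i4; exact: smooths_cst. Qed.

Lemma qsmoothD f g : qsmooth f -> qsmooth g -> qsmooth (fun x => f x + g x).
Proof.
move=> Sf Sg i i4; apply: (smooths_ext oU _ (smoothsD oU (Sf i i4) (Sg i i4))).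
by move=> x _; rewrite qcoordD.
Qed.

Lemma qsmoothN f : qsmooth f -> qsmooth (fun x => - f x).
Proof.
move=> Sf i i4; apply: (smooths_ext oU _ (smoothsN oU (Sf i i4))).
by move=> x _; rewrite qcoordN.
Qed.

Lemma qsmoothB f g : qsmooth f -> qsmooth g -> qsmooth (fun x => f x - g x).
Proof. by move=> Sf Sg; apply: qsmoothD => //; exact: qsmoothN. Qed.

Lemma qsmoothZ (a : 'rV[R]_m -> R) f : smooths U a -> qsmooth f ->
  qsmooth (fun x => a x *: f x).
Proof.
move=> Sa Sf i i4; apply: (smooths_ext oU _ (smoothsM oU Sa (Sf i i4))).
by move=> x _; rewrite qcoord_scale.
Qed.

Lemma qsmooth_mk (a b c d : 'rV[R]_m -> R) : smooths U a -> smooths U b ->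
  smooths U c -> smooths U d -> qsmooth (fun x => mkquat (a x) (b x) (c x) (d x)).
Proof.
move=> Sa Sb Sc Sd i i4.
apply: (@smooths_ext _ _ _ oU (fun x => [:: a x; b x; c x; d x]`_i)).
  by move=> x _; rewrite qcoord_mk.
by case: i i4 => [|[|[|[|]]]].
Qed.

Lemma qsmoothM f g : qsmooth f -> qsmooth g -> qsmooth (fun x => f x * g x).
Proof.
move=> Sf Sg; have F i (i4 : (i < 4)%N) := Sf i i4; have G i (i4 : (i < 4)%N) := Sg i i4.
apply: qsmooth_mk; do ?[apply: (smoothsD oU)|apply: (smoothsN oU)|apply: (smoothsM oU)];
  (exact: F) || (exact: G).
Qed.

Lemma qsmooth_conj f : qsmooth f -> qsmooth (fun x => qconj (f x)).
Proof.
by move=> Sf; apply: qsmooth_mk; try apply: (smoothsN oU); exact: Sf.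
Qed.

Lemma smooths_nsq f : qsmooth f -> smooths U (fun x => nsq (f x)).
Proof.
move=> Sf; apply: (@smooths_ext _ _ _ oU (fun x => qcoord (f x) 0 * qcoord (f x) 0 +
  qcoord (f x) 1 * qcoord (f x) 1 + qcoord (f x) 2 * qcoord (f x) 2 +
  qcoord (f x) 3 * qcoord (f x) 3)); first by move=> x _; rewrite nsqE -!expr2.
by do 3?[apply: (smoothsD oU)]; apply: (smoothsM oU); exact: Sf.
Qed.

Lemma qsmoothV f : (forall x, U x -> f x != 0) -> qsmooth f -> qsmooth (fun x => (f x)^-1).
Proof.
move=> f0 Sf; apply: (@qsmooth_ext (fun x => (nsq (f x))^-1 *: qconj (f x))) => //.
apply: qsmoothZ; last exact: qsmooth_conj.
apply: (smoothsV oU); last exact: smooths_nsq.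
by move=> x Ux; rewrite nsq_eq0P; exact: f0.
Qed.

Lemma open_pos (f : 'rV[R]_m -> R) : smooths U f -> open [set x | U x /\ 0 < f x].
Proof.
move=> Sf; rewrite openE => x [Ux fx].
have cf : {for x, continuous f} by exact: (Cks_continuous (Sf 0%N) Ux).
have nU : nbhs x U by exact: open_nbhs_nbhs.
have nf : nbhs x (f @^-1` [set r | 0 < r]).
  by apply: cf; apply: open_nbhs_nbhs; split => //; exact: open_gt.
by apply: filterS2 nU nf => y.
Qed.

Lemma qsmooth_symw f g : qsmooth f -> qsmooth g -> qsmooth (fun x => symw (f x) (g x)).
Proof.
move=> Sf Sg; rewrite /symw; apply: qsmoothD.
  apply: qsmoothB; first exact: qsmooth_cst.
  apply: qsmoothZ => //; apply: (smoothsM oU); first exact: smooths_cst.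
  exact: Sf.
by apply: qsmoothZ; [exact: smooths_nsq|exact: qsmoothM].
Qed.

Lemma qsmooth_mob (P V q : 'rV[R]_m -> H) : qsmooth P -> qsmooth V -> qsmooth q ->
  (forall x, U x -> symw (mobw (P x) (V x)) (q x) != 0) ->
  qsmooth (fun x => mob (P x) (V x) (q x)).
Proof.
move=> SP SV Sq s0.
have Sw : qsmooth (fun x => mobw (P x) (V x)).
  by apply: qsmoothN; apply: qsmoothM => //; exact: qsmooth_conj.
have Sv : qsmooth (fun x => 1 - q x * qconj (mobw (P x) (V x))).
  apply: qsmoothB; first exact: qsmooth_cst.
  by apply: qsmoothM => //; exact: qsmooth_conj.
apply: qsmoothM; first by apply: qsmoothV => //; exact: qsmooth_symw.
apply: qsmoothD; first exact: qsmoothM.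
by apply: qsmoothM => //; exact: qsmoothM.
Qed.

End QuatSmooth.

                                          

Section Transport.
Variables (R : realType) (T T' : Type) (n : nat) (A : atlas R T n) (M : set T).
Variables (f : T -> T') (g : T' -> T).
Hypotheses (mA : is_manifold M A) (fK : forall x, M x -> g (f x) = x).

Definition transport_chart (c : chart R T n) : chart R T' n :=
  (f @` cdom c, cmap c \o g).

Definition transport_atlas : atlas R T' n := [set transport_chart c | c in A].

Let Mc c : A c -> cdom c `<=` M.
Proof. by case: mA => _ -> _ _ _ Ac x cx; exists c. Qed.

Lemma transport_setI (V W : set T) : V `<=` M -> W `<=` M ->
  f @` V `&` f @` W = f @` (V `&` W).
Proof.
move=> VM WM; apply/seteqP; split=> [_ [[x Vx <-] [y Wy yx]]|_ [x [Vx Wx] <-]].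
  exists x => //; split => //.
  by rewrite -(fK (VM _ Vx)) -yx (fK (WM _ Wy)).
by split; exists x.
Qed.

Lemma transport_image (c : chart R T n) (W : set T) : W `<=` M ->
  (cmap c \o g) @` (f @` W) = cmap c @` W.
Proof.
move=> WM; apply/seteqP; split=> [_ [_ [x Wx <-] <-]|_ [x Wx <-]].
  by exists x => //; rewrite /= fK //; exact: WM.
by exists (f x); [exists x|rewrite /= fK //; exact: WM].
Qed.

Lemma transport_mopen (W : set T) : mopen A W -> mopen transport_atlas (f @` W).
Proof.
move=> [Wc Wo]; have WM : W `<=` M by move=> x /Wc [c Ac cx]; exact: (Mc Ac).
split=> [_ [x Wx <-]|_ [c Ac <-]].
  have [c Ac cx] := Wc x Wx; exists (transport_chart c); first by exists c.
  by exists x.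
rewrite /cdom /cmap /= transport_setI //; last exact: Mc.
by rewrite transport_image; [exact: Wo|move=> x [/WM]].
Qed.

Lemma transport_mopen_inv (W : set T') : mopen transport_atlas W ->
  mopen A [set x | M x /\ W (f x)].
Proof.
move=> [Wc Wo]; split=> [x [Mx _]|c Ac].
  by move: Mx; case: mA => _ -> _ _ _.
have := Wo (transport_chart c) (ex_intro2 _ _ c Ac erefl).
rewrite (_ : W `&` _ = f @` ([set x | M x /\ W (f x)] `&` cdom c)).
  by rewrite transport_image // => x [[]].
apply/seteqP; split=> [y [Wx [x cx xy]]|_ [x [[Mx Wx] cx] <-]].
  by subst y; exists x => //; split => //; split => //; exact: (Mc Ac).
by split => //; exists x.
Qed.

Lemma transport_rep (c d : chart R T n) x : A c -> cdom c x -> smooth_rep c d id x ->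
  A d -> smooth_rep (transport_chart c) (transport_chart d) id (f x).
Proof.
move=> Ac cx [U [k [_ Ux [oU Uc Sk kP]]]] Ad.
have gfx : g (f x) = x by apply: fK; exact: (Mc Ac).
exists U, k; split; [by exists x|by rewrite /cmap /= gfx|split => //].
  by rewrite /cdom /cmap /= transport_image //; exact: (Mc Ac).
move=> _ [y cy <-]; rewrite /cmap /= fK; last exact: (Mc Ac).
by move=> Uy; have [dy E] := kP y cy Uy; split => //; exists y.
Qed.

                                                                                   
                                         
Lemma transport_manifold : is_manifold (f @` M) transport_atlas.
Proof.
have [cc cov tr haus [B [oB bB]]] := mA.
have tc c : A c -> is_chart (transport_chart c).
  move=> Ac; split; last first.
    rewrite -[X in open X]/((cmap c \o g) @` (f @` cdom c)).
    by rewrite (transport_image c (Mc Ac)); case: (cc c Ac).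
  move=> y z; rewrite !inE => -[x cx <-] [w cw <-]; rewrite /cmap /= !fK; try exact: (Mc Ac).
  by move=> /(is_chart_inj (cc c Ac) cx cw) ->.
split.
- by move=> _ [c Ac <-]; exact: tc.
- apply/seteqP; split=> [_ [x Mx <-]|_ [_ [c Ac <-] [x cx <-]]].
    move: Mx; rewrite cov => -[c Ac cx].
    by exists (transport_chart c); [exists c|exists x].
  by exists x => //; exact: (Mc Ac).
- move=> _ _ [c Ac <-] [d Ad <-]; apply: rep_transition; first exact: tc.
  move=> _ [x cx <-] [y dy yx].
  have xy : x = y by rewrite -(fK (Mc Ac cx)) -yx (fK (Mc Ad dy)).
  subst y; apply: transport_rep => //.
  exact: (smooth_transition_rep (cc c Ac) (tr c d Ac Ad)).
- move=> _ _ [x Mx <-] [y My <-] xy.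
  have [U [V [oU oV Ux Vy UV]]] := haus x y Mx My (fun e => xy (congr1 f e)).
  exists (f @` U), (f @` V); split; [exact: transport_mopen|exact: transport_mopen|by exists x|by exists y|].
  have sub W : mopen A W -> W `<=` M by move=> [Wc _] z /Wc [c Ac cz]; exact: (Mc Ac).
  by rewrite transport_setI ?UV ?image_set0 //; exact: sub.
exists (fun i => f @` B i); split=> [i|W z oW Wfx]; first exact: transport_mopen.
have [_ [c Ac <-] [x cx xy]] := oW.1 _ Wfx; subst z.
have [i [Bx BW]] := bB _ x (transport_mopen_inv oW) (conj (Mc Ac cx) Wfx).
by exists i; split; [exists x|move=> _ [z /BW [_ Wz] <-]].
Qed.

Lemma transport_diffeo : diffeomorphism M A (f @` M) transport_atlas f.
Proof.
have [cc cov tr _ _] := mA.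
split.
- split=> [x Mx|x y|//]; first by exists x.
  by rewrite !inE => Mx My E; rewrite -(fK Mx) E fK.
- move=> x; rewrite {1}cov => -[c Ac cx].
  exists c, (transport_chart c), (cmap c @` cdom c), id; split; [by []|by exists c|by []|by exists x|].
  have oc : open (cmap c @` cdom c) by case: (cc c Ac).
  split => //; first by apply: (@smooth_on_lin _ _ _ oc _ idfun).
  by move=> y cy _; split; [exists y|rewrite /cmap /= fK //; exact: (Mc Ac)].
exists g; split => // _ [x Mx <-]; move: (Mx); rewrite {1}cov => -[c Ac cx].
exists (transport_chart c), c, (cmap c @` cdom c), id.
split; [by exists c|by []|by exists x|by exists x => //; rewrite /cmap /= fK|].
have oc : open (cmap c @` cdom c) by case: (cc c Ac).
split => //; first by rewrite /cdom /cmap /= transport_image //; exact: (Mc Ac).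
  by apply: (@smooth_on_lin _ _ _ oc _ idfun).
by move=> _ [y cy <-] _; rewrite /cmap /= fK //; exact: (Mc Ac).
Qed.

End Transport.

                         

Section Euclidean.
Variable R : realType.

Lemma open_atlas_mopen m (W : set 'rV[R]_m) : mopen (open_atlas setT) W <-> open W.
Proof.
split=> [[_ /(_ _ erefl)]|oW]; first by rewrite /cdom /cmap /= setIT image_id.
split=> [x _|_ ->]; first by exists (open_chart setT).
by rewrite /cdom /cmap /= setIT image_id.
Qed.

                                                                                  
         
Lemma euclidean_manifold m : is_manifold [set: 'rV[R]_m] (open_atlas setT).
Proof.
have [c1 c2] := @open_atlas_compat R m setT openT.
split => //.
- by apply/seteqP; split=> // x _; exists (open_chart setT).
- move=> x y _ _ xy.
  have r0 : 0 < `|x - y| / 2 by rewrite divr_gt0 // normr_gt0 subr_eq0; apply/eqP.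
  exists [set z | `|z - x| < `|x - y| / 2], [set z | `|z - y| < `|x - y| / 2].
  split; rewrite ?open_atlas_mopen ?subrr ?normr0 //=; try exact: open_norm_ball.
    by rewrite subrr normr0.
    by rewrite subrr normr0.
  apply/seteqP; split=> // z [/= zx zy].
  have := ler_normD (x - z) (z - y); rewrite addrA subrK [`|x - z|]distrC; lra.
pose B (i : nat) : set 'rV[R]_m := match unpickle i with
  | Some cr => [set z | `|z - map_mx (@ratr R) (cr.1 : 'rV[rat]_m)| < ratr (cr.2 : rat)]
  | None => set0 end.
exists B; split=> [i|W x /open_atlas_mopen oW Wx].
  apply/open_atlas_mopen; rewrite /B; case: (unpickle i) => [cr|]; last exact: open0.
  exact: open_norm_ball.
have [e e0 eW] := near_norm_lt (open_nbhs_nbhs (conj oW Wx)).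
have [r] : exists r, ratr r \in `]e / 4, e / 2[ by apply: rat_in_itvoo; lra.
rewrite in_itv /= => /andP [r1 r2].
have /choice [c cP] : forall j : 'I_m, exists q, ratr q \in `]x 0 j - e / 4, x 0 j + e / 4[.
  by move=> j; apply: rat_in_itvoo; lra.
have xc : `|x - map_mx (@ratr R) (\row_j c j)| <= e / 4.
  apply: row_norm_le => [|j]; first by rewrite divr_ge0 // ltW.
  rewrite entryB mxE mxE; have := cP j; rewrite in_itv /= ler_norml => /andP [h1 h2].
  by apply/andP; split; lra.
exists (pickle (\row_j c j : 'rV[rat]_m, r)); rewrite /B pickleK /=; split.
  exact: le_lt_trans r1.
move=> z /= zr; apply: eW.
have := ler_normD (z - map_mx (@ratr R) (\row_j c j)) (map_mx (@ratr R) (\row_j c j) - x).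
rewrite distrC in xc; rewrite addrA subrK; lra.
Qed.

                                                                               
                                        
Lemma smooth_rep_through T T' p q n (d : chart R T p) (c : chart R T' n)
    (F : T -> T') (kappa : T -> 'rV[R]_q) (V : set 'rV[R]_q)
    (h : 'rV[R]_q -> 'rV[R]_n) x :
  smooth_rep d (open_chart setT) kappa x -> open V -> V (kappa x) -> smooth_on V h ->
  (forall y, cdom d y -> V (kappa y) -> cdom c (F y) /\ cmap c (F y) = h (kappa y)) ->
  smooth_rep d c F x.
Proof.
move=> [U [g [dx Ux [oU Ud Sg gP]]]] oV Vx Sh H.
have gE y : cdom d y -> U (cmap d y) -> kappa y = g (cmap d y).
  by move=> dy Uy; have [_] := gP y dy Uy.
have oW := open_preimage oU Sg oV.
exists [set u | U u /\ V (g u)], (h \o g); split => //.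
  by split => //; rewrite -gE.
split => // [u [/Ud //]| |y dy [Uy Vy]].
  apply: (smooth_on_comp oW oV _ _ Sh) => [u []//|].
  by apply: (smooth_on_sub oW oU _ Sg) => u [].
by have := H y dy; rewrite gE // => /(_ Vy).
Qed.

Lemma smooth_map_ext T T' m n (M : set T) (A : atlas R T m) (A' : atlas R T' n) f h :
  (forall c x, A c -> cdom c x -> f x = h x) ->
  smooth_map M A A' f -> smooth_map M A A' h.
Proof.
move=> fh Sf x Mx; have [c [d [U [g [Ac Ad cx Ux r]]]]] := Sf x Mx.
have r' : smooth_rep c d f x by exists U, g.
have [V [k [_ Vx rr]]] := smooth_rep_ext (fun y => @fh c y Ac) r'.
by exists c, d, V, k.
Qed.

End Euclidean.

                                                      

Section SphereCharts.
Variable R : realType.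
Local Notation H := (quat R).
Implicit Types (u q v w : H).

                                                                                
                                                                                    
                 
Definition sphere_map u q : H :=
  let w := qconj u * q in let a := (1 + qcoord w 0)^-1 in
  mkquat (qcoord w 1 * a) (qcoord w 2 * a) (qcoord w 3 * a) ((nsq w - 1) * a).

                                                                               
Definition sphere_inv u v : H :=
  let l := (qcoord v 3 + 2) / (1 + (qcoord v 0 ^+ 2 + qcoord v 1 ^+ 2 + qcoord v 2 ^+ 2)) in
  u * mkquat (l - 1) (l * qcoord v 0) (l * qcoord v 1) (l * qcoord v 2).

Definition sphere_dom u : set H := [set q | 0 < 1 + qcoord (qconj u * q) 0].

Lemma conj_mulK u q : nsq u = 1 -> qconj u * (u * q) = q.
Proof. by move=> u1; rewrite mulrA mul_conjq u1 scale1r mul1r. Qed.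

Lemma mul_conjK u q : nsq u = 1 -> u * (qconj u * q) = q.
Proof. by move=> u1; rewrite mulrA mul_qconj u1 scale1r mul1r. Qed.

Lemma sphere_mapK u q : nsq u = 1 -> sphere_dom u q -> sphere_inv u (sphere_map u q) = q.
Proof.
move=> u1; rewrite /sphere_dom /= -[RHS](mul_conjK q u1) /sphere_inv /sphere_map.
move: (qconj u * q) => w dq; congr (u * _); rewrite !qcoord_mk //=.
have d0 : 1 + qcoord w 0 != 0 by rewrite gt_eqF.
have a1 := sqr_ge0 (qcoord w 1); have a2 := sqr_ge0 (qcoord w 2).
have a3 := sqr_ge0 (qcoord w 3).
have e0 : (1 + qcoord w 0) ^+ 2 + (qcoord w 1 ^+ 2 + qcoord w 2 ^+ 2 + qcoord w 3 ^+ 2) != 0.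
  by rewrite gt_eqF //; have : 0 < (1 + qcoord w 0) ^+ 2 by [rewrite exprn_gt0]; lra.
have -> : ((nsq w - 1) * (1 + qcoord w 0)^-1 + 2) /
    (1 + ((qcoord w 1 * (1 + qcoord w 0)^-1) ^+ 2 +
          (qcoord w 2 * (1 + qcoord w 0)^-1) ^+ 2 +
          (qcoord w 3 * (1 + qcoord w 0)^-1) ^+ 2)) = 1 + qcoord w 0.
  by rewrite nsqE; field; rewrite d0.
by apply: quat_ext; rewrite qcoord_mk //=; field.
Qed.

Lemma sphere_invK u v : nsq u = 1 -> 0 < qcoord v 3 + 2 ->
  sphere_dom u (sphere_inv u v) /\ sphere_map u (sphere_inv u v) = v.
Proof.
move=> u1 v3; rewrite /sphere_dom /sphere_map /= /sphere_inv conj_mulK //.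
set n := 1 + (qcoord v 0 ^+ 2 + qcoord v 1 ^+ 2 + qcoord v 2 ^+ 2).
set l := (qcoord v 3 + 2) / n.
have n0 : 0 < n.
  rewrite /n; have := sqr_ge0 (qcoord v 0); have := sqr_ge0 (qcoord v 1).
  have := sqr_ge0 (qcoord v 2); lra.
have l0 : 0 < l by rewrite divr_gt0.
rewrite !qcoord_mk //= [1 + (l - 1)]addrC subrK; split => //.
have l1 : l != 0 by rewrite gt_eqF.
have E : l * n = qcoord v 3 + 2 by rewrite /l mulfVK // gt_eqF.
apply: quat_ext; rewrite qcoord_mk //=; try by field.
rewrite nsqE !qcoord_mk //=; apply: (mulIf l1); rewrite mulfVK //.
have -> : (l - 1) ^+ 2 + (l * qcoord v 0) ^+ 2 + (l * qcoord v 1) ^+ 2 +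
  (l * qcoord v 2) ^+ 2 - 1 = l * (l * n - 2) by rewrite /n; ring.
by rewrite E addrK mulrC.
Qed.

Lemma sphere_map_eq0 u q : nsq u = 1 -> sphere_dom u q ->
  nsq q = 1 <-> qcoord (sphere_map u q) 3 = 0.
Proof.
move=> u1 dq; rewrite /sphere_map qcoord_mk //= nsqM nsq_conj u1 mul1r.
have d0 : (1 + qcoord (qconj u * q) 0)^-1 != 0 by rewrite invr_neq0 // gt_eqF.
split=> [->|/eqP]; first by rewrite subrr mul0r.
by rewrite mulf_eq0 (negbTE d0) orbF subr_eq0 => /eqP.
Qed.

Lemma sphere_dom_self u : nsq u = 1 -> sphere_dom u u.
Proof. by move=> u1; rewrite /sphere_dom /= mul_conjq u1 scale1r qcoord_one0. Qed.

Lemma qsmooth_id (U : set 'rV[R]_4) : qsmooth U (fun q => q : H).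
Proof. by move=> i i4; exact: smooths_coord. Qed.

Lemma open_sphere_dom u : open (sphere_dom u : set 'rV[R]_4).
Proof.
have Sf : smooths (setT : set 'rV[R]_4) (fun q : H => 1 + qcoord (qconj u * q) 0).
  apply: smoothsD; [exact: openT|exact: smooths_cst|].
  apply: (@qsmoothM _ _ _ openT (fun=> qconj u) id) => //; first exact: qsmooth_cst.
  exact: qsmooth_id.
have := open_pos openT Sf; rewrite (_ : [set _ | _] = sphere_dom u) //.
by apply/seteqP; split=> q // [].
Qed.

Lemma qsmooth_sphere_map m (U : set 'rV[R]_m) u (f : 'rV[R]_m -> H) : open U ->
  (forall x, U x -> sphere_dom u (f x)) -> qsmooth U f ->
  qsmooth U (fun x => sphere_map u (f x)).
Proof.
move=> oU fd Sf.
have Sw : qsmooth U (fun x => qconj u * f x) by apply: qsmoothM => //; exact: qsmooth_cst.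
have Sa : smooths U (fun x => (1 + qcoord (qconj u * f x) 0)^-1).
  apply: smoothsV => //; first by move=> x /fd; rewrite /sphere_dom /= => h; rewrite gt_eqF.
  by apply: smoothsD => //; [exact: smooths_cst|exact: Sw].
apply: qsmooth_mk => //; apply: smoothsM => //; try exact: Sw.
by apply: smoothsB => //; [exact: smooths_nsq|exact: smooths_cst].
Qed.

Lemma qsmooth_sphere_inv m (U : set 'rV[R]_m) u (f : 'rV[R]_m -> H) : open U ->
  qsmooth U f -> qsmooth U (fun x => sphere_inv u (f x)).
Proof.
move=> oU Sf; have F i (i4 : (i < 4)%N) := Sf i i4.
have Sl : smooths U (fun x => (qcoord (f x) 3 + 2) /
    (1 + (qcoord (f x) 0 ^+ 2 + qcoord (f x) 1 ^+ 2 + qcoord (f x) 2 ^+ 2))).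
  apply: smoothsM => //.
    by apply: smoothsD => //; [exact: F|exact: smooths_cst].
  apply: smoothsV => //.
    move=> x _; rewrite gt_eqF //; have := sqr_ge0 (qcoord (f x) 0).
    have := sqr_ge0 (qcoord (f x) 1); have := sqr_ge0 (qcoord (f x) 2); lra.
  apply: smoothsD => //; first exact: smooths_cst.
  by do 2?[apply: smoothsD => //]; apply: smoothsM => //; exact: F.
apply: qsmoothM => //; first exact: qsmooth_cst.
by apply: qsmooth_mk => //; [apply: smoothsB => //; exact: smooths_cst| | |];
  apply: smoothsM => //; exact: F.
Qed.

Lemma smooth_sphere_map u :
  smooth_on (sphere_dom u : set 'rV[R]_4) (sphere_map u : 'rV[R]_4 -> 'rV[R]_4).
Proof.
apply (@qsmoothP R 4 _ (@open_sphere_dom u) (sphere_map u)).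
apply: (@qsmooth_sphere_map 4 _ u id) => //; first exact: open_sphere_dom.
exact: qsmooth_id.
Qed.

                                                                                    
               
Definition sphere_chart u : chart R H 4 := (sphere_dom u, sphere_map u).

Lemma sphere_chart_image u : nsq u = 1 ->
  cmap (sphere_chart u) @` cdom (sphere_chart u) = [set v : H | 0 < qcoord v 3 + 2].
Proof.
move=> u1; apply/seteqP; split=> [_ [q dq <-]|v v3] /=.
  move: dq; rewrite /cmap /cdom /= /sphere_dom /sphere_map /=.
  move: (qconj u * q) => w dq; rewrite qcoord_mk //=; have d0 : 1 + qcoord w 0 != 0 by rewrite gt_eqF.
  have -> : (nsq w - 1) * (1 + qcoord w 0)^-1 + 2 =
      ((1 + qcoord w 0) ^+ 2 + (qcoord w 1 ^+ 2 + qcoord w 2 ^+ 2 + qcoord w 3 ^+ 2)) / (1 + qcoord w 0).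
    by rewrite nsqE; field.
  rewrite divr_gt0 //; have : 0 < (1 + qcoord w 0) ^+ 2 by rewrite exprn_gt0.
  have := sqr_ge0 (qcoord w 1); have := sqr_ge0 (qcoord w 2).
  have := sqr_ge0 (qcoord w 3); lra.
by have [dq E] := sphere_invK u1 v3; exists (sphere_inv u v).
Qed.

Lemma open_sphere_image : open ([set v : H | 0 < qcoord v 3 + 2] : set 'rV[R]_4).
Proof.
have Sf : smooths (setT : set 'rV[R]_4) (fun q : H => qcoord q 3 + 2).
  by apply: smoothsD; [exact: openT|exact: smooths_coord|exact: smooths_cst].
have := open_pos openT Sf; rewrite (_ : [set _ | _] = [set v : H | 0 < qcoord v 3 + 2]) //.
by apply/seteqP; split=> q // [].
Qed.

Lemma quat_atlas_compat : compat (@quat_atlas R).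
Proof. exact: (@open_atlas_compat R 4 setT openT). Qed.

Lemma quat_manifold : is_manifold [set: H] (@quat_atlas R).
Proof. exact: (@euclidean_manifold R 4). Qed.

Lemma sphere_chart_from u q : nsq u = 1 -> sphere_dom u q ->
  smooth_rep (sphere_chart u) (open_chart (setT : set 'rV[R]_4)) id q.
Proof.
move=> u1 dq; exists [set v : H | 0 < qcoord v 3 + 2], (sphere_inv u).
split => //; first by rewrite -(sphere_chart_image u1); exists q.
split; [exact: open_sphere_image|by rewrite (sphere_chart_image u1)| |].
  apply/(qsmoothP open_sphere_image); apply: qsmooth_sphere_inv; first exact: open_sphere_image.
  exact: qsmooth_id.
by move=> x dx _; split => //; rewrite [RHS](sphere_mapK u1 dx).
Qed.

Lemma sphere_chart_slice u : nsq u = 1 -> slice_chart (@quat_atlas R) (Sp1 R) 3 (sphere_chart u).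
Proof.
move=> u1; have cc : is_chart (sphere_chart u).
  split; last by rewrite (sphere_chart_image u1); exact: open_sphere_image.
  move=> x y; rewrite !inE => dx dy E.
  by rewrite -(sphere_mapK u1 dx) -(sphere_mapK u1 dy); congr sphere_inv.
split.
  apply: (max_atlasP quat_atlas_compat) => //.
    by move=> q _; exists (setT, id).
  move=> _ q -> dq _; split; first exact: sphere_chart_from.
  exists (sphere_dom u : set 'rV[R]_4), (sphere_map u); split => //.
  split => //; [exact: open_sphere_dom|by rewrite image_id|exact: smooth_sphere_map].
move=> q dq; rewrite Sp1P (sphere_map_eq0 u1 dq) /qcoord; split=> [E j j3|]; last first.
  by apply; rewrite inordK.
have -> : j = inord 3 
  by apply: val_inj; rewrite /= inordK //; apply/eqP; rewrite eqn_leq j3 andbT -ltnS.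
by [].
Qed.

End SphereCharts.

                                                 

Section SphereModel.
Variable R : realType.
Local Notation H := (quat R).

                                                                                   
                                                                                  
                                                                                    
                                     
Record sphere_model T n (A : atlas R T n) (S : set T) (k : nat) (E : T -> H)
    (C : H -> chart R T n) : Prop := SphereModel {
  sm_compat : compat A;
  sm_dim : (k <= n)%N;
  sm_unit : forall x, S x -> nsq (E x) = 1;
  sm_slice : forall u, nsq u = 1 -> slice_chart A S k (C u);
  sm_from : forall u x, nsq u = 1 -> cdom (C u) x ->
    smooth_rep (C u) (open_chart (setT : set 'rV[R]_4)) E x;
  sm_to : forall u, nsq u = 1 -> exists (V : set 'rV[R]_4) h,
    [/\ open V, V u, smooth_on V h &
        forall y, S y -> V (E y) -> cdom (C u) y /\ cmap (C u) y = h (E y)]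
}.

Lemma Sp1_model : sphere_model (@quat_atlas R) (Sp1 R) 3 id (@sphere_chart R).
Proof.
split => //; first exact: quat_atlas_compat.
- by move=> x /Sp1P.
- exact: sphere_chart_slice.
- exact: sphere_chart_from.
move=> u u1; exists (sphere_dom u), (sphere_map u); split => //.
- exact: open_sphere_dom.
- exact: sphere_dom_self.
exact: smooth_sphere_map.
Qed.

Section Model.
Variables (T : Type) (n : nat) (A : atlas R T n) (S : set T) (k : nat) (E : T -> H).
Variable C : H -> chart R T n.
Hypothesis SM : sphere_model A S k E C.

Let kn := sm_dim SM.
Let cA := sm_compat SM.

Lemma sphere_model_cover x : S x -> exists2 c, slice_chart A S k c & cdom c x.
Proof.
move=> Sx; have Ex := sm_unit SM Sx; exists (C (E x)); first exact: (sm_slice SM).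
by have [V [h [_ Vu _ H]]] := sm_to SM Ex; case: (H x Sx Vu).
Qed.

Lemma sphere_model_submanifold : submanifold A S k.
Proof. by split => //; exact: sphere_model_cover. Qed.

Lemma sphere_model_dom x : S x -> cdom (C (E x)) x.
Proof.
move=> Sx; have Ex := sm_unit SM Sx.
by have [V [h [_ Vu _ H]]] := sm_to SM Ex; case: (H x Sx Vu).
Qed.

                                                                                    
                                  
Lemma sphere_model_to T' p (c : chart R T' p) (F : T' -> T) x :
  (forall y, cdom c y -> S (F y)) -> cdom c x ->
  smooth_rep c (open_chart (setT : set 'rV[R]_4)) (E \o F) x ->
  smooth_rep c (slice_restr S k (C (E (F x)))) F x.
Proof.
move=> FS cx r; have Ex := sm_unit SM (FS x cx).
have [V [h [oV Vu Sh H]]] := sm_to SM Ex.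
apply: slice_restr_rep => //; first exact: (sm_slice SM).
apply: (smooth_rep_through r oV Vu Sh) => y cy Vy.
exact: H (FS y cy) Vy.
Qed.

Lemma sphere_model_from x : S x ->
  smooth_rep (slice_restr S k (C (E x))) (open_chart (setT : set 'rV[R]_4)) E x.
Proof.
move=> Sx; have Ex := sm_unit SM Sx; have dx := sphere_model_dom Sx.
have r1 := slice_incl_rep kn (sm_slice SM Ex) Sx dx.
exact: smooth_rep_comp r1 (sm_from SM Ex dx).
Qed.

Lemma sphere_model_atlas u : nsq u = 1 -> sub_atlas A S k (slice_restr S k (C u)).
Proof. by move=> u1; apply/sub_atlasP; exists (C u) => //; exact: (sm_slice SM). Qed.

                                                                                      
     
Lemma sphere_model_op (m : H -> H -> H) (op : T -> T -> T) :
  smooth_on setT (fun z : 'rV[R]_(4 + 4) => m (lsubmx z) (rsubmx z) : 'rV[R]_4) ->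
  (forall x y, S x -> S y -> S (op x y) /\ E (op x y) = m (E x) (E y)) ->
  smooth_map (S `*` S) (prod_atlas (sub_atlas A S k) (sub_atlas A S k))
    (sub_atlas A S k) (fun z => op z.1 z.2).
Proof.
move=> Sm opE [x y] [/= Sx Sy].
pose cx := slice_restr S k (C (E x)); pose cy := slice_restr S k (C (E y)).
pose cz := slice_restr S k (C (E (op x y))).
have [Sxy Exy] := opE x y Sx Sy.
have Ax : sub_atlas A S k cx by apply: sphere_model_atlas; exact: (sm_unit SM).
have Ay : sub_atlas A S k cy by apply: sphere_model_atlas; exact: (sm_unit SM).
have Az : sub_atlas A S k cz by apply: sphere_model_atlas; exact: (sm_unit SM).
have dx : cdom cx x by split => //; exact: sphere_model_dom.
have dy : cdom cy y by split => //; exact: sphere_model_dom.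
have [cc _] := sub_atlas_compat S cA kn.
have [p1 p2] := prod_chart_proj (z := (x, y)) (cc _ Ax) (cc _ Ay) dx dy.
have r1 := smooth_rep_comp p1 (sphere_model_from Sx).
have r2 := smooth_rep_comp p2 (sphere_model_from Sy).
have r3 := smooth_rep_row r1 r2.
have r4 : smooth_rep (prod_chart cx cy) (open_chart (setT : set 'rV[R]_4))
    (fun z => E (op z.1 z.2)) (x, y).
  apply: (smooth_rep_through r3 openT _ Sm) => // z [[Sz1 _] [Sz2 _]] _; split => //.
  by rewrite row_mxKl row_mxKr /cmap /=; have [_ ->] := opE _ _ Sz1 Sz2.
have r5 : smooth_rep (prod_chart cx cy) cz (fun z => op z.1 z.2) (x, y).
  apply: (sphere_model_to (F := fun z : T * T => op z.1 z.2)) => //.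
  by move=> z [[Sz1 _] [Sz2 _]]; have [] := opE _ _ Sz1 Sz2.
have [U [g [_ Uz r]]] := r5.
by exists (prod_chart cx cy), cz, U, g; split => //; exact: prod_atlas_chart.
Qed.

End Model.

                                                                                      
                                                                  
Lemma sphere_model_map T T' n n' (A : atlas R T n) (A' : atlas R T' n') S S' k k' E E' C C'
    (f : T -> T') :
  sphere_model A S k E C -> sphere_model A' S' k' E' C' ->
  (forall x, S x -> S' (f x) /\ E' (f x) = qconj (E x)) ->
  smooth_map S (sub_atlas A S k) (sub_atlas A' S' k') f.
Proof.
move=> SM SM' fE x Sx; have [Sfx Efx] := fE x Sx.
pose c := slice_restr S k (C (E x)); pose d := slice_restr S' k' (C' (E' (f x))).
have cx : cdom c x by split => //; exact: (sphere_model_dom SM).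
have r1 := sphere_model_from SM Sx.
have Sc : smooth_on (setT : set 'rV[R]_4) (fun q : 'rV[R]_4 => qconj q : 'rV[R]_4).
  by apply/(qsmoothP openT); apply: qsmooth_conj; [exact: openT|exact: qsmooth_id].
have r2 : smooth_rep c (open_chart (setT : set 'rV[R]_4)) (E' \o f) x.
  apply: (smooth_rep_through r1 openT _ Sc) => // y [Sy _] _; split => //.
  by have [_ /= ->] := fE y Sy.
have r3 : smooth_rep c d f x.
  by apply: (sphere_model_to SM') => // y [Sy _]; have [] := fE y Sy.
have [U [g [_ Ux r]]] := r3; exists c, d, U, g; split => //.
  by apply: (sphere_model_atlas SM); exact: sm_unit SM _ Sx.
by apply: (sphere_model_atlas SM'); exact: sm_unit SM' _ Sfx.
Qed.

                                                                               
                                                                                      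
                                                             
Lemma sphere_lie_group T n (M : set T) (A : atlas R T n) S k E C
    (m : H -> H -> H) (op : T -> T -> T) (e : T) (inv : T -> T) :
  sphere_model A S k E C -> is_manifold M A -> S `<=` M ->
  smooth_on setT (fun z : 'rV[R]_(4 + 4) => m (lsubmx z) (rsubmx z) : 'rV[R]_4) ->
  (forall x y, S x -> S y -> E x = E y -> x = y) ->
  associative m -> left_id 1 m -> right_id 1 m ->
  (forall p, nsq p = 1 -> m (qconj p) p = 1 /\ m p (qconj p) = 1) ->
  S e -> E e = 1 ->
  (forall x y, S x -> S y -> S (op x y) /\ E (op x y) = m (E x) (E y)) ->
  (forall x, S x -> S (inv x) /\ E (inv x) = qconj (E x)) ->
  lie_group S (sub_atlas A S k) op.
Proof.
move=> SM mA SM' Sm inj mA' m1 m1' mV Se Ee opE invE; split.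
  exact: (sub_atlas_manifold (sm_compat SM) (sm_dim SM) (sphere_model_cover SM) mA).
have opS x y : S x -> S y -> S (op x y) by move=> Sx Sy; have [] := opE x y Sx Sy.
have opEE x y : S x -> S y -> E (op x y) = m (E x) (E y) by move=> Sx Sy; have [] := opE x y Sx Sy.
have invS x : S x -> S (inv x) by move=> /invE [].
have invEE x : S x -> E (inv x) = qconj (E x) by move=> /invE [].
exists e, inv; split; last first.
  by split; [exact: (sphere_model_op SM Sm opE)|exact: (sphere_model_map SM SM invE)].
split => //.
- move=> x y z Sx Sy Sz; have Sxy := opS _ _ Sx Sy; have Syz := opS _ _ Sy Sz.
  by apply: inj; [exact: opS|exact: opS|rewrite !opEE // mA'].
- by move=> x Sx; split; apply: inj => //; try exact: opS; rewrite opEE // Ee ?m1 ?m1'.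
move=> x Sx; have [mV1 mV2] := mV _ (sm_unit SM Sx); have Six := invS x Sx.
by split => //; apply: inj => //; try (by apply: opS); rewrite opEE // invEE // Ee.
Qed.

End SphereModel.

                                           

Section MobiusSpace.
Variable R : realType.
Local Notation H := (quat R).
Local Notation ball := (qball R).
Implicit Types (P U : H) (X : 'M[H]_2) (f : ball -> ball).

Lemma ball_lt1 (q : ball) : nsq (val q) < 1.
Proof. by rewrite -qnorm_lt1; exact: (valP q). Qed.

Lemma mk_ball (q : H) : nsq q < 1 -> exists b : ball, val b = q.
Proof. by rewrite -qnorm_lt1 => q1; exists (exist _ q q1). Qed.

Lemma ball0_subproof : qnorm (0 : H) < 1.
Proof. by rewrite qnorm_lt1 nsq0. Qed.
Definition ball0 : ball := exist _ 0 ball0_subproof.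

                                                                                
                                       
Definition mob_ball P U (q : ball) : ball := insubd q (mob P U (val q)).

Lemma mob_ballE P U q : nsq P < 1 -> nsq U = 1 -> val (mob_ball P U q) = mob P U (val q).
Proof.
move=> P1 U1; rewrite /mob_ball insubdK // unfold_in qnorm_lt1.
by apply: mob_lt1 => //; exact: ball_lt1.
Qed.

Lemma mob_ball_inj P U P' U' : nsq P < 1 -> nsq U = 1 -> nsq P' < 1 -> nsq U' = 1 ->
  mob_ball P U = mob_ball P' U' -> P = P' /\ U = U'.
Proof.
move=> P1 U1 P1' U1' E; apply: mob_inj => // q /mk_ball [b <-].
by rewrite -!mob_ballE // E.
Qed.

Lemma ball_fun_ext f g : (forall q, val (f q) = val (g q)) -> f = g.
Proof. by move=> E; apply/funext => q; exact: val_inj. Qed.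

Lemma is_moebius_inv X f : Sp11 R X ->
  is_moebius (Sp11_inv X) f <-> f = mob_ball (inv_centre X) (inv_rotor X).
Proof.
move=> SX; have [P1 U1] := inv_params SX; have [i00 i01 i10 i11] := Sp11_invE X.
have E (q : ball) : moebius (Sp11_inv X) (val q) = mob (inv_centre X) (inv_rotor X) (val q).
  rewrite moebiusE; [|exact: Sp11_inv_Sp11|exact: ball_lt1].
  by rewrite i00 i10 i11 mulrN /inv_centre mulNr.
split=> [fE|-> q]; last by rewrite mob_ballE.
by apply: ball_fun_ext => q; rewrite fE mob_ballE.
Qed.

                                                                                      
                                     
Lemma moebius_setP f : moebius_set R f <->
  exists P U, [/\ nsq P < 1, nsq U = 1 & f = mob_ball P U].
Proof.
split=> [[A SA fA]|[P [U [P1 U1 ->]]]].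
  have SV := Sp11_inv_Sp11 SA; have [P1 U1] := inv_params SV.
  exists (inv_centre (Sp11_inv A)), (inv_rotor (Sp11_inv A)); split => //.
  by apply/is_moebius_inv; rewrite ?Sp11_invK.
have [SX eX uX] := Sp11_of_Sp11 P1 U1.
exists (Sp11_inv (Sp11_of P U)); first exact: Sp11_inv_Sp11.
by apply/is_moebius_inv => //; rewrite eX uX.
Qed.

Definition centre f : H := val (f ball0).

                                                                               
                         
Definition rotor f : H := xget 0 [set U | nsq U = 1 /\ f = mob_ball (centre f) U].

Lemma centreE P U : nsq P < 1 -> nsq U = 1 -> centre (mob_ball P U) = P.
Proof. by move=> P1 U1; rewrite /centre mob_ballE //= mob_0. Qed.

Lemma rotorE P U : nsq P < 1 -> nsq U = 1 -> rotor (mob_ball P U) = U.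
Proof.
move=> P1 U1; rewrite /rotor centreE //; case: xgetP => [V _ [V1 E]|/(_ U) []//].
by have [_ ->] := mob_ball_inj P1 U1 P1 V1 E.
Qed.

Lemma moebius_paramP f : moebius_set R f ->
  [/\ nsq (centre f) < 1, nsq (rotor f) = 1 & f = mob_ball (centre f) (rotor f)].
Proof. by move=> /moebius_setP [P [U [P1 U1 ->]]]; rewrite centreE // rotorE. Qed.

Lemma moebius_set_mob P U : nsq P < 1 -> nsq U = 1 -> moebius_set R (mob_ball P U).
Proof. by move=> P1 U1; apply/moebius_setP; exists P, U. Qed.

                                                                                      
                                                    
Definition coset_mobius (Q : set 'M[H]_2) : ball -> ball :=
  let X := xget 0 Q in mob_ball (inv_centre X) (inv_rotor X).

Lemma coset_mobiusE X : coset_mobius (coset X) = mob_ball (inv_centre X) (inv_rotor X).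
Proof.
rewrite /coset_mobius; case: xgetP => [Y _ XY|/(_ X) []]; last exact: coset_refl.
by have [-> ->] := coset_inv_params XY.
Qed.

Lemma coset_mobius_bij : set_bij (coset_space R) (moebius_set R) coset_mobius.
Proof.
split.
- move=> _ [X SX <-]; rewrite coset_mobiusE; have [P1 U1] := inv_params SX.
  exact: moebius_set_mob.
- move=> Q Q'; rewrite !inE => -[X SX <-] [Y SY <-]; rewrite !coset_mobiusE => E.
  have [P1 U1] := inv_params SX; have [P1' U1'] := inv_params SY.
  by have [inv_centre inv_rotor] := mob_ball_inj P1 U1 P1' U1' E; exact: coset_ext.
move=> f /moebius_paramP [P1 U1 ->]; have [SX eX uX] := Sp11_of_Sp11 P1 U1.
exists (coset (Sp11_of (centre f) (rotor f))); first by exists (Sp11_of (centre f) (rotor f)).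
by rewrite coset_mobiusE eX uX.
Qed.

Definition mobius_coset f : set 'M[H]_2 := coset (Sp11_of (centre f) (rotor f)).

Lemma coset_mobiusK Q : coset_space R Q -> mobius_coset (coset_mobius Q) = Q.
Proof.
move=> [X SX <-]; have [P1 U1] := inv_params SX.
rewrite coset_mobiusE /mobius_coset centreE // rotorE //.
by have [SY eY uY] := Sp11_of_Sp11 P1 U1; exact: coset_ext.
Qed.

Lemma coset_space_image : coset_mobius @` coset_space R = moebius_set R.
Proof.
have [im inj surj] := coset_mobius_bij.
by apply/seteqP; split=> [_ [Q SQ <-]|f /surj //]; exact: im.
Qed.

Lemma mobius_transitive (p q : ball) : exists2 f, moebius_set R f & f p = q.
Proof.
have [P [U [P1 U1 E]]] := mob_transitive (ball_lt1 p) (ball_lt1 q).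
by exists (mob_ball P U); [exact: moebius_set_mob|apply: val_inj; rewrite mob_ballE].
Qed.

Lemma isotropy0_centre f : isotropy0 R f <-> moebius_set R f /\ centre f = 0.
Proof.
split=> [[Mf f0]|[Mf f0]]; first by split => //; exact: f0.
split => // q q0; rewrite -[RHS]f0 /centre; congr (val (f _)); exact: val_inj.
Qed.

Lemma isotropy0P f : isotropy0 R f <-> exists2 U, nsq U = 1 & f = mob_ball 0 U.
Proof.
split=> [/isotropy0_centre [/moebius_paramP [P1 U1 E] c0]|[U U1 ->]].
  by rewrite c0 in E; exists (rotor f); [exact: U1|exact: E].
have z1 : nsq (0 : H) < 1 by rewrite nsq0.
by apply/isotropy0_centre; split; [exact: moebius_set_mob|rewrite centreE].
Qed.

Lemma is_right_mulP U f : nsq U = 1 -> is_right_mul U f <-> f = mob_ball 0 U.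
Proof.
move=> U1; split=> [fU|-> q]; last by rewrite mob_ballE ?nsq0 // mob_rot.
by apply: ball_fun_ext => q; rewrite fU mob_ballE ?nsq0 // mob_rot.
Qed.

Lemma isotropy0E : isotropy0 R = [set f | exists2 u : H, Sp1 R u & is_right_mul u f].
Proof.
apply/seteqP; split=> f.
  by move=> /isotropy0P [U U1 fU]; exists U; [exact/Sp1P|exact/is_right_mulP].
by move=> [u /Sp1P u1 fu]; apply/isotropy0P; exists u => //; exact/is_right_mulP.
Qed.

End MobiusSpace.

                                                  

Section MatrixChart.
Variable R : realType.
Local Notation H := (quat R).
Local Notation full n := (open_atlas (setT : set 'rV[R]_n)).

Lemma qsmooth_lin m (U : set 'rV[R]_m) (f : {linear 'rV[R]_m -> 'rV[R]_4}) : open U ->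
  qsmooth U (f : 'rV[R]_m -> H).
Proof. by move=> oU; apply/(qsmoothP oU); exact: smooth_on_lin. Qed.

                                                                          
               
Definition mx_entry (i j : 'I_2) (v : 'rV[R]_(2 * 2 * 4)) : H :=
  \row_k v 0 (mxvec_index (mxvec_index i j) k).

Lemma mx_entryK i j (X : 'M[H]_2) : mx_entry i j (mx_coords X) = X i j.
Proof.
by apply/rowP => k; rewrite mxE /mx_coords mxvecE mxE mxvecE /qcoord inord_val.
Qed.

Lemma mx_coordsK v : mx_coords (\matrix_(i, j) mx_entry i j v) = v.
Proof.
apply/rowP => l; case/mxvec_indexP: l => a k; case/mxvec_indexP: a => i j.
by rewrite /mx_coords mxvecE mxE mxvecE mxE /qcoord /mx_entry mxE inord_val.
Qed.

Lemma qsmooth_mx_entry U i j : qsmooth U (mx_entry i j).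
Proof.
move=> k k4 l; have := @smooths_coord R _ U (mxvec_index (mxvec_index i j) (inord k)) l.
by congr (Cks _ _ _); apply/funext => v; rewrite /qcoord /mx_entry mxE.
Qed.

Definition mx_chart : chart R 'M[H]_2 (2 * 2 * 4) := (setT, @mx_coords R).

Lemma mx_coords_image : cmap mx_chart @` cdom mx_chart = setT.
Proof.
apply/seteqP; split=> // v _; exists (\matrix_(i, j) mx_entry i j v) => //.
exact: mx_coordsK.
Qed.

Lemma mx_chart_ok : is_chart mx_chart.
Proof.
split; last by rewrite mx_coords_image; exact: openT.
by move=> X Y _ _ E; apply: mx2_ext; rewrite -!mx_entryK; congr mx_entry.
Qed.

Lemma mx_atlas_compat : compat (@mx_atlas R).
Proof.
split=> [_ ->|_ _ -> ->]; first exact: mx_chart_ok.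
apply: rep_transition => [|X _ _]; first exact: mx_chart_ok.
exists setT, id; split => //; split => //; first exact: openT.
  by rewrite mx_coords_image.
exact: (@smooth_on_lin _ _ _ openT _ idfun).
Qed.

Lemma open_mx_entry_neq0 : open [set v | mx_entry 1 1 v != 0].
Proof.
have := open_pos openT (smooths_nsq openT (qsmooth_mx_entry setT 1 1)).
rewrite (_ : [set _ | _] = [set v | mx_entry 1 1 v != 0]) //.
by apply/seteqP; split=> v /=; rewrite nsq_gt0 // => -[].
Qed.

Lemma mx_chart_map (F : 'M[H]_2 -> H) (G : 'rV[R]_(2 * 2 * 4) -> H) :
  qsmooth [set v | mx_entry 1 1 v != 0] G -> (forall X, F X = G (mx_coords X)) ->
  smooth_map [set X : 'M[H]_2 | X 1 1 != 0] (@mx_atlas R) (full 4) (F : _ -> 'rV[R]_4).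
Proof.
move=> SG FG X X0; exists mx_chart, (open_chart setT), [set v | mx_entry 1 1 v != 0], G.
split => //; first by rewrite /= /cmap /= mx_entryK.
split; first exact: open_mx_entry_neq0.
- by rewrite mx_coords_image.
- by apply/qsmoothP => //; exact: open_mx_entry_neq0.
by move=> Y _ _; split => //; exact: FG.
Qed.

Lemma inv_centre_smooth : smooth_map [set X : 'M[H]_2 | X 1 1 != 0] (@mx_atlas R) (full 4) (@inv_centre R : _ -> 'rV[R]_4).
Proof.
have oV := open_mx_entry_neq0.
apply: (mx_chart_map (G := fun v =>
  - (qconj (mx_entry 1 1 v))^-1 * qconj (mx_entry 0 1 v))); last first.
  by move=> X; rewrite !mx_entryK.
have S i j := qsmooth_conj oV (qsmooth_mx_entry _ i j).
apply: qsmoothM => //; apply: qsmoothN => //; apply: qsmoothV => // v /=.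
by rewrite -!nsq_gt0 nsq_conj.
Qed.

Lemma inv_rotor_smooth : smooth_map [set X : 'M[H]_2 | X 1 1 != 0] (@mx_atlas R) (full 4) (@inv_rotor R : _ -> 'rV[R]_4).
Proof.
have oV := open_mx_entry_neq0.
apply: (mx_chart_map (G := fun v =>
  (qconj (mx_entry 1 1 v))^-1 * qconj (mx_entry 0 0 v))); last first.
  by move=> X; rewrite !mx_entryK.
have S i j := qsmooth_conj oV (qsmooth_mx_entry _ i j).
apply: qsmoothM => //; apply: qsmoothV => // v /=.
by rewrite -!nsq_gt0 nsq_conj.
Qed.

Lemma mx_atlas_map m (U : set 'rV[R]_m) (F : 'rV[R]_m -> 'M[H]_2) : open U ->
  (forall i j, qsmooth U (fun x => F x i j)) -> smooth_map U (open_atlas U) (@mx_atlas R) F.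
Proof.
move=> oU SF x Ux; exists (open_chart U), mx_chart, U, (@mx_coords R \o F); split => //.
split => //; first by rewrite image_id.
apply/(smooth_onE oU) => l; case/mxvec_indexP: l => a k; case/mxvec_indexP: a => i j.
apply: smooths_ext (SF i j k (ltn_ord k)) => // y _.
by rewrite /= /mx_coords mxvecE mxE mxvecE.
Qed.

                                                                      
Lemma qsmooth_Sp11_of m (U : set 'rV[R]_m) (P V : 'rV[R]_m -> H) : open U ->
  (forall x, U x -> nsq (P x) < 1) -> qsmooth U P -> qsmooth U V ->
  forall i j, qsmooth U (fun x => Sp11_of (P x) (V x) i j).
Proof.
move=> oU P1 SP SV.
have Sl : smooths U (fun x => (Num.sqrt (1 - nsq (P x)))^-1).
  apply: smoothsV => //; first by move=> x /P1 h; rewrite gt_eqF // sqrtr_gt0 subr_gt0.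
  apply: smooths_sqrt => //; first by move=> x /P1 h; rewrite subr_gt0.
  by apply: smoothsB => //; [exact: smooths_cst|exact: smooths_nsq].
have SP' := qsmooth_conj oU SP; have SV' := qsmooth_conj oU SV.
move=> i j; have [-> | ->] := ord2P i; have [-> | ->] := ord2P j.
- rewrite (_ : (fun x => _) = fun x => (Num.sqrt (1 - nsq (P x)))^-1 *: qconj (V x));
    last by apply/funext => x; rewrite /Sp11_of mxE.
  exact: qsmoothZ.
- rewrite (_ : (fun x => _) = fun x => - ((Num.sqrt (1 - nsq (P x)))^-1 *: qconj (P x)));
    last by apply/funext => x; rewrite /Sp11_of mxE.
  by apply: qsmoothN => //; exact: qsmoothZ.
- rewrite (_ : (fun x => _) = fun x =>
    - ((Num.sqrt (1 - nsq (P x)))^-1 *: (P x * qconj (V x))));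
    last by apply/funext => x; rewrite /Sp11_of mxE.
  by apply: qsmoothN => //; apply: qsmoothZ => //; exact: qsmoothM.
rewrite (_ : (fun x => _) = fun x => (Num.sqrt (1 - nsq (P x)))^-1 *: (1 : H));
    last by apply/funext => x; rewrite /Sp11_of mxE.
by apply: qsmoothZ => //; exact: qsmooth_cst.
Qed.

                                                                                     
                                                                                   
                                
Definition param_dom : set 'rV[R]_(4 + 4) :=
  [set z | nsq (lsubmx z : H) < 1 /\ (rsubmx z : H) != 0].

Definition normalize (q : H) : H := (Num.sqrt (nsq q))^-1 *: q.

Lemma nsq_normalize q : q != 0 -> nsq (normalize q) = 1.
Proof.
rewrite -nsq_gt0 => q0; rewrite /normalize nsqZ exprVn sqr_sqrtr ?ltW // mulVf //.
by rewrite gt_eqF.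
Qed.

Lemma normalize_id q : nsq q = 1 -> normalize q = q.
Proof. by move=> q1; rewrite /normalize q1 sqrtr1 invr1 scale1r. Qed.

Lemma qsmooth_normalize m (U : set 'rV[R]_m) (f : 'rV[R]_m -> H) : open U ->
  (forall x, U x -> f x != 0) -> qsmooth U f -> qsmooth U (fun x => normalize (f x)).
Proof.
move=> oU f0 Sf; apply: qsmoothZ => //; apply: smoothsV => //.
  by move=> x /f0 h; rewrite gt_eqF // sqrtr_gt0 nsq_gt0.
by apply: smooths_sqrt => //; [move=> x /f0; rewrite nsq_gt0|exact: smooths_nsq].
Qed.

Lemma open_param_dom : open param_dom.
Proof.
have Sl := @qsmooth_lin _ setT lsubmx (@openT 'rV[R]_(4 + 4)).
have Sr := @qsmooth_lin _ setT rsubmx (@openT 'rV[R]_(4 + 4)).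
have S1 : smooths setT (fun z : 'rV[R]_(4 + 4) => 1 - nsq (lsubmx z : H)).
  exact: (smoothsB openT (smooths_cst _ 1) (smooths_nsq openT Sl)).
have o1 := open_pos openT S1; have o2 := open_pos openT (smooths_nsq openT Sr).
have := openI o1 o2; rewrite (_ : _ `&` _ = param_dom) //.
apply/seteqP; split=> z /=; rewrite subr_gt0 nsq_gt0; first by case=> -[_ h] [].
by case.
Qed.

End MatrixChart.

                                                          

Section MobiusParametrisation.
Variable R : realType.
Local Notation H := (quat R).
Local Notation full n := (open_atlas (setT : set 'rV[R]_n)).

Definition param_mobius (z : 'rV[R]_(4 + 4)) : qball R -> qball R :=
  mob_ball (lsubmx z : H) (normalize (rsubmx z : H)).

                                                                                      
                                                                                  
              
Record mobius_structure m (AM : atlas R (qball R -> qball R) m) : Prop := MobiusStructure {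
  ms_manifold : is_manifold (moebius_set R) AM;
  ms_centre : smooth_map (moebius_set R) AM (full 4) (@centre R : _ -> 'rV[R]_4);
  ms_rotor : smooth_map (moebius_set R) AM (full 4) (@rotor R : _ -> 'rV[R]_4);
  ms_param : smooth_map (@param_dom R) (open_atlas (@param_dom R)) AM param_mobius
}.

Section FromQuotient.
Variables (n : nat) (AQ : atlas R (set 'M[H]_2) n).
Hypothesis mAQ : is_manifold (coset_space R) AQ.
Hypothesis sAQ : submersion (Sp11 R) (Sp11_atlas R) AQ (@coset R).

Let Sp11_cover X : Sp11 R X -> exists2 c, slice_chart (@mx_atlas R) (Sp11 R) 10 c & cdom c X.
Proof.
move=> SX; have [c [d [U [g [/sub_atlasP [c' Sc ->] _ [_ cx] _ _]]]]] := sAQ SX.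
by exists c'.
Qed.

Let cSp11 : compat (Sp11_atlas R).
Proof. exact: sub_atlas_compat (@mx_atlas_compat R) _. Qed.

Let cAQ : compat AQ := manifold_compat mAQ.
Let cfull p : compat (full p) := open_atlas_compat openT.

Let sub_eq c X : Sp11_atlas R c -> cdom c X -> Sp11 R X.
Proof. by move=> /sub_atlasP [c' _ ->] []. Qed.

                                                                              
                                   
Lemma quotient_centre : smooth_map (coset_space R) AQ (full 4)
  ((fun Q => centre (coset_mobius Q)) : _ -> 'rV[R]_4).
Proof.
apply: (submersion_descend (f := @coset R) cSp11 cAQ (cfull 4) _ sAQ).
  by move=> _ [X SX <-]; exists X.
apply: (smooth_map_ext (f := (@inv_centre R : _ -> 'rV[R]_4) \o id)).
  move=> c X Ac cX; have [P1 U1] := inv_params (sub_eq Ac cX).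
  by rewrite /= coset_mobiusE centreE.
apply: (smooth_map_comp (@mx_atlas_compat R) _ _ (@inv_centre_smooth R)).
  by move=> X SX; have [] := Sp11_rel SX.
exact: (smooth_incl (@mx_atlas_compat R) _ Sp11_cover).
Qed.

Lemma quotient_rotor : smooth_map (coset_space R) AQ (full 4)
  ((fun Q => rotor (coset_mobius Q)) : _ -> 'rV[R]_4).
Proof.
apply: (submersion_descend (f := @coset R) cSp11 cAQ (cfull 4) _ sAQ).
  by move=> _ [X SX <-]; exists X.
apply: (smooth_map_ext (f := (@inv_rotor R : _ -> 'rV[R]_4) \o id)).
  move=> c X Ac cX; have [P1 U1] := inv_params (sub_eq Ac cX).
  by rewrite /= coset_mobiusE rotorE.
apply: (smooth_map_comp (@mx_atlas_compat R) _ _ (@inv_rotor_smooth R)).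
  by move=> X SX; have [] := Sp11_rel SX.
exact: (smooth_incl (@mx_atlas_compat R) _ Sp11_cover).
Qed.

Lemma coset_smooth : smooth_map (Sp11 R) (Sp11_atlas R) AQ (@coset R).
Proof. by move=> X /sAQ [c [d [U [g [Ac Ad cx Ux [r _]]]]]]; exists c, d, U, g. Qed.

Definition param_matrix (z : 'rV[R]_(4 + 4)) : 'M[H]_2 :=
  Sp11_of (lsubmx z : H) (normalize (rsubmx z : H)).

Lemma param_matrixP z : param_dom z -> [/\ Sp11 R (param_matrix z),
  inv_centre (param_matrix z) = lsubmx z & inv_rotor (param_matrix z) = normalize (rsubmx z : H)].
Proof. by move=> [P1 V0]; apply: Sp11_of_Sp11 => //; exact: nsq_normalize. Qed.

                                                                                     
                                        
Lemma param_matrix_smooth :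
  smooth_map (@param_dom R) (open_atlas (@param_dom R)) (Sp11_atlas R) param_matrix.
Proof.
have oD := @open_param_dom R.
apply: (smooth_corestr (@mx_atlas_compat R) _ Sp11_cover (open_atlas_compat oD)) => //.
  by move=> _ z -> /param_matrixP [].
apply: (mx_atlas_map oD); apply: (qsmooth_Sp11_of oD).
- by move=> z [].
- exact: (@qsmooth_lin R (4 + 4) _ lsubmx oD).
apply: (qsmooth_normalize oD); first by move=> z [].
exact: (@qsmooth_lin R (4 + 4) _ rsubmx oD).
Qed.

Lemma mobius_structure_quotient m (AM : atlas R (qball R -> qball R) m) :
  is_manifold (moebius_set R) AM ->
  diffeomorphism (coset_space R) AQ (moebius_set R) AM (@coset_mobius R) ->
  mobius_structure AM.
Proof.
move=> mAM [[im _ surj] SPhi [g [gK Sg]]].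
have cAM := manifold_compat mAM.
have gM f : moebius_set R f -> coset_space R (g f) /\ coset_mobius (g f) = f.
  by move=> /surj [Q SQ <-]; rewrite gK.
have Mf c f : AM c -> cdom c f -> moebius_set R f.
  by move=> Ac cf; have [_ -> _ _ _] := mAM; exists c.
split => //.
- apply: (smooth_map_ext (f := (fun Q => centre (coset_mobius Q) : 'rV[R]_4) \o g)).
    by move=> c f Ac cf /=; have [_ ->] := gM f (Mf c f Ac cf).
  by apply: (smooth_map_comp cAQ _ Sg quotient_centre) => f /gM [].
- apply: (smooth_map_ext (f := (fun Q => rotor (coset_mobius Q) : 'rV[R]_4) \o g)).
    by move=> c f Ac cf /=; have [_ ->] := gM f (Mf c f Ac cf).
  by apply: (smooth_map_comp cAQ _ Sg quotient_rotor) => f /gM [].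
apply: (smooth_map_ext (f := (@coset_mobius R \o @coset R) \o param_matrix)).
  by move=> _ z -> /param_matrixP [SX eX uX]; rewrite /= coset_mobiusE eX uX.
apply: (smooth_map_comp (M' := Sp11 R) cSp11 _ param_matrix_smooth) => [z /param_matrixP [] //|].
by apply: (smooth_map_comp cAQ _ coset_smooth SPhi) => X SX; exists X.
Qed.

End FromQuotient.

Section Structure.
Variables (m : nat) (AM : atlas R (qball R -> qball R) m).
Hypothesis MS : mobius_structure AM.

Let mAM := ms_manifold MS.
Let cAM : compat AM := manifold_compat mAM.
Let cfull p : compat (full p) := open_atlas_compat openT.

Lemma moebius_chart f : moebius_set R f -> exists2 c, AM c & cdom c f.
Proof. by have [_ -> _ _ _] := mAM. Qed.

Lemma chart_moebius c f : AM c -> cdom c f -> moebius_set R f.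
Proof. by move=> Ac cf; have [_ -> _ _ _] := mAM; exists c. Qed.

Lemma centre_rep c f : max_atlas AM c -> cdom c f ->
  smooth_rep c (open_chart (setT : set 'rV[R]_4)) (@centre R : _ -> 'rV[R]_4) f.
Proof.
move=> Mc cf; apply: (smooth_map_rep cAM (cfull 4) (ms_centre MS)) => //.
  by have [d Ad df] := max_atlas_cover Mc cf; exact: chart_moebius df.
exact: max_atlas_sub.
Qed.

Lemma rotor_rep c f : max_atlas AM c -> cdom c f ->
  smooth_rep c (open_chart (setT : set 'rV[R]_4)) (@rotor R : _ -> 'rV[R]_4) f.
Proof.
move=> Mc cf; apply: (smooth_map_rep cAM (cfull 4) (ms_rotor MS)) => //.
  by have [d Ad df] := max_atlas_cover Mc cf; exact: chart_moebius df.
exact: max_atlas_sub.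
Qed.

                                                                                   
                                                                                    
                          
Lemma evaluation_smooth : smooth_map (moebius_set R `*` [set: qball R])
  (prod_atlas AM (qball_atlas R)) (qball_atlas R) (fun z => z.1 z.2).
Proof.
move=> [f b] [/= Mf _]; have [c Ac cf] := moebius_chart Mf.
pose d : chart R (qball R) 4 := (setT, fun q : qball R => val q).
have cd : is_chart d.
  split; first by move=> p q _ _; exact: val_inj.
  rewrite (_ : _ @` _ = [set q : H | 0 < 1 - nsq q]).
    have S1 : smooths setT (fun q : H => 1 - nsq q).
      by apply: (smoothsB openT (smooths_cst _ 1)); apply: (smooths_nsq openT); exact: qsmooth_id.
    have := open_pos openT S1; rewrite (_ : [set _ | _] = [set q : H | 0 < 1 - nsq q]) //.
    by apply/seteqP; split=> q // [].
  apply/seteqP; split=> [_ [q _ <-]|q] /=; rewrite subr_gt0; first exact: ball_lt1.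
  by move=> /mk_ball [p <-]; exists p.
have [p1 p2] := prod_chart_proj (z := (f, b)) (cAM.1 _ Ac) cd cf I.
have Mc := max_atlas_sub cAM Ac.
have r1 := smooth_rep_comp p1 (centre_rep Mc cf).
have r2 := smooth_rep_comp p1 (rotor_rep Mc cf).
have r3 : smooth_rep (prod_chart c d) (open_chart (setT : set 'rV[R]_4))
    ((fun q : qball R => val q : 'rV[R]_4) \o snd) (f, b).
  apply: smooth_rep_comp p2 _; exists (cmap d @` cdom d), id.
  split => //; first by exists b.
  split => //; [exact: cd.2|exact: (@smooth_on_lin _ _ _ cd.2 _ idfun)].
have r := smooth_rep_row (smooth_rep_row r1 r2) r3.
pose P (v : 'rV[R]_(4 + 4 + 4)) : H := lsubmx (lsubmx v).
pose U (v : 'rV[R]_(4 + 4 + 4)) : H := rsubmx (lsubmx v).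
pose q (v : 'rV[R]_(4 + 4 + 4)) : H := rsubmx v.
have SP W : open W -> qsmooth W P by move=> oW; exact: (@qsmooth_lin R _ W (lsubmx \o lsubmx) oW).
have SU W : open W -> qsmooth W U by move=> oW; exact: (@qsmooth_lin R _ W (rsubmx \o lsubmx) oW).
have Sq W : open W -> qsmooth W q by move=> oW; exact: (@qsmooth_lin R _ W rsubmx oW).
pose V := [set v | symw (mobw (P v) (U v)) (q v) != 0].
have oV : open V.
  have Sw : qsmooth setT (fun v => mobw (P v) (U v)).
    apply: (qsmoothN openT); apply: (qsmoothM openT); first exact: SU openT.
    by apply: (qsmooth_conj openT); exact: SP openT.
  have := open_pos openT (smooths_nsq openT (qsmooth_symw openT Sw (Sq _ openT))).
  rewrite (_ : [set _ | _] = V) //.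
  by apply/seteqP; split=> v /=; rewrite nsq_gt0 // => -[].
have Sh : smooth_on V (fun v => mob (P v) (U v) (q v) : 'rV[R]_4).
  apply (@qsmoothP R _ V oV (fun v => mob (P v) (U v) (q v))).
  by apply: (qsmooth_mob oV); [exact: SP|exact: SU|exact: Sq|].
have PUq g (b' : qball R) : let v := row_mx (row_mx (centre g : 'rV[R]_4) (rotor g : 'rV[R]_4)) (val b' : 'rV[R]_4) in
    [/\ P v = centre g, U v = rotor g & q v = val b'].
  by rewrite /P /U /q /= !row_mxKl !row_mxKr.
have Vf : V (row_mx (row_mx (centre f : 'rV[R]_4) (rotor f : 'rV[R]_4)) (val b : 'rV[R]_4)).
  have [E1 E2 E3] := PUq f b; rewrite /V /= E1 E2 E3.
  have [P1 U1 _] := moebius_paramP Mf; apply: symw_neq0; rewrite nsq_mobw //.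
  have := nsq_ge0 (centre f); have := nsq_ge0 (val b); have := ball_lt1 b; nra.
have [W [g [_ Wx r']]] : smooth_rep (prod_chart c d) d (fun z => z.1 z.2) (f, b).
  apply: (smooth_rep_through r oV Vf Sh) => -[g b'] [/= cg _] _; split => //.
  have [E1 E2 E3] := PUq g b'; rewrite /= E1 E2 E3 /cmap /=.
  by have [P1 U1 {1}->] := moebius_paramP (chart_moebius Ac cg); rewrite mob_ballE.
exists (prod_chart c d), d, W, g; split => //.
exact: prod_atlas_chart.
Qed.

End Structure.
End MobiusParametrisation.

                                             

Section MobiusCharts.
Variable R : realType.
Local Notation H := (quat R).

Lemma smooth_on0 m n (U : set 'rV[R]_m) : open U -> smooth_on U (fun=> 0 : 'rV[R]_n).
Proof.
by move=> oU; apply/(smooth_onE oU) => j; apply: smooths_ext (smooths_cst _ 0) => // x _; rewrite mxE.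
Qed.

                                                                                    
                                                                                     
Definition mobius_chart (u : H) : chart R (qball R -> qball R) (3 + 4) :=
  ([set f | moebius_set R f /\ sphere_dom u (rotor f)],
   fun f => row_mx (first_coords 3 (sphere_map u (rotor f) : 'rV[R]_4)) (centre f : 'rV[R]_4)).

Definition mobius_chart_rotor (u : H) (v : 'rV[R]_(3 + 4)) : H :=
  sphere_inv u (pad_coords 4 (lsubmx v)).

Lemma pad3 (v : 'rV[R]_3) : qcoord (pad_coords 4 v : H) 3 = 0.
Proof. by rewrite /qcoord pad_coords_ge // inordK. Qed.

Lemma mobius_chart_rotorP u v : nsq u = 1 ->
  [/\ nsq (mobius_chart_rotor u v) = 1, sphere_dom u (mobius_chart_rotor u v) &
      sphere_map u (mobius_chart_rotor u v) = pad_coords 4 (lsubmx v)].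
Proof.
move=> u1; have h : 0 < qcoord (pad_coords 4 (lsubmx v) : H) 3 + 2 by rewrite pad3 add0r.
have [d E] := sphere_invK u1 h; split => //.
by apply/(sphere_map_eq0 u1 d); rewrite E pad3.
Qed.

Lemma mobius_chart_rotorK u f : nsq u = 1 -> cdom (mobius_chart u) f ->
  mobius_chart_rotor u (cmap (mobius_chart u) f) = rotor f /\
  rsubmx (cmap (mobius_chart u) f) = centre f.
Proof.
move=> u1 [Mf df]; have [P1 U1 _] := moebius_paramP Mf.
rewrite /mobius_chart_rotor /cmap /= row_mxKl row_mxKr; split => //.
rewrite first_coordsK ?sphere_mapK // => j j3.
have := (sphere_map_eq0 u1 df).1 U1; rewrite /qcoord; congr (_ = _); congr (_ _ _).
by apply: val_inj; rewrite /= inordK //; apply/eqP; rewrite eqn_leq j3 /= -ltnS ltn_ord.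
Qed.

                                                                                      
                 
Lemma mobius_chart_image u : nsq u = 1 ->
  cmap (mobius_chart u) @` cdom (mobius_chart u) = [set v | nsq (rsubmx v : H) < 1].
Proof.
move=> u1; apply/seteqP; split=> [_ [f df <-]|v /= P1].
  rewrite /= (mobius_chart_rotorK u1 df).2; by case: df => /moebius_paramP [].
have [U1 dU EU] := mobius_chart_rotorP v u1.
exists (mob_ball (rsubmx v : H) (mobius_chart_rotor u v)).
  by split; [exact: moebius_set_mob|rewrite rotorE].
by rewrite /cmap /= rotorE // centreE // EU pad_coordsK // hsubmxK.
Qed.

Lemma open_mobius_image : open [set v : 'rV[R]_(3 + 4) | nsq (rsubmx v : H) < 1].
Proof.
have Sr := @qsmooth_lin R _ setT rsubmx (@openT 'rV[R]_(3 + 4)).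
have := open_pos openT (smoothsB openT (smooths_cst _ 1) (smooths_nsq openT Sr)).
rewrite (_ : [set _ | _] = [set v : 'rV[R]_(3 + 4) | nsq (rsubmx v : H) < 1]) //.
by apply/seteqP; split=> v /=; rewrite subr_gt0 // => -[].
Qed.

Lemma mobius_chart_ok u : nsq u = 1 -> is_chart (mobius_chart u).
Proof.
move=> u1; split; last by rewrite mobius_chart_image //; exact: open_mobius_image.
move=> f g /set_mem df /set_mem dg E.
have [E1 E2] := mobius_chart_rotorK u1 df; have [E3 E4] := mobius_chart_rotorK u1 dg.
have [_ _ ->] := moebius_paramP df.1; have [_ _ ->] := moebius_paramP dg.1.
by rewrite -E1 -E2 -E3 -E4 E.
Qed.

Section Structure.
Variables (m : nat) (AM : atlas R (qball R -> qball R) m).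
Hypothesis MS : mobius_structure AM.

Let mAM := ms_manifold MS.
Let cAM : compat AM := manifold_compat mAM.

                                                                      
Lemma mobius_chart_to u d f : nsq u = 1 -> AM d -> cdom d f -> cdom (mobius_chart u) f ->
  smooth_rep d (mobius_chart u) id f.
Proof.
move=> u1 Ad df cf; have Md := max_atlas_sub cAM Ad.
have r := smooth_rep_row (centre_rep MS Md df) (rotor_rep MS Md df).
pose V := [set z : 'rV[R]_(4 + 4) | sphere_dom u (rsubmx z : H)].
have Sr := @smooth_on_lin R (4 + 4) setT openT 4 rsubmx.
have oV : open V.
  have := open_preimage openT Sr (@open_sphere_dom R u).
  by rewrite (_ : [set _ | _] = V) //; apply/seteqP; split=> z // [].
have Sr' : qsmooth V (rsubmx : 'rV[R]_(4 + 4) -> H) by exact: (@qsmooth_lin R (4 + 4) V rsubmx oV).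
have Sh : smooth_on V (fun z : 'rV[R]_(4 + 4) =>
    row_mx (first_coords 3 (sphere_map u (rsubmx z : H) : 'rV[R]_4)) (lsubmx z)).
  apply: (smooth_on_row_mx oV); last exact: smooth_on_lin.
  apply: (smooth_on_comp oV openT _ _ (@smooth_on_first_coords R 4 3 setT openT)) => //.
  apply (@qsmoothP R _ V oV (fun z => sphere_map u (rsubmx z : H))).
  by apply: (qsmooth_sphere_map oV).
apply: (smooth_rep_through r oV _ Sh); first by rewrite /V /= row_mxKr; case: cf.
move=> g dg; rewrite /V /= row_mxKr row_mxKl => sg; split; last by reflexivity.
by split; [exact: (chart_moebius MS Ad dg)|exact: sg].
Qed.

                                                                                     
                                       
Lemma mobius_chart_from u d f : nsq u = 1 -> AM d -> cdom d f -> cdom (mobius_chart u) f ->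
  smooth_rep (mobius_chart u) d id f.
Proof.
move=> u1 Ad df cf; have oD := @open_param_dom R; have oI := open_mobius_image.
pose kappa (g : qball R -> qball R) : 'rV[R]_(4 + 4) :=
  row_mx (centre g : 'rV[R]_4) (rotor g : 'rV[R]_4).
have kD g : moebius_set R g -> param_dom (kappa g) /\ param_mobius (kappa g) = g.
  move=> /moebius_paramP [P1 U1 E]; rewrite /param_dom /param_mobius /kappa /= row_mxKl row_mxKr.
  by rewrite normalize_id // -nsq_gt0 U1.
have Mf := cf.1; have [Df Ef] := kD f Mf.
have r1 : smooth_rep (mobius_chart u) (open_chart (@param_dom R)) kappa f.
  exists [set v | nsq (rsubmx v : H) < 1],
    (fun v => row_mx (rsubmx v) (mobius_chart_rotor u v : 'rV[R]_4)).
  split; [exact: cf|by rewrite -(mobius_chart_image u1); exists f|].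
  split; [exact: oI|by rewrite mobius_chart_image| |].
    apply: (smooth_on_row_mx oI); first exact: smooth_on_lin.
    apply (@qsmoothP R _ _ oI (mobius_chart_rotor u)).
    apply: (qsmooth_sphere_inv _ oI); apply/(qsmoothP oI).
    apply: (smooth_on_comp oI openT _ _ (@smooth_on_pad_coords R 4 3 setT openT)) => //.
    exact: smooth_on_lin.
  move=> g cg _; have [E1 E2] := mobius_chart_rotorK u1 cg; have [Dg _] := kD g cg.1.
  by split; [exact: Dg|rewrite /= E1 E2].
have r2 : smooth_rep (open_chart (@param_dom R)) d (@param_mobius R) (kappa f).
  apply: (smooth_map_rep (open_atlas_compat oD) cAM (ms_param MS)) => //.
  - exact: (max_atlas_sub (open_atlas_compat oD)).
  - exact: max_atlas_sub.
  by rewrite Ef.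
apply: (smooth_rep_ext _ (smooth_rep_comp r1 r2)) => g [Mg _] /=.
by have [_ ->] := kD g Mg.
Qed.

                                                                                  
                   
Lemma mobius_dim : m = (3 + 4)%N.
Proof.
                                    
have one1 := @nsq1 R; have z1 : nsq (0 : H) < 1 by rewrite nsq0.
have M1 : moebius_set R (mob_ball 0 1) by exact: moebius_set_mob.
have [d Ad df] := moebius_chart MS M1.
have c1 : cdom (mobius_chart 1) (mob_ball 0 1).
  by split; [exact: M1|rewrite rotorE //; exact: sphere_dom_self].
have r1 := mobius_chart_to one1 Ad df c1; have r2 := mobius_chart_from one1 Ad df c1.
by apply/eqP; rewrite eqn_leq (smooth_rep_dim r1 r2) (smooth_rep_dim r2 r1).
Qed.

End Structure.

Section Isotropy.
Variable AM : atlas R (qball R -> qball R) (3 + 4).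
Hypothesis MS : mobius_structure AM.

Let mAM := ms_manifold MS.
Let cAM : compat AM := manifold_compat mAM.

Lemma mobius_chart_max u : nsq u = 1 -> max_atlas AM (mobius_chart u).
Proof.
move=> u1; apply: (max_atlasP cAM); first exact: mobius_chart_ok.
  by move=> f [/(moebius_chart MS) [d Ad df] _]; exists d.
move=> d f Ad cf df; split; first exact: (mobius_chart_from MS).
exact: (mobius_chart_to MS).
Qed.

Lemma mobius_chart_slice u : nsq u = 1 -> slice_chart AM (isotropy0 R) 3 (mobius_chart u).
Proof.
move=> u1; split; first exact: mobius_chart_max.
move=> f [Mf df]; rewrite isotropy0_centre /cmap /=; split=> [[_ f0] j j3|E].
  rewrite mxE; case: (fintype.splitP j) => i ji; last by rewrite f0 mxE.
  by move: j3; rewrite ji leqNgt ltn_ord.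
split => //; by apply/rowP => i; rewrite mxE -(E (rshift 3 i)) ?row_mxEr.
Qed.

Lemma isotropy0_model : sphere_model AM (isotropy0 R) 3 (@rotor R) mobius_chart.
Proof.
split => //.
- by move=> f /isotropy0_centre [/moebius_paramP []].
- exact: mobius_chart_slice.
- by move=> u f u1 cf; apply: (rotor_rep MS) => //; exact: mobius_chart_max.
move=> u u1; exists (sphere_dom u), (fun q => row_mx (first_coords 3 (sphere_map u q : 'rV[R]_4)) 0).
split => //.
- exact: open_sphere_dom.
- exact: sphere_dom_self.
- have oV := @open_sphere_dom R u; apply: (smooth_on_row_mx oV).
    apply: (smooth_on_comp oV openT _ _ (@smooth_on_first_coords R 4 3 setT openT)) => //.
    exact: smooth_sphere_map.
  exact: smooth_on0.
move=> f /isotropy0_centre [Mf f0] df; split; first by split; [exact: Mf|exact: df].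
by rewrite /cmap /= f0.
Qed.

Lemma compact_Sp1 : compact ([set q | nsq q = 1] : set 'rV[R]_4).
Proof.
apply: bounded_closed_compact.
  exists 1; split => // r r1 q q1; apply: row_norm_le.
    by apply: ltW; apply: lt_trans r1.
  move=> i; have := nsq_coord q (ltn_ord i); rewrite q1 /qcoord inord_val => h.
  apply: le_trans (ltW r1); rewrite -(ler_pXn2r (n := 2)) ?nnegrE // expr1n.
  by rewrite real_normK ?num_real.
have S1 : smooths setT (fun q : H => nsq q) by apply: (smooths_nsq openT); exact: qsmooth_id.
have o1 := open_pos openT (smoothsB openT (smooths_cst _ 1) S1).
have o2 := open_pos openT (smoothsB openT S1 (smooths_cst _ 1)).
rewrite -openC; have := openU o1 o2; congr open.
apply/seteqP; split=> q /=; rewrite !subr_gt0.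
  by case=> -[_ h] E; move: h; rewrite E ltxx.
by move=> /eqP; rewrite neq_lt => /orP[]; [left|right].
Qed.

                                                                                      
       
Lemma isotropy0_compact : compact_in AM (isotropy0 R).
Proof.
move=> F oF cF; have z1 : nsq (0 : H) < 1 by rewrite nsq0.
have oD := @open_param_dom R.
pose nu (q : 'rV[R]_4) : 'rV[R]_(4 + 4) := row_mx 0 q.
have Snu : smooth_on setT nu.
  apply: (smooth_on_row_mx openT); last exact: (@smooth_on_lin _ _ _ openT _ idfun).
  exact: (@smooth_on0 4 4 setT openT).
pose W V := [set q : 'rV[R]_4 | param_dom (nu q) /\ V (param_mobius (nu q))].
have oW V : F V -> open (W V).
  move=> /oF oV; have o1 := smooth_map_open cAM oD (ms_param MS) oV.
  have := open_preimage openT Snu o1; rewrite (_ : [set _ | _] = W V) //.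
  by apply/seteqP; split=> q // [].
have nuE q : nsq q = 1 -> param_dom (nu q) /\ param_mobius (nu q) = mob_ball 0 q.
  move=> q1; rewrite /param_dom /param_mobius /nu /= row_mxKl row_mxKr normalize_id //.
  by rewrite -nsq_gt0 q1.
have := compact_Sp1; rewrite compact_cover => /(_ _ F W oW) [|D DF cov].
  move=> q q1; have [Dq Eq] := nuE q q1.
  have [V FV Vq] : (\bigcup_(V in F) V) (mob_ball 0 q) by apply: cF; apply/isotropy0P; exists q.
  by exists V => //; split => //; rewrite Eq.
eexists; split; [exact: (finite_fset D)|by move=> V /= /DF; rewrite inE|].
move=> _ /isotropy0P [U U1 ->]; have [V DV [_ VU]] := cov U U1.
by exists V => //; have [_ <-] := nuE U U1.
Qed.

End Isotropy.
End MobiusCharts.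

                                                 

Section LieGroups.
Variable R : realType.
Local Notation H := (quat R).

Let sub_lin := @qsmooth_lin R (4 + 4) setT.

Lemma smooth_quat_mul :
  smooth_on setT (fun z : 'rV[R]_(4 + 4) => (lsubmx z : H) * (rsubmx z : H) : 'rV[R]_4).
Proof.
apply (@qsmoothP R _ _ openT (fun z : 'rV[R]_(4 + 4) => (lsubmx z : H) * (rsubmx z : H))).
by apply: (qsmoothM openT); [exact: (sub_lin lsubmx openT)|exact: (sub_lin rsubmx openT)].
Qed.

Lemma smooth_quat_mul_op :
  smooth_on setT (fun z : 'rV[R]_(4 + 4) => (rsubmx z : H) * (lsubmx z : H) : 'rV[R]_4).
Proof.
apply (@qsmoothP R _ _ openT (fun z : 'rV[R]_(4 + 4) => (rsubmx z : H) * (lsubmx z : H))).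
by apply: (qsmoothM openT); [exact: (sub_lin rsubmx openT)|exact: (sub_lin lsubmx openT)].
Qed.

Lemma mul_conj1 (q : H) : nsq q = 1 -> qconj q * q = 1 /\ q * qconj q = 1.
Proof. by move=> q1; rewrite mul_conjq mul_qconj q1 scale1r. Qed.

Lemma Sp1_lie_group : lie_group (Sp1 R) (Sp1_atlas R) *%R.
Proof.
have E (q : H) : Sp1 R q -> nsq q = 1 by move/Sp1P.
apply: (sphere_lie_group (Sp1_model R) (@quat_manifold R) _ smooth_quat_mul
  (e := 1) (inv := @qconj R)) => //.
- exact: mulrA.
- exact: mul1r.
- exact: mulr1.
- exact: mul_conj1.
- by apply/Sp1P; exact: nsq1.
- by move=> p q /E p1 /E q1; split => //; apply/Sp1P; rewrite nsqM p1 q1 mulr1.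
by move=> p /E p1; split => //; apply/Sp1P; rewrite nsq_conj.
Qed.

Definition rot_mobius (u : H) : qball R -> qball R := mob_ball 0 u.

                                                                       
Lemma rot_mobiusP u : nsq u = 1 ->
  [/\ isotropy0 R (rot_mobius u), rotor (rot_mobius u) = u & is_right_mul u (rot_mobius u)].
Proof.
move=> u1; have z1 : nsq (0 : H) < 1 by rewrite nsq0.
by split; [apply/isotropy0P; exists u|rewrite /rot_mobius rotorE|apply/is_right_mulP].
Qed.

Lemma isotropy0_rotor f : isotropy0 R f -> nsq (rotor f) = 1 /\ f = rot_mobius (rotor f).
Proof. by move=> /isotropy0P [u u1 ->]; have [_ E _] := rot_mobiusP u1; rewrite E. Qed.

Lemma rot_mobius_comp u v : nsq u = 1 -> nsq v = 1 ->
  rot_mobius u \o rot_mobius v = rot_mobius (v * u).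
Proof.
move=> u1 v1; have uv : nsq (v * u) = 1 by rewrite nsqM u1 v1 mulr1.
have [_ _ Ru] := rot_mobiusP u1; have [_ _ Rv] := rot_mobiusP v1.
by apply/is_right_mulP => // q; rewrite /= Ru Rv mulrA.
Qed.

Lemma rotor_comp f g : isotropy0 R f -> isotropy0 R g ->
  isotropy0 R (f \o g) /\ rotor (f \o g) = rotor g * rotor f.
Proof.
move=> /isotropy0P [u u1 ->] /isotropy0P [v v1 ->].
have uv : nsq (v * u) = 1 by rewrite nsqM u1 v1 mulr1.
have [_ -> _] := rot_mobiusP u1; have [_ -> _] := rot_mobiusP v1.
by have [I E _] := rot_mobiusP uv; rewrite -/(rot_mobius u) -/(rot_mobius v) rot_mobius_comp.
Qed.

Section Isotropy.
Variable AM : atlas R (qball R -> qball R) (3 + 4).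
Hypothesis MS : mobius_structure AM.

Lemma isotropy0_submanifold : submanifold AM (isotropy0 R) 3.
Proof. exact: sphere_model_submanifold (isotropy0_model MS). Qed.

Lemma isotropy0_lie_group : lie_group (isotropy0 R) (sub_atlas AM (isotropy0 R) 3)
  (fun f g => f \o g).
Proof.
have [I1 E1 _] := rot_mobiusP (@nsq1 R).
apply: (sphere_lie_group (m := fun p q => q * p) (e := rot_mobius 1)
  (inv := fun f => rot_mobius (qconj (rotor f)))
  (isotropy0_model MS) (ms_manifold MS) _ smooth_quat_mul_op).
- by move=> f [].
- move=> f g /isotropy0_rotor [_ Ef] /isotropy0_rotor [_ Eg] E; rewrite Ef E; exact: esym.
- by move=> p q r; rewrite mulrA.
- exact: mulr1.
- exact: mul1r.
- by move=> p /mul_conj1 [].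
- exact: I1.
- exact: E1.
- exact: rotor_comp.
move=> f /isotropy0_rotor [u1 _]; rewrite -nsq_conj in u1.
by have [] := rot_mobiusP u1.
Qed.

                                                                                  
                             
Definition inv_rotation (u : H) : qball R -> qball R := rot_mobius (qconj u).

Lemma inv_rotationP u : nsq u = 1 -> isotropy0 R (inv_rotation u) /\ rotor (inv_rotation u) = qconj u.
Proof. by rewrite -nsq_conj => /rot_mobiusP []. Qed.

                                                                                      
                                                                              
Lemma inv_rotation_iso : lie_group_iso (Sp1 R) (Sp1_atlas R) *%R (isotropy0 R)
  (sub_atlas AM (isotropy0 R) 3) (fun f g => f \o g) inv_rotation.
Proof.
have M1 := Sp1_model R; have M2 := isotropy0_model MS.
have rI u : Sp1 R u -> isotropy0 R (inv_rotation u) /\ rotor (inv_rotation u) = qconj u by move=> /Sp1P /inv_rotationP.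
pose g f := qconj (rotor f : H).
have gS f : isotropy0 R f -> Sp1 R (g f) /\ g f = qconj (rotor f).
  by move=> /isotropy0_rotor [u1 _]; split => //; apply/Sp1P; rewrite nsq_conj.
split; [exact: Sp1_lie_group|exact: isotropy0_lie_group| |].
  split; [split| |].
  - by move=> u /rI [].
  - move=> u v /set_mem Su /set_mem Sv E; rewrite -[u]qconjK -[v]qconjK.
    by have [_ <-] := rI u Su; have [_ <-] := rI v Sv; rewrite E.
  - move=> f If; have [Sg _] := gS f If; exists (g f) => //.
    by have [_ Ef] := isotropy0_rotor If; rewrite /inv_rotation /g qconjK -Ef.
  - exact: (sphere_model_map M1 M2 rI).
  exists g; split; last exact: (sphere_model_map M2 M1 gS).
  by move=> u /rI [_ E]; rewrite /g E qconjK.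
move=> u v /Sp1P u1 /Sp1P v1; rewrite /inv_rotation rot_mobius_comp ?nsq_conj //.
by rewrite qconjM.
Qed.

End Isotropy.

End LieGroups.

Theorem theorem4p2p1 (R : realType) (n : nat)
    (AQ : atlas R (set 'M[quat R]_2) n)
    (AQ_manifold : is_manifold (coset_space R) AQ)
    (AQ_submersion : submersion (Sp11 R) (Sp11_atlas R) AQ (@coset R)) :
  exists Phi : set 'M[quat R]_2 -> (qball R -> qball R),
  [/\ (forall A A' : 'M[quat R]_2, Sp11 R A -> A *m A' = 1%:M -> A' *m A = 1%:M ->
         is_moebius A' (Phi (coset A))),
      set_bij (coset_space R) (moebius_set R) Phi,
      (exists (m : nat) (AM : atlas R (qball R -> qball R) m),
         is_manifold (moebius_set R) AM /\
         diffeomorphism (coset_space R) AQ (moebius_set R) AM Phi) &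
      forall (m : nat) (AM : atlas R (qball R -> qball R) m),
        is_manifold (moebius_set R) AM ->
        diffeomorphism (coset_space R) AQ (moebius_set R) AM Phi ->
        [/\ smooth_map (moebius_set R `*` [set: qball R])
              (prod_atlas AM (qball_atlas R)) (qball_atlas R)
              (fun z => z.1 z.2),
            (forall p q : qball R, exists2 f, moebius_set R f & f p = q),
            isotropy0 R = [set f | exists2 u : quat R, Sp1 R u & is_right_mul u f] &
            exists k : nat,
              [/\ submanifold AM (isotropy0 R) k,
                  compact_in AM (isotropy0 R),
                  lie_group (isotropy0 R) (sub_atlas AM (isotropy0 R) k)
                    (fun f g => f \o g) &
                  exists rho : quat R -> (qball R -> qball R),
                    (forall u, Sp1 R u -> is_right_mul u^-1 (rho u)) /\
                    lie_group_iso (Sp1 R) (Sp1_atlas R) *%R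
                      (isotropy0 R) (sub_atlas AM (isotropy0 R) k)
                      (fun f g => f \o g) rho]]].
Proof.
exists (@coset_mobius R); split.
- move=> A A' SA AA' _; rewrite (Sp11_inv_unique SA AA') coset_mobiusE.
  exact/is_moebius_inv.
- exact: coset_mobius_bij.
- exists n, (transport_atlas AQ (@coset_mobius R) (@mobius_coset R)).
  rewrite -coset_space_image; split.
    exact: (transport_manifold AQ_manifold (@coset_mobiusK R)).
  exact: (transport_diffeo AQ_manifold (@coset_mobiusK R)).
move=> m AM mAM dAM; have MS := mobius_structure_quotient AQ_manifold AQ_submersion mAM dAM.
have m7 := mobius_dim MS; subst m.
split; [exact: evaluation_smooth|exact: mobius_transitive|exact: isotropy0E|].
exists 3; split.
- exact: isotropy0_submanifold.
- exact: isotropy0_compact.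
- exact: isotropy0_lie_group.
exists (@inv_rotation R); split; last exact: inv_rotation_iso.
move=> u /Sp1P u1; rewrite (invr_Sp1 u1); have u1' : nsq (qconj u) = 1 by rewrite nsq_conj.
by have [_ _] := rot_mobiusP u1'.
Qed.
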